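(* Let $\boldsymbol\omega:\mathbb{S}^2\to\mathbb{S}^4$ be an $\mathbb{S}^1$-equivariant harmonic sphere. If $\boldsymbol\omega$ is linearly full, then it can be recovered as (up to sign) the composition of the twistor fibration $\boldsymbol\tau:\mathbb{C}P^3\to\mathbb{S}^4$ with its $\mathbb{S}^1$-equivariant, holomorphic and horizontal twistor lift $\widetilde{\boldsymbol\omega}:\mathbb{C}P^1\to\mathbb{C}P^3$. More explicitly, set $\epsilon=+1$ if $\boldsymbol\omega(-S^{(2)})=-S^{(4)}$ and $\epsilon=-1$ if $\boldsymbol\omega(-S^{(2)})=S^{(4)}$. Then: (1) $\epsilon\,\boldsymbol\omega=\boldsymbol\tau\circ\widetilde{\boldsymbol\omega}$, where $\widetilde{\boldsymbol\omega}$ is the positive lift of $\epsilon\,\boldsymbol\omega$. (2) There exist $\mu_1,\mu_2\in\mathbb{C}\setminus\{0\}$ such that $$\widetilde{\boldsymbol\omega}([z_0,z_1])=\Big[z_0^3,\ \mu_1z_0^2z_1,\ \mu_2z_0z_1^2,\ -\tfrac{\mu_1\mu_2}{3}z_1^3\Big].$$ (3) With these $\mu_1,\mu_2$, the map $\epsilon\,\boldsymbol\omega$ is given by $$\epsilon\,\boldsymbol\omega([z_0,z_1])=\frac1D\Big(|z_0|^6-|\mu_1|^2|z_0|^4|z_1|^2-|\mu_2|^2|z_0|^2|z_1|^4+\tfrac{|\mu_1|^2|\mu_2|^2}{9}|z_1|^6,\ 2\mu_1\overline{z_0}z_1\big(|z_0|^4-\tfrac{|\mu_2|^2}{3}|z_1|^4\big),\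 2\mu_2\overline{z_0}^2z_1^2\big(|z_0|^2+\tfrac{|\mu_1|^2}{3}|z_1|^2\big)\Big),$$ where $D=|z_0|^6+|\mu_1|^2|z_0|^4|z_1|^2+|\mu_2|^2|z_0|^2|z_1|^4+\frac{|\mu_1|^2|\mu_2|^2}{9}|z_1|^6$.
   Context: $\mathbb{S}^4$ is the unit sphere of $\mathbb{R}\oplus\mathbb{C}\oplus\mathbb{C}$, on which $\mathbb{S}^1$ (rotations $R_\alpha$ of angle $\alpha$) acts by $R_\alpha\cdot(t,\zeta_1,\zeta_2)=(t,e^{i\alpha}\zeta_1,e^{2i\alpha}\zeta_2)$; $\mathbb{S}^1$ acts on $\mathbb{S}^2\subset\mathbb{R}^3$ by rotations about the $x_3$-axis, on $\mathbb{C}P^1$ by $[z_0,z_1]\mapsto[z_0,e^{i\alpha}z_1]$, and on $\mathbb{C}P^3$ by $[w_0,w_1,w_2,w_3]\mapsto[w_0,e^{i\alpha}w_1,e^{2i\alpha}w_2,e^{3i\alpha}w_3]$. Maps are $\mathbb{S}^1$-equivariant if they commute with these actions. $S^{(2)}=(0,0,-1)\in\mathbb{S}^2$, $S^{(4)}=(-1,0,0)\in\mathbb{S}^4$; equivariant continuous maps satisfy $\boldsymbol\omega(-S^{(2)})\in\{\pm S^{(4)}\}$. $\mathbb{S}^2$ is identified with $\mathbb{C}P^1$ equivariantly by stereographic projection $\boldsymbol\sigma_2(x)=\frac{x_1+ix_2}{1+x_3}=z=z_1/z_0$ (with $S^{(2)}\leftrightarrow[0,1]$, $-S^{(2)}\leftrightarrow[1,0]$).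 A harmonic sphere is a smooth harmonic map $\boldsymbol\omega:\mathbb{S}^2\to\mathbb{S}^4$, i.e. $\Delta_T\boldsymbol\omega+|\nabla_T\boldsymbol\omega|^2\boldsymbol\omega=0$; it is linearly full if its image spans $\mathbb{R}\oplus\mathbb{C}\oplus\mathbb{C}$ over $\mathbb{R}$. Twistor fibration: $$\boldsymbol\tau([w_0,w_1,w_2,w_3])=\frac{\big(|w_0|^2+|w_3|^2-|w_1|^2-|w_2|^2,\ 2(\overline{w_0}w_1+\overline{w_2}w_3),\ 2(\overline{w_0}w_2-\overline{w_1}w_3)\big)}{|w_0|^2+|w_1|^2+|w_2|^2+|w_3|^2}.$$ A holomorphic map $\mathbb{C}P^1\to\mathbb{C}P^3$ is horizontal if the range of its differential at each point is orthogonal (for the Fubini–Study metric) to the fiber of $\boldsymbol\tau$ through the image point. Positive lift: for a linearly full equivariant harmonic sphere $\boldsymbol\psi=(\boldsymbol\psi_0,\boldsymbol\psi_1,\boldsymbol\psi_2)$ with $\boldsymbol\psi(-S^{(2)})=-S^{(4)}$, put $\xi=\frac{\boldsymbol\psi_1}{1+\boldsymbol\psi_0}$, $\eta=\frac{\boldsymbol\psi_2}{1+\boldsymbol\psi_0}$, regarded via $\boldsymbol\sigma_2^{-1}$ as functions of $z\in\mathbb{C}$. The positive lift of $\boldsymbol\psi$ is the map defined for $z\in\mathbb{C}\setminus\{0\}$ by $[\bar\xi_{\bar z},\ \bar\xi_{\bar z}\xi+\eta_{\bar z}\bar\eta,\ \bar\xi_{\bar z}\eta-\eta_{\bar z}\bar\xi,\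 -\eta_{\bar z}]$ where $(\bar\xi_{\bar z},\eta_{\bar z})\ne(0,0)$ and by $[\bar\eta_{\bar z},\ \bar\eta_{\bar z}\xi-\xi_{\bar z}\bar\eta,\ \bar\eta_{\bar z}\eta+\xi_{\bar z}\bar\xi,\ \xi_{\bar z}]$ where $(\xi_{\bar z},\bar\eta_{\bar z})\neq(0,0)$ (the two expressions agree on overlaps), and extended holomorphically to $\mathbb{C}P^1$. Here subscript $\bar z$ denotes the Wirtinger derivative $\partial_{\bar z}$. *)

(* Defs.v *)
From Stdlib Require Import Reals List.
From Coquelicot Require Import Coquelicot.
Import ListNotations.
Open Scope R_scope.

(** The ambient spaces R^3 and R + C + C, and the spheres in them.  Maps
    S^2 -> S^4 are functions [R3 -> E5]; only their values on [S2] matter. *)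

Definition R3 : Type := (R * R * R)%type.
Definition E5 : Type := (R * C * C)%type.

Definition norm3 (x : R3) : R :=
  let '(x1, x2, x3) := x in sqrt (x1 ^ 2 + x2 ^ 2 + x3 ^ 2).

Definition S2 (x : R3) : Prop :=
  let '(x1, x2, x3) := x in x1 ^ 2 + x2 ^ 2 + x3 ^ 2 = 1.

Definition S4 (y : E5) : Prop :=
  let '(t, zeta1, zeta2) := y in t ^ 2 + Cmod zeta1 ^ 2 + Cmod zeta2 ^ 2 = 1.

Definition S2pole : R3 := (0, 0, -1).
Definition S4pole : E5 := (-1, RtoC 0, RtoC 0).

Definition cis (alpha : R) : C := (cos alpha, sin alpha).

Definition rotS2 (alpha : R) (x : R3) : R3 :=
  let '(x1, x2, x3) := x in
  (cos alpha * x1 - sin alpha * x2, sin alpha * x1 + cos alpha * x2, x3).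

Definition rotS4 (alpha : R) (y : E5) : E5 :=
  let '(t, zeta1, zeta2) := y in
  (t, (cis alpha * zeta1)%C, (cis (2 * alpha) * zeta2)%C).

Definition equivariant (omega : R3 -> E5) : Prop :=
  forall (alpha : R) (x : R3), S2 x ->
    omega (rotS2 alpha x) = rotS4 alpha (omega x).

(** Tangential calculus on S^2, by means of the extension [f o radial] of [f]
    that is constant along rays.  At a point of S^2 its Euclidean gradient is
    the tangential gradient, so [tgrad e f] is the component of the tangential
    gradient along [e], and the surface divergence of a tangential field [v] is
    the sum over the standard basis of [tgrad e] applied to the component of [v]
    along [e]. *)

Definition radial (x : R3) : R3 := scal (/ norm3 x) x.

Definition basis3 : list R3 := [(1, 0, 0); (0, 1, 0); (0, 0, 1)].

Definition Rsum (l : list R) : R := fold_right Rplus 0 l.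

Definition partial (e : R3) (f : R3 -> R) (x : R3) : R :=
  Derive (fun t : R => f (plus x (scal t e))) 0.

Definition tgrad (e : R3) (f : R3 -> R) (x : R3) : R :=
  partial e (fun y => f (radial y)) x.

Definition laplaceT (f : R3 -> R) (x : R3) : R :=
  Rsum (map (fun e => tgrad e (tgrad e f) x) basis3).

Definition coords : list (E5 -> R) :=
  [fun y => fst (fst y);
   fun y => Re (snd (fst y)); fun y => Im (snd (fst y));
   fun y => Re (snd y); fun y => Im (snd y)].

Definition energyT (omega : R3 -> E5) (x : R3) : R :=
  Rsum (map (fun c =>
    Rsum (map (fun e => tgrad e (fun y => c (omega y)) x ^ 2) basis3)) coords).

(** [Ck n U f], for open [U]: all partial derivatives of [f] of order at most
    [n] exist and are continuous on [U]. *)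
Fixpoint Ck (n : nat) (U : R3 -> Prop) (f : R3 -> R) : Prop :=
  (forall x, U x -> continuous f x) /\
  match n with
  | O => True
  | S m => forall e, In e basis3 ->
      (forall x, U x -> ex_derive (fun t : R => f (plus x (scal t e))) 0) /\
      Ck m U (partial e f)
  end.

Definition smooth_on_S2 (f : R3 -> R) : Prop :=
  forall n : nat, Ck n (fun x => x <> zero) (fun x => f (radial x)).

Definition harmonic_sphere (omega : R3 -> E5) : Prop :=
  (forall x, S2 x -> S4 (omega x)) /\
  (forall c, In c coords -> smooth_on_S2 (fun x => c (omega x))) /\
  (forall c x, In c coords -> S2 x ->
     laplaceT (fun y => c (omega y)) x + energyT omega x * c (omega x) = 0).

Definition linearly_full (omega : R3 -> E5) : Prop :=
  forall v : E5, exists l : list (R * R3),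
    List.Forall (fun p => S2 (snd p)) l /\
    v = fold_right (fun p acc => plus (scal (fst p) (omega (snd p))) acc) zero l.

(** Complex projective spaces: points of CP^1 and CP^3 are nonzero vectors of
    [C2] and [C4], equality of points being [proj_eq]. *)

Definition C2 : Type := (C * C)%type.
Definition C4 : Type := (C * C * C * C)%type.

Definition proj_eq {V : ModuleSpace C_Ring} (u v : V) : Prop :=
  exists a : C, a <> RtoC 0 /\ u = scal a v.

Definition CP_map (W : C2 -> C4) : Prop :=
  (forall z, z <> zero -> W z <> zero) /\
  (forall z z', z <> zero -> z' <> zero ->
     proj_eq z z' -> proj_eq (W z) (W z')).

Definition rotCP1 (alpha : R) (z : C2) : C2 :=
  let '(z0, z1) := z in (z0, (cis alpha * z1)%C).

Definition rotCP3 (alpha : R) (w : C4) : C4 :=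
  let '(w0, w1, w2, w3) := w in
  (w0, (cis alpha * w1)%C, (cis (2 * alpha) * w2)%C, (cis (3 * alpha) * w3)%C).

Definition CP_equivariant (W : C2 -> C4) : Prop :=
  forall (alpha : R) (z : C2), z <> zero ->
    proj_eq (W (rotCP1 alpha z)) (rotCP3 alpha (W z)).

Definition chart0 (z : C) : C2 := (RtoC 1, z).
Definition chart1 (z : C) : C2 := (z, RtoC 1).

(** [F] is a holomorphic map to C^4 minus the origin representing [W] near [z]
    in the chart [phi]. *)
Definition local_lift (W : C2 -> C4) (phi : C -> C2) (z : C) (F : C -> C4) :
    Prop :=
  locally z (fun u =>
    F u <> zero /\ proj_eq (W (phi u)) (F u) /\ ex_derive (K := C_AbsRing) F u).

Definition holomorphic (W : C2 -> C4) : Prop :=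
  CP_map W /\
  forall phi, phi = chart0 \/ phi = chart1 ->
  forall z, exists F, local_lift W phi z F.

Definition tau (w : C4) : E5 :=
  let '(w0, w1, w2, w3) := w in
  let N := Cmod w0 ^ 2 + Cmod w1 ^ 2 + Cmod w2 ^ 2 + Cmod w3 ^ 2 in
  ((Cmod w0 ^ 2 + Cmod w3 ^ 2 - Cmod w1 ^ 2 - Cmod w2 ^ 2) / N,
   (2 * (Cconj w0 * w1 + Cconj w2 * w3) / N)%C,
   (2 * (Cconj w0 * w2 - Cconj w1 * w3) / N)%C).

Definition herm (u v : C4) : C :=
  let '(u0, u1, u2, u3) := u in
  let '(v0, v1, v2, v3) := v in
  (u0 * Cconj v0 + u1 * Cconj v1 + u2 * Cconj v2 + u3 * Cconj v3)%C.

(** Fubini-Study metric at [w]: the vectors [u], [v] of C^4 stand for their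
    images in the tangent space C^4 / C w. *)
Definition FubiniStudy (w u v : C4) : R :=
  Re ((herm w w * herm u v - herm u w * herm w v) / (herm w w) ^ 2)%C.

(** Vectors tangent to the fiber of [tau] are velocities of curves [gamma] in
    the fiber; the range of the differential of [W] is spanned over C by the
    derivative of a local holomorphic lift. *)
Definition horizontal (W : C2 -> C4) : Prop :=
  forall phi, phi = chart0 \/ phi = chart1 ->
  forall (z : C) (F : C -> C4) (dF : C4),
    local_lift W phi z F -> is_derive (K := C_AbsRing) F z dF ->
  forall (gamma : R -> C4) (dgamma : C4),
    gamma 0 = F z ->
    locally 0 (fun t : R => gamma t <> zero /\ tau (gamma t) = tau (F z)) ->
    is_derive (K := R_AbsRing) gamma 0 dgamma ->
  forall a : C, FubiniStudy (F z) (scal a dF) dgamma = 0.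

Definition sigma2 (x : R3) : C2 :=
  let '(x1, x2, x3) := x in
  if Req_EM_T x3 (-1) then (RtoC 0, RtoC 1)
  else (RtoC 1, ((x1 + Ci * x2) / (1 + x3))%C).

Definition sigma2_inv (z : C2) : R3 :=
  let '(z0, z1) := z in
  let N := Cmod z0 ^ 2 + Cmod z1 ^ 2 in
  (2 * Re (Cconj z0 * z1)%C / N,
   2 * Im (Cconj z0 * z1)%C / N,
   (Cmod z0 ^ 2 - Cmod z1 ^ 2) / N).

Definition dirC (h : C) (f : C -> C) (z : C) : C :=
  (Derive (fun t : R => Re (f (z + t * h)%C)) 0,
   Derive (fun t : R => Im (f (z + t * h)%C)) 0).

Definition dzbar (f : C -> C) (z : C) : C :=
  ((dirC 1 f z + Ci * dirC Ci f z) / 2)%C.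

(** [1 + t] does not vanish for the maps whose positive lift is considered. *)
Definition xi_of (psi : R3 -> E5) (z : C) : C :=
  let '(t, zeta1, zeta2) := psi (sigma2_inv (chart0 z)) in
  (zeta1 / (1 + t))%C.

Definition eta_of (psi : R3 -> E5) (z : C) : C :=
  let '(t, zeta1, zeta2) := psi (sigma2_inv (chart0 z)) in
  (zeta2 / (1 + t))%C.

Definition positive_lift (psi : R3 -> E5) (W : C2 -> C4) : Prop :=
  holomorphic W /\
  forall z : C, z <> RtoC 0 ->
    let xi := xi_of psi z in
    let eta := eta_of psi z in
    let xi_zb := dzbar (xi_of psi) z in
    let eta_zb := dzbar (eta_of psi) z in
    let xibar_zb := dzbar (fun u => Cconj (xi_of psi u)) z in
    let etabar_zb := dzbar (fun u => Cconj (eta_of psi u)) z in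
    ((xibar_zb, eta_zb) <> zero ->
       proj_eq (W (chart0 z))
         (xibar_zb,
          xibar_zb * xi + eta_zb * Cconj eta,
          xibar_zb * eta - eta_zb * Cconj xi,
          - eta_zb)%C) /\
    ((xi_zb, etabar_zb) <> zero ->
       proj_eq (W (chart0 z))
         (etabar_zb,
          etabar_zb * xi - xi_zb * Cconj eta,
          etabar_zb * eta + xi_zb * Cconj xi,
          xi_zb)%C).

(* Main.v *)
Require Import Defs.
From Stdlib Require Import Reals List Lra Psatz Classical.
From Coquelicot Require Import Coquelicot.
Open Scope R_scope.

(** In the conformal coordinates [x = rotS2 th (mer s)] (so [z = exp (s + i th)])
    an equivariant harmonic sphere is [(u0, e^{i th} u1, e^{2 i th} u2)] with
    [uk'' = (k^2 - e) uk]: the C. Neumann system on a sphere.  Its energy and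
    angular momenta vanish, because they do so at the pole [s = -oo]; hence each
    [uk] is a real function times a constant phase, and Uhlenbeck's integrals of
    the Neumann system take the values they have at the pole.  Where the momentum
    [x1 x2' - x2 x1'] is not zero, which happens somewhere by fullness, these
    algebraic relations determine up to sign the parameters [mu1], [mu2] of an
    explicit solution with the same position and velocity, and uniqueness for the
    Neumann system propagates the equality to all of [S^2].  That explicit
    solution is [tau] of the cubic curve of the theorem.  The formulas for its
    positive lift are then checked by Wirtinger calculus; it is horizontal because
    the contact form [w0 dw3 - w3 dw0 + w1 dw2 - w2 dw1] vanishes along it. *)

(** Conservation laws on the cylinder do here what holomorphic differentials do for general harmonic
    spheres; zero energy, for instance, expresses conformality. They can be evaluated at the pole
    because meridians arrive there with speed tending to 0 in [s], and because a point fixed by all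
    rotations has no component of weight 1 or 2. The multiplier [e] depends on the solution, so two
    solutions of [uk'' = (k^2 - e) uk] cannot be compared directly; in terms of position and angular
    momentum the system is closed, with a quadratic right-hand side and without [e]. At their values
    at the pole the integrals become differences of squares, each equal to one third of the square
    of [C], the momentum in the plane of [x1] and [x2]; quotients of [C] by suitable factors are the
    two parameters. A position and its antipode share the angular momentum, which is the origin of
    the sign [eps]: only one of the two lies on the sheet filled by the explicit solutions. *)

Definition e1 : R3 := (1, 0, 0).
Definition e2 : R3 := (0, 1, 0).
Definition e3 : R3 := (0, 0, 1).

Lemma R3_ext (x1 x2 x3 y1 y2 y3 : R) :
  x1 = y1 -> x2 = y2 -> x3 = y3 -> (x1, x2, x3) = (y1, y2, y3) :> R3.
Proof. now intros -> -> ->. Qed.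

Lemma plus_scal_R3 (x1 x2 x3 t a b c : R) :
  plus ((x1, x2, x3) : R3) (scal t ((a, b, c) : R3)) =
  (x1 + t * a, x2 + t * b, x3 + t * c).
Proof. reflexivity. Qed.

Ltac R3_ring := unfold e1, e2, e3; rewrite ?plus_scal_R3; apply R3_ext; ring.

(** * Differentiability and the chain rule in three real variables *)

Lemma is_derive_line (e : R3) (f : R3 -> R) (p : R3) (t0 : R) :
  ex_derive (fun t : R => f (plus (plus p (scal t0 e)) (scal t e))) 0 ->
  is_derive (fun t : R => f (plus p (scal t e))) t0
    (partial e f (plus p (scal t0 e))).
Proof.
intros H. apply Derive_correct in H.
fold (partial e f (plus p (scal t0 e))) in H.
set (d := partial e f (plus p (scal t0 e))) in *.
apply (is_derive_ext
  (fun t => f (plus (plus p (scal t0 e)) (scal (t - t0) e)))).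
- intros t. f_equal. destruct p as [[p1 p2] p3], e as [[a b] c].
  R3_ring.
- rewrite <- (Rmult_1_l d).
  apply (is_derive_comp
    (fun t => f (plus (plus p (scal t0 e)) (scal t e))) (fun t => t - t0)).
  + now replace (t0 - t0) with 0 by ring.
  + auto_derive; [easy | ring].
Qed.

Lemma mean_value_line (e : R3) (f : R3 -> R) (p : R3) (h : R) :
  (forall t, Rabs t <= Rabs h ->
     ex_derive (fun u : R => f (plus (plus p (scal t e)) (scal u e))) 0) ->
  exists c, Rabs c <= Rabs h /\
    f (plus p (scal h e)) - f p = partial e f (plus p (scal c e)) * h.
Proof.
intros H.
assert (Hb : forall t, Rmin 0 h <= t <= Rmax 0 h -> Rabs t <= Rabs h).
{ intros t. unfold Rmin, Rmax. destruct (Rle_dec 0 h).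
  - intros. rewrite !Rabs_pos_eq; lra.
  - intros. rewrite !Rabs_left1; lra. }
assert (Hd : forall t, Rmin 0 h <= t <= Rmax 0 h ->
  is_derive (fun t => f (plus p (scal t e))) t (partial e f (plus p (scal t e)))).
{ intros t Ht. apply is_derive_line, H, Hb, Ht. }
destruct (MVT_gen (fun t => f (plus p (scal t e))) 0 h
  (fun t => partial e f (plus p (scal t e)))) as [c [Hc E]].
- intros t Ht. apply Hd. lra.
- intros t Ht. apply continuity_pt_filterlim.
  apply (ex_derive_continuous (fun t : R => f (plus p (scal t e))) t).
  eexists. now apply Hd.
- exists c. split. now apply Hb.
  rewrite Rminus_0_r in E. rewrite <- E. f_equal. f_equal. f_equal.
  destruct p as [[p1 p2] p3], e as [[a b] d].
  R3_ring.
Qed.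

Lemma locally_R3 (x1 x2 x3 : R) (P : R3 -> Prop) :
  locally ((x1, x2, x3) : R3) P ->
  exists delta : R, 0 < delta /\ forall h1 h2 h3,
    Rabs h1 < delta -> Rabs h2 < delta -> Rabs h3 < delta ->
    P (x1 + h1, x2 + h2, x3 + h3).
Proof.
intros [d Hd]. exists d. split. apply cond_pos.
intros h1 h2 h3 H1 H2 H3. apply Hd.
assert (B : forall x h, Rabs h < d -> ball x d (x + h)).
{ intros x h Hh. unfold ball; simpl. unfold AbsRing_ball, abs, minus, plus, opp; simpl.
  now replace (x + h + - x) with h by ring. }
repeat split; simpl; now apply B.
Qed.

Definition C1_at (f : R3 -> R) (x : R3) : Prop :=
  forall e, In e basis3 ->
    locally x (fun y => ex_derive (fun t : R => f (plus y (scal t e))) 0) /\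
    continuous (partial e f) x.

(** Continuity of the partial derivatives controls the increment: the mean value theorem is applied
    on a path of three segments parallel to the axes, run through in the order [e3], [e2], [e1]. *)
Lemma C1_increment (f : R3 -> R) (x1 x2 x3 : R) :
  C1_at f (x1, x2, x3) ->
  forall eps, 0 < eps -> exists delta, 0 < delta /\ forall h1 h2 h3,
    Rabs h1 < delta -> Rabs h2 < delta -> Rabs h3 < delta ->
    Rabs (f (x1 + h1, x2 + h2, x3 + h3) - f (x1, x2, x3)
      - (partial e1 f (x1, x2, x3) * h1 + partial e2 f (x1, x2, x3) * h2
         + partial e3 f (x1, x2, x3) * h3))
    <= eps * (Rabs h1 + Rabs h2 + Rabs h3).
Proof.
intros H eps Heps.
assert (L : forall e, In e basis3 -> exists delta, 0 < delta /\
  forall h1 h2 h3, Rabs h1 < delta -> Rabs h2 < delta -> Rabs h3 < delta ->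
    ex_derive (fun t : R => f (plus (x1 + h1, x2 + h2, x3 + h3) (scal t e))) 0 /\
    Rabs (partial e f (x1 + h1, x2 + h2, x3 + h3) - partial e f (x1, x2, x3)) < eps).
{ intros e He. destruct (H e He) as [Hl Hc].
  apply (locally_R3 x1 x2 x3 (fun y =>
    ex_derive (fun t : R => f (plus y (scal t e))) 0 /\
    Rabs (partial e f y - partial e f (x1, x2, x3)) < eps)).
  apply filter_and. exact Hl.
  apply (Hc (fun v => Rabs (v - partial e f (x1, x2, x3)) < eps)).
  now exists (mkposreal eps Heps). }
destruct (L e1) as [d1 [P1 L1]]. simpl; auto.
destruct (L e2) as [d2 [P2 L2]]. simpl; auto.
destruct (L e3) as [d3 [P3 L3]]. simpl; auto.
clear L H.
exists (Rmin d1 (Rmin d2 d3)). split. now repeat apply Rmin_glb_lt.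
intros h1 h2 h3 H1 H2 H3.
assert (Hm : Rmin d1 (Rmin d2 d3) <= d1 /\ Rmin d1 (Rmin d2 d3) <= d2
  /\ Rmin d1 (Rmin d2 d3) <= d3).
{ unfold Rmin. repeat destruct Rle_dec; lra. }
assert (Z0 : Rabs 0 = 0) by apply Rabs_R0.
destruct (mean_value_line e3 f (x1, x2, x3) h3) as [c3 [B3 E3]].
{ intros t Ht. destruct (L3 0 0 t) as [K _]; try lra.
  apply (ex_derive_ext (fun u : R => f (plus (x1 + 0, x2 + 0, x3 + t) (scal u e3)))); [|exact K].
  intros u. f_equal. R3_ring. }
destruct (mean_value_line e2 f (x1, x2, x3 + h3) h2) as [c2 [B2 E2]].
{ intros t Ht. destruct (L2 0 t h3) as [K _]; try lra.
  apply (ex_derive_ext (fun u : R => f (plus (x1 + 0, x2 + t, x3 + h3) (scal u e2)))); [|exact K].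
  intros u. f_equal. R3_ring. }
destruct (mean_value_line e1 f (x1, x2 + h2, x3 + h3) h1) as [c1 [B1 E1]].
{ intros t Ht. destruct (L1 t h2 h3) as [K _]; try lra.
  apply (ex_derive_ext (fun u : R => f (plus (x1 + t, x2 + h2, x3 + h3) (scal u e1)))); [|exact K].
  intros u. f_equal. R3_ring. }
destruct (L3 0 0 c3) as [_ K3]; try lra.
destruct (L2 0 c2 h3) as [_ K2]; try lra.
destruct (L1 c1 h2 h3) as [_ K1]; try lra.
assert (Q3 : plus (x1, x2, x3) (scal h3 e3) = (x1, x2, x3 + h3)).
{ R3_ring. }
assert (Q2 : plus (x1, x2, x3 + h3) (scal h2 e2) = (x1, x2 + h2, x3 + h3)).
{ R3_ring. }
assert (Q1 : plus (x1, x2 + h2, x3 + h3) (scal h1 e1) = (x1 + h1, x2 + h2, x3 + h3)).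
{ R3_ring. }
assert (S3 : plus (x1, x2, x3) (scal c3 e3) = (x1 + 0, x2 + 0, x3 + c3)).
{ R3_ring. }
assert (S2 : plus (x1, x2, x3 + h3) (scal c2 e2) = (x1 + 0, x2 + c2, x3 + h3)).
{ R3_ring. }
assert (S1 : plus (x1, x2 + h2, x3 + h3) (scal c1 e1) = (x1 + c1, x2 + h2, x3 + h3)).
{ R3_ring. }
rewrite Q1, S1 in E1. rewrite Q2, S2 in E2. rewrite Q3, S3 in E3.
set (p1 := partial e1 f (x1, x2, x3)) in *.
set (p2 := partial e2 f (x1, x2, x3)) in *.
set (p3 := partial e3 f (x1, x2, x3)) in *.
replace (_ - _ - _) with
  ((partial e1 f (x1 + c1, x2 + h2, x3 + h3) - p1) * h1
   + (partial e2 f (x1 + 0, x2 + c2, x3 + h3) - p2) * h2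
   + (partial e3 f (x1 + 0, x2 + 0, x3 + c3) - p3) * h3) by nra.
eapply Rle_trans. apply Rabs_triang.
eapply Rle_trans. apply Rplus_le_compat_r, Rabs_triang.
rewrite !Rabs_mult.
pose proof (Rabs_pos h1). pose proof (Rabs_pos h2). pose proof (Rabs_pos h3).
assert (forall a b, a < eps -> 0 <= b -> a * b <= eps * b) as M by (intros; nra).
rewrite !Rmult_plus_distr_l.
apply Rplus_le_compat; [apply Rplus_le_compat|]; now apply M.
Qed.

Lemma is_derive_iff_eps (g : R -> R) (t l : R) :
  is_derive g t l <->
  forall eps, 0 < eps -> exists delta, 0 < delta /\
    forall h, Rabs h < delta -> Rabs (g (t + h) - g t - l * h) <= eps * Rabs h.
Proof.
split.
- intros H eps He. apply is_derive_Reals in H. destruct (H eps He) as [d Hd].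
  exists d. split. apply cond_pos. intros h Hh.
  destruct (Req_dec h 0) as [->|Hn].
  + rewrite Rplus_0_r, Rabs_R0, Rmult_0_r, Rmult_0_r.
    replace (g t - g t - 0) with 0 by ring. rewrite Rabs_R0. lra.
  + specialize (Hd h Hn Hh).
    replace (g (t + h) - g t - l * h) with (((g (t + h) - g t) / h - l) * h) by (field; lra).
    rewrite Rabs_mult. apply Rmult_le_compat_r. apply Rabs_pos. lra.
- intros H. apply is_derive_Reals. intros eps He.
  destruct (H (eps / 2)) as [d [Pd Hd]]. lra.
  exists (mkposreal d Pd). intros h Hn Hh. specialize (Hd h Hh).
  replace ((g (t + h) - g t) / h - l) with ((g (t + h) - g t - l * h) / h) by (field; lra).
  unfold Rdiv at 1. rewrite Rabs_mult, Rabs_inv.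
  pose proof (Rabs_pos_lt h Hn).
  apply Rle_lt_trans with (eps / 2 * Rabs h * / Rabs h).
  + apply Rmult_le_compat_r; [|exact Hd]. left. now apply Rinv_0_lt_compat.
  + field_simplify; lra.
Qed.

Lemma is_derive_curve (f : R3 -> R) (c1 c2 c3 : R -> R) (t l1 l2 l3 : R) :
  C1_at f (c1 t, c2 t, c3 t) ->
  is_derive c1 t l1 -> is_derive c2 t l2 -> is_derive c3 t l3 ->
  is_derive (fun u => f (c1 u, c2 u, c3 u)) t
    (partial e1 f (c1 t, c2 t, c3 t) * l1 + partial e2 f (c1 t, c2 t, c3 t) * l2
     + partial e3 f (c1 t, c2 t, c3 t) * l3).
Proof.
intros Hf H1 H2 H3.
apply is_derive_iff_eps. intros eps He.
set (p1 := partial e1 f (c1 t, c2 t, c3 t)).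
set (p2 := partial e2 f (c1 t, c2 t, c3 t)).
set (p3 := partial e3 f (c1 t, c2 t, c3 t)).
(* For small [h], [M * Rabs h] bounds the increment of the curve, and [P] bounds the gradient; one
   half of [eps] pays for the linearisation of [f], the other half for that of the curve. *)
set (M := Rabs l1 + Rabs l2 + Rabs l3 + 3).
set (P := Rabs p1 + Rabs p2 + Rabs p3 + 1).
assert (HM : 3 <= M).
{ unfold M. pose proof (Rabs_pos l1). pose proof (Rabs_pos l2). pose proof (Rabs_pos l3). lra. }
assert (HP : 1 <= P).
{ unfold P. pose proof (Rabs_pos p1). pose proof (Rabs_pos p2). pose proof (Rabs_pos p3). lra. }
assert (HeM : 0 < eps / (2 * M)) by (apply Rdiv_lt_0_compat; lra).
assert (HeP0 : 0 < eps / (2 * P)) by (apply Rdiv_lt_0_compat; lra).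
destruct (C1_increment f _ _ _ Hf _ HeM) as [d [Pd Hd]].
assert (K : forall c l, is_derive c t l -> exists dl, 0 < dl /\ forall h, Rabs h < dl ->
   Rabs (c (t + h) - c t - l * h) <= eps / (2 * P) * Rabs h /\
   Rabs (c (t + h) - c t) <= (Rabs l + 1) * Rabs h /\
   Rabs (c (t + h) - c t) < d).
{ intros c l Hc.
  destruct (proj1 (is_derive_iff_eps c t l) Hc _ HeP0) as [a [Pa Ha]].
  destruct (proj1 (is_derive_iff_eps c t l) Hc 1 Rlt_0_1) as [b [Pb Hb]].
  exists (Rmin a (Rmin b (d / (Rabs l + 1)))).
  pose proof (Rabs_pos l).
  assert (0 < d / (Rabs l + 1)) by (apply Rdiv_lt_0_compat; lra).
  split. repeat apply Rmin_glb_lt; lra.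
  intros h Hh.
  assert (G : Rabs h < a /\ Rabs h < b /\ Rabs h < d / (Rabs l + 1)).
  { revert Hh. unfold Rmin. repeat destruct Rle_dec; lra. }
  destruct G as [Ga [Gb Gd]].
  assert (B : Rabs (c (t + h) - c t) <= (Rabs l + 1) * Rabs h).
  { specialize (Hb h Gb).
    replace (c (t + h) - c t) with ((c (t + h) - c t - l * h) + l * h) by ring.
    eapply Rle_trans. apply Rabs_triang. rewrite Rabs_mult. lra. }
  split; [now apply Ha|]. split; [exact B|].
  eapply Rle_lt_trans. exact B.
  apply Rlt_le_trans with ((Rabs l + 1) * (d / (Rabs l + 1))).
  apply Rmult_lt_compat_l; lra. right. field. lra. }
destruct (K c1 l1 H1) as [a1 [A1 B1]]. destruct (K c2 l2 H2) as [a2 [A2 B2]].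
destruct (K c3 l3 H3) as [a3 [A3 B3]].
exists (Rmin a1 (Rmin a2 a3)). split. repeat apply Rmin_glb_lt; lra.
intros h Hh.
assert (G : Rabs h < a1 /\ Rabs h < a2 /\ Rabs h < a3).
{ revert Hh. unfold Rmin. repeat destruct Rle_dec; lra. }
destruct G as [G1 [G2 G3]].
destruct (B1 h G1) as [X1 [Y1 Z1]]. destruct (B2 h G2) as [X2 [Y2 Z2]].
destruct (B3 h G3) as [X3 [Y3 Z3]].
specialize (Hd _ _ _ Z1 Z2 Z3). fold p1 p2 p3 in Hd.
replace (c1 t + (c1 (t + h) - c1 t)) with (c1 (t + h)) in Hd by ring.
replace (c2 t + (c2 (t + h) - c2 t)) with (c2 (t + h)) in Hd by ring.
replace (c3 t + (c3 (t + h) - c3 t)) with (c3 (t + h)) in Hd by ring.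
set (D1 := c1 (t + h) - c1 t) in *. set (D2 := c2 (t + h) - c2 t) in *.
set (D3 := c3 (t + h) - c3 t) in *.
set (DF := f (c1 (t + h), c2 (t + h), c3 (t + h)) - f (c1 t, c2 t, c3 t)) in *.
replace (DF - (p1 * l1 + p2 * l2 + p3 * l3) * h) with
  ((DF - (p1 * D1 + p2 * D2 + p3 * D3)) +
   (p1 * (D1 - l1 * h) + (p2 * (D2 - l2 * h) + p3 * (D3 - l3 * h)))) by ring.
eapply Rle_trans. apply Rabs_triang.
replace (eps * Rabs h) with (eps / 2 * Rabs h + eps / 2 * Rabs h) by field.
pose proof (Rabs_pos h) as Hh0.
apply Rplus_le_compat.
- eapply Rle_trans. exact Hd.
  apply Rle_trans with (eps / (2 * M) * (M * Rabs h)).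
  + apply Rmult_le_compat_l. lra. unfold M. lra.
  + right. field. lra.
- apply Rle_trans with (eps / (2 * P) * (P * Rabs h)); [|right; field; lra].
  assert (T : forall p q, Rabs q <= eps / (2 * P) * Rabs h ->
     Rabs (p * q) <= Rabs p * (eps / (2 * P) * Rabs h)).
  { intros p q Hq. rewrite Rabs_mult. apply Rmult_le_compat_l. apply Rabs_pos. exact Hq. }
  pose proof (T p1 _ X1). pose proof (T p2 _ X2). pose proof (T p3 _ X3).
  eapply Rle_trans. apply Rabs_triang.
  eapply Rle_trans. apply Rplus_le_compat_l, Rabs_triang.
  assert (0 <= eps / (2 * P) * Rabs h) by (apply Rmult_le_pos; lra).
  unfold P at 2. nra.
Qed.

(** * The radial extension *)

Lemma nonzero3_coords (x1 x2 x3 : R) :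
  0 < x1 ^ 2 + x2 ^ 2 + x3 ^ 2 -> ((x1, x2, x3) : R3) <> zero.
Proof.
intros H E. change ((x1, x2, x3) = ((0, 0, 0) : R3)) in E.
injection E; intros; subst. lra.
Qed.

Lemma coords_nonzero3 (x1 x2 x3 : R) :
  ((x1, x2, x3) : R3) <> zero -> 0 < x1 ^ 2 + x2 ^ 2 + x3 ^ 2.
Proof.
intros H.
destruct (Req_dec x1 0) as [E1|]; [|nra].
destruct (Req_dec x2 0) as [E2|]; [|nra].
destruct (Req_dec x3 0) as [E3|]; [|nra].
subst. now contradiction H.
Qed.

Lemma continuous_R3_coord (x : R3) :
  continuous (fun y : R3 => fst (fst y)) x /\
  continuous (fun y : R3 => snd (fst y)) x /\
  continuous (fun y : R3 => snd y) x.
Proof.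
repeat split.
- apply (continuous_comp (fun y : R3 => fst y) fst). apply continuous_fst. apply continuous_fst.
- apply (continuous_comp (fun y : R3 => fst y) snd). apply continuous_fst. apply continuous_snd.
- apply continuous_snd.
Qed.

Lemma locally_nonzero3 (x : R3) : x <> zero -> locally x (fun y : R3 => y <> zero).
Proof.
destruct (continuous_R3_coord x) as [K1 [K2 K3]].
assert (N : forall (g : R3 -> R), continuous g x -> g zero = 0 -> g x <> 0 ->
  locally x (fun y : R3 => y <> zero)).
{ intros g Hg G0 Gx.
  apply (filter_imp (fun y => g y <> 0)). intros y Hy ->. now apply Hy.
  apply (Hg (fun v => v <> 0)). exact (open_neq 0 (g x) Gx). }
destruct x as [[x1 x2] x3]. intros H. apply coords_nonzero3 in H.
destruct (Req_dec x1 0) as [E1|E1]; [|now apply (N _ K1)].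
destruct (Req_dec x2 0) as [E2|E2]; [|now apply (N _ K2)].
destruct (Req_dec x3 0) as [E3|E3]; [|now apply (N _ K3)].
subst. exfalso. lra.
Qed.

Lemma Ck_C1_at (n : nat) (f : R3 -> R) (x : R3) :
  Ck (S n) (fun x => x <> zero) f -> x <> zero -> C1_at f x.
Proof.
intros [_ H] Hx e He. destruct (H e He) as [Hd Hc]. split.
- apply (filter_imp (fun y : R3 => y <> zero)). exact Hd.
  now apply locally_nonzero3.
- destruct n; now apply Hc.
Qed.

Lemma radial_scal (l x1 x2 x3 : R) : 0 < l ->
  radial (l * x1, l * x2, l * x3) = radial (x1, x2, x3).
Proof.
intros Hl. unfold radial, norm3.
replace ((l * x1) ^ 2 + (l * x2) ^ 2 + (l * x3) ^ 2)
  with (l ^ 2 * (x1 ^ 2 + x2 ^ 2 + x3 ^ 2)) by ring.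
rewrite sqrt_mult_alt by apply pow2_ge_0. rewrite sqrt_pow2 by lra.
set (n := sqrt _).
assert (E : forall u, / (l * n) * (l * u) = / n * u).
{ intros u. rewrite Rinv_mult. rewrite (Rmult_comm (/ l)), Rmult_assoc. f_equal. field. lra. }
apply R3_ext; apply E.
Qed.

Lemma radial_S2 (x : R3) : S2 x -> radial x = x.
Proof.
destruct x as [[x1 x2] x3]. unfold S2, radial, norm3. intros ->.
rewrite sqrt_1, Rinv_1.
apply R3_ext; apply Rmult_1_l.
Qed.

Lemma is_derive_comb3 (g1 g2 g3 : R -> R) (t d1 d2 d3 a1 a2 a3 : R) :
  is_derive g1 t d1 -> is_derive g2 t d2 -> is_derive g3 t d3 ->
  is_derive (fun u => g1 u * a1 + g2 u * a2 + g3 u * a3) t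
    (d1 * a1 + d2 * a2 + d3 * a3).
Proof.
intros H1 H2 H3. auto_derive.
- repeat split; eexists; eassumption.
- rewrite (is_derive_unique g1 t d1 H1 : Derive (fun x : R => g1 x) t = d1),
    (is_derive_unique g2 t d2 H2 : Derive (fun x : R => g2 x) t = d2),
    (is_derive_unique g3 t d3 H3 : Derive (fun x : R => g3 x) t = d3). ring.
Qed.

Lemma is_derive_inv_sqrt (q : R -> R) (t d : R) :
  q t = 1 -> is_derive q t d ->
  is_derive (fun u => / sqrt (q u)) t (- (d / 2)).
Proof.
intros H1 Hq. auto_derive; rewrite H1, sqrt_1.
- repeat split; try lra. now exists d.
- rewrite (is_derive_unique q t d Hq : Derive (fun x : R => q x) t = d). field.
Qed.

Definition rext (f : R3 -> R) (x : R3) : R := f (radial x).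

Section RadialExtension.

Variable f : R3 -> R.
Hypothesis Hf : smooth_on_S2 f.

Local Notation F := (rext f).

Lemma rext_C1 (x : R3) : x <> zero -> C1_at F x.
Proof. exact (Ck_C1_at 0 F x (Hf 1%nat)). Qed.

Lemma partial_rext_C1 (e x : R3) : In e basis3 -> x <> zero -> C1_at (partial e F) x.
Proof. intros He. apply (Ck_C1_at 0). exact (proj2 (proj2 (Hf 2%nat) e He)). Qed.

Let B1 : In e1 basis3. Proof. simpl; auto. Qed.
Let B2 : In e2 basis3. Proof. simpl; auto. Qed.
Let B3 : In e3 basis3. Proof. simpl; auto. Qed.

(** [rext f] is constant along rays; this is Euler's identity in degree 0, obtained by
    differentiating in [l] at 1. *)
Lemma euler_first (x1 x2 x3 : R) : ((x1, x2, x3) : R3) <> zero ->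
  partial e1 F (x1, x2, x3) * x1 + partial e2 F (x1, x2, x3) * x2
  + partial e3 F (x1, x2, x3) * x3 = 0.
Proof.
intros Hx.
assert (D : is_derive (fun l => F (l * x1, l * x2, l * x3)) 1
  (partial e1 F (1 * x1, 1 * x2, 1 * x3) * x1
   + partial e2 F (1 * x1, 1 * x2, 1 * x3) * x2
   + partial e3 F (1 * x1, 1 * x2, 1 * x3) * x3)).
{ apply (is_derive_curve F (fun l => l * x1) (fun l => l * x2) (fun l => l * x3)).
  - rewrite !Rmult_1_l. now apply rext_C1.
  - auto_derive; [easy|ring].
  - auto_derive; [easy|ring].
  - auto_derive; [easy|ring]. }
assert (D0 : is_derive (fun l => F (l * x1, l * x2, l * x3)) 1 0).
{ apply (is_derive_ext_loc (fun _ => F (x1, x2, x3))).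
  - apply (filter_imp (fun l => 0 < l)).
    + intros l Hl. unfold rext. now rewrite radial_scal.
    + apply (open_gt 0 1). lra.
  - apply @is_derive_const. }
rewrite !Rmult_1_l in D.
rewrite <- (is_derive_unique _ _ _ D). exact (is_derive_unique _ _ _ D0).
Qed.

Definition hess (a b : R3) (x : R3) : R := partial b (partial a F) x.

(** The first identity holds at every point [l * x] of the ray; divided by [l] and differentiated at
    [l = 1], it says that the Hessian vanishes on the pair (x, x). *)
Lemma euler_second (x1 x2 x3 : R) : ((x1, x2, x3) : R3) <> zero ->
  let x := (x1, x2, x3) in
  (hess e1 e1 x * x1 + hess e1 e2 x * x2 + hess e1 e3 x * x3) * x1 +
  (hess e2 e1 x * x1 + hess e2 e2 x * x2 + hess e2 e3 x * x3) * x2 +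
  (hess e3 e1 x * x1 + hess e3 e2 x * x2 + hess e3 e3 x * x3) * x3 = 0.
Proof.
intros Hx x.
assert (D : forall e, In e basis3 -> is_derive (fun l => partial e F (l * x1, l * x2, l * x3)) 1
  (hess e e1 x * x1 + hess e e2 x * x2 + hess e e3 x * x3)).
{ intros e He.
  generalize (is_derive_curve (partial e F) (fun l => l * x1) (fun l => l * x2)
    (fun l => l * x3) 1 x1 x2 x3). rewrite !Rmult_1_l. intros K. apply K.
  - now apply partial_rext_C1.
  - auto_derive; [easy|ring].
  - auto_derive; [easy|ring].
  - auto_derive; [easy|ring]. }
pose proof (D e1 B1) as D1. pose proof (D e2 B2) as D2. pose proof (D e3 B3) as D3.
assert (DS : is_derive (fun l =>
  partial e1 F (l * x1, l * x2, l * x3) * x1 + partial e2 F (l * x1, l * x2, l * x3) * x2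
  + partial e3 F (l * x1, l * x2, l * x3) * x3) 1
  ((hess e1 e1 x * x1 + hess e1 e2 x * x2 + hess e1 e3 x * x3) * x1 +
  (hess e2 e1 x * x1 + hess e2 e2 x * x2 + hess e2 e3 x * x3) * x2 +
  (hess e3 e1 x * x1 + hess e3 e2 x * x2 + hess e3 e3 x * x3) * x3)).
{ now apply is_derive_comb3. }
rewrite <- (is_derive_unique _ _ _ DS). apply is_derive_unique.
apply (is_derive_ext_loc (fun _ => 0)).
- apply (filter_imp (fun l => 0 < l)).
  + intros l Hl. apply (Rmult_eq_reg_l l); [|lra].
    assert (Hn : ((l * x1, l * x2, l * x3) : R3) <> zero).
    { apply nonzero3_coords. apply coords_nonzero3 in Hx.
      replace (_ + _ + _) with (l ^ 2 * (x1 ^ 2 + x2 ^ 2 + x3 ^ 2)) by ring.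
      apply Rmult_lt_0_compat; [now apply pow_lt | exact Hx]. }
    pose proof (euler_first _ _ _ Hn). lra.
  + apply (open_gt 0 1). lra.
- apply @is_derive_const.
Qed.

(** In the iterated tangential derivative the inner one is again extended along rays, so the outer
    one differentiates in the direction [e - <x, e> x]. Summed over the basis, the correction is the
    Hessian on (x, x), which is zero. *)
Lemma laplaceT_hess (x : R3) : S2 x ->
  laplaceT f x = hess e1 e1 x + hess e2 e2 x + hess e3 e3 x.
Proof.
destruct x as [[x1 x2] x3]. intros Hx. unfold S2 in Hx.
assert (Hn : ((x1, x2, x3) : R3) <> zero) by (apply nonzero3_coords; lra).
pose proof (euler_second x1 x2 x3 Hn) as E2. cbv zeta in E2.
set (x := (x1, x2, x3) : R3) in *.
assert (D : forall a b c, In (a, b, c) basis3 ->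
  tgrad (a, b, c) (tgrad (a, b, c) f) x =
    hess (a, b, c) e1 x * (a - (x1 * a + x2 * b + x3 * c) * x1)
    + hess (a, b, c) e2 x * (b - (x1 * a + x2 * b + x3 * c) * x2)
    + hess (a, b, c) e3 x * (c - (x1 * a + x2 * b + x3 * c) * x3)).
{ intros a b c He.
  set (N := fun t => / sqrt ((x1 + t * a) ^ 2 + (x2 + t * b) ^ 2 + (x3 + t * c) ^ 2)).
  apply is_derive_unique.
  change (is_derive (fun t => partial (a, b, c) F
    (N t * (x1 + t * a), N t * (x2 + t * b), N t * (x3 + t * c))) 0
   (hess (a, b, c) e1 x * (a - (x1 * a + x2 * b + x3 * c) * x1)
    + hess (a, b, c) e2 x * (b - (x1 * a + x2 * b + x3 * c) * x2)
    + hess (a, b, c) e3 x * (c - (x1 * a + x2 * b + x3 * c) * x3))).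
  assert (N0 : N 0 = 1).
  { unfold N. rewrite !Rmult_0_l, !Rplus_0_r, Hx, sqrt_1. field. }
  assert (DN : is_derive N 0 (- (x1 * a + x2 * b + x3 * c))).
  { replace (- _) with (- ((2 * (x1 * a + x2 * b + x3 * c)) / 2)) by field.
    apply (is_derive_inv_sqrt
      (fun t => (x1 + t * a) ^ 2 + (x2 + t * b) ^ 2 + (x3 + t * c) ^ 2)).
    - now rewrite !Rmult_0_l, !Rplus_0_r.
    - auto_derive; [easy|ring]. }
  assert (DC : forall y d, is_derive (fun t => N t * (y + t * d)) 0
     (d - (x1 * a + x2 * b + x3 * c) * y)).
  { intros y d. 
    replace (d - _) with (- (x1 * a + x2 * b + x3 * c) * (y + 0 * d) + N 0 * d)
      by (rewrite N0; ring).
    apply (is_derive_mult (K := R_AbsRing) N (fun t => y + t * d)).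
    exact DN. auto_derive; [easy|ring]. intros; apply Rmult_comm. }
  generalize (is_derive_curve (partial (a, b, c) F) (fun t => N t * (x1 + t * a))
    (fun t => N t * (x2 + t * b)) (fun t => N t * (x3 + t * c)) 0
    (a - (x1 * a + x2 * b + x3 * c) * x1)
    (b - (x1 * a + x2 * b + x3 * c) * x2) (c - (x1 * a + x2 * b + x3 * c) * x3)).
  intros K.
  cbv beta in K.
  rewrite N0, !Rmult_0_l, !Rplus_0_r, !Rmult_1_l in K.
  apply K; [now apply partial_rext_C1| apply DC..]. }
unfold laplaceT, basis3, Rsum. simpl map. unfold fold_right.
rewrite (D 1 0 0), (D 0 1 0), (D 0 0 1) by (simpl; auto).
fold e1 e2 e3. lra.
Qed.

End RadialExtension.

(** * Cylinder coordinates on the sphere *)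

(** These are sech and tanh. Written rationally in [exp s], they extend smoothly to [exp s = 0],
    which is the pole; [mer s] is the point with stereographic coordinate [exp s]. *)
Definition mS (s : R) : R := 2 * exp s / (1 + exp s ^ 2).
Definition mT (s : R) : R := (exp s ^ 2 - 1) / (1 + exp s ^ 2).
Definition mer (s : R) : R3 := (mS s, 0, - mT s).

Lemma mS_mT (s : R) : mS s ^ 2 + mT s ^ 2 = 1.
Proof. unfold mS, mT. pose proof (exp_pos s). field. nra. Qed.

Lemma is_derive_mS (s : R) : is_derive mS s (- (mS s * mT s)).
Proof.
unfold mS, mT. pose proof (exp_pos s). auto_derive. nra. field. nra.
Qed.

Lemma is_derive_mT (s : R) : is_derive mT s (mS s ^ 2).
Proof.
unfold mS, mT. pose proof (exp_pos s). auto_derive. nra. field. nra.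
Qed.

Lemma mer_rot_S2 (s th : R) : S2 (mS s * cos th, mS s * sin th, - mT s).
Proof.
unfold S2. pose proof (mS_mT s). pose proof (sin2_cos2 th) as E. unfold Rsqr in E. nra.
Qed.

Lemma mer_S2 (s : R) : S2 (mer s).
Proof. unfold S2, mer. pose proof (mS_mT s). lra. Qed.

Lemma S2_nonzero (x : R3) : S2 x -> x <> zero.
Proof.
destruct x as [[x1 x2] x3]. unfold S2. intros H. apply nonzero3_coords. lra.
Qed.

(** In the parameter [r = exp s] the meridian continues through the pole at [r = 0], so the limit is
    continuity of [G] along a smooth curve. *)
Lemma mer_lim_m (G : R3 -> R) : C1_at G (0, 0, 1) ->
  is_lim (fun s => G (mer s)) m_infty (G (0, 0, 1)).
Proof.
intros H.
set (P := fun r : R => G (2 * r / (1 + r ^ 2), 0, - ((r ^ 2 - 1) / (1 + r ^ 2)))).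
assert (P0 : G (0, 0, 1) = P 0).
{ unfold P. f_equal. apply R3_ext; field. }
rewrite P0. apply (is_lim_comp_continuous exp P m_infty 0).
- exact is_lim_exp_m.
- assert (D : ex_derive P 0); [|exact (ex_derive_continuous P 0 D)].
  eexists.
  apply (is_derive_curve G (fun r => 2 * r / (1 + r ^ 2)) (fun _ => 0)
    (fun r => - ((r ^ 2 - 1) / (1 + r ^ 2)))).
  + replace (_, _, _) with ((0, 0, 1) : R3). exact H. apply R3_ext; field.
  + auto_derive. lra. reflexivity.
  + apply @is_derive_const.
  + auto_derive. lra. reflexivity.
Qed.

Lemma is_lim_exp_opp_p : is_lim (fun s => exp (- s)) p_infty 0.
Proof.
apply (is_lim_comp exp Ropp p_infty 0 m_infty).
- exact is_lim_exp_m.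
- apply (is_lim_opp (fun s => s) p_infty p_infty). apply is_lim_id.
- now exists 0.
Qed.

Lemma mer_lim_p (G : R3 -> R) : C1_at G (0, 0, -1) ->
  is_lim (fun s => G (mer s)) p_infty (G (0, 0, -1)).
Proof.
intros H.
set (P := fun r : R => G (2 * r / (1 + r ^ 2), 0, (r ^ 2 - 1) / (1 + r ^ 2))).
assert (P0 : G (0, 0, -1) = P 0).
{ unfold P. f_equal. apply R3_ext; field. }
rewrite P0. apply (is_lim_ext (fun s => P (exp (- s)))).
{ intros s. unfold P, mer, mS, mT. rewrite exp_Ropp. pose proof (exp_pos s).
  f_equal. apply R3_ext; [field; nra|reflexivity|field; nra]. }
apply (is_lim_comp_continuous (fun s => exp (- s)) P p_infty 0).
- exact is_lim_exp_opp_p.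
- assert (D : ex_derive P 0); [|exact (ex_derive_continuous P 0 D)].
  eexists.
  apply (is_derive_curve G (fun r => 2 * r / (1 + r ^ 2)) (fun _ => 0)
    (fun r => (r ^ 2 - 1) / (1 + r ^ 2))).
  + replace (_, _, _) with ((0, 0, -1) : R3). exact H. apply R3_ext; field.
  + auto_derive. lra. reflexivity.
  + apply @is_derive_const.
  + auto_derive. lra. reflexivity.
Qed.

(** * Derivatives along meridians and parallels *)

Section Meridian.

Variable f : R3 -> R.
Hypothesis Hf : smooth_on_S2 f.

(** The chain rule written out with Euclidean partial derivatives, so that it can be differentiated
    again and has a limit at the pole; the [e2] term is absent because the meridian lies in the
    plane [x2 = 0]. *)
Definition dmer (s : R) : R :=
  partial e1 (rext f) (mer s) * (- (mS s * mT s))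
  + partial e3 (rext f) (mer s) * (- mS s ^ 2).

Lemma mer_derive (s : R) : is_derive (fun u => f (mer u)) s (dmer s).
Proof.
apply (is_derive_ext (fun u => rext f (mer u))).
{ intros u. unfold rext. now rewrite radial_S2 by apply mer_S2. }
replace (dmer s) with (partial e1 (rext f) (mer s) * (- (mS s * mT s))
  + partial e2 (rext f) (mer s) * 0
  + partial e3 (rext f) (mer s) * (- mS s ^ 2)) by (unfold dmer; ring).
apply (is_derive_curve (rext f) mS (fun _ => 0) (fun u => - mT u)).
- apply rext_C1. exact Hf. apply S2_nonzero, mer_S2.
- apply is_derive_mS.
- apply @is_derive_const.
- apply (is_derive_opp (K := R_AbsRing) mT). apply is_derive_mT.
Qed.

Lemma partial_mer_derive (e : R3) (s : R) : In e basis3 ->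
  is_derive (fun u => partial e (rext f) (mer u)) s
    (hess f e e1 (mer s) * (- (mS s * mT s)) + hess f e e3 (mer s) * (- mS s ^ 2)).
Proof.
intros He.
replace (_ + _) with (hess f e e1 (mer s) * (- (mS s * mT s))
  + hess f e e2 (mer s) * 0 + hess f e e3 (mer s) * (- mS s ^ 2)) by ring.
apply (is_derive_curve (partial e (rext f)) mS (fun _ => 0) (fun u => - mT u)).
- apply partial_rext_C1; trivial. apply S2_nonzero, mer_S2.
- apply is_derive_mS.
- apply @is_derive_const.
- apply (is_derive_opp (K := R_AbsRing) mT). apply is_derive_mT.
Qed.

Lemma dmer_derive (s : R) :
  is_derive dmer s
    ((hess f e1 e1 (mer s) * (- (mS s * mT s)) + hess f e1 e3 (mer s) * (- mS s ^ 2))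
       * (- (mS s * mT s))
     + partial e1 (rext f) (mer s) * (mS s * mT s ^ 2 - mS s ^ 3)
     + (hess f e3 e1 (mer s) * (- (mS s * mT s)) + hess f e3 e3 (mer s) * (- mS s ^ 2))
       * (- mS s ^ 2)
     + partial e3 (rext f) (mer s) * (2 * mS s ^ 2 * mT s)).
Proof.
assert (D1 := partial_mer_derive e1 s). assert (D3 := partial_mer_derive e3 s).
specialize (D1 ltac:(simpl; auto)). specialize (D3 ltac:(simpl; auto)).
assert (DS := is_derive_mS s). assert (DT := is_derive_mT s).
unfold dmer. set (p1 := fun u => partial e1 (rext f) (mer u)) in *.
set (p3 := fun u => partial e3 (rext f) (mer u)) in *.
change (partial e1 (rext f) (mer s)) with (p1 s).
change (partial e3 (rext f) (mer s)) with (p3 s).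
apply (is_derive_ext (fun u => p1 u * - (mS u * mT u) + p3 u * - mS u ^ 2)).
{ reflexivity. }
auto_derive.
- repeat split; eexists; eassumption.
- rewrite (is_derive_unique p1 s _ D1 : Derive (fun x : R => p1 x) s = _).
  rewrite (is_derive_unique p3 s _ D3 : Derive (fun x : R => p3 x) s = _).
  rewrite (is_derive_unique mS s _ DS : Derive (fun x : R => mS x) s = _).
  rewrite (is_derive_unique mT s _ DT : Derive (fun x : R => mT x) s = _).
  ring.
Qed.

Section Rotation.

Variables (s : R) (h h' : R -> R) (h'' : R).
Hypothesis Hh : forall th, f (rotS2 th (mer s)) = h th.
Hypothesis Dh : forall th, is_derive h th (h' th).
Hypothesis Dh' : is_derive h' 0 h''.

Let circle (th : R) : R3 := (mS s * cos th, mS s * sin th, - mT s).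

Let circle0 : circle 0 = mer s.
Proof. unfold circle. rewrite cos_0, sin_0. apply R3_ext; ring. Qed.

Let circle_nonzero (th : R) : circle th <> zero.
Proof. apply S2_nonzero, mer_rot_S2. Qed.

Lemma rot_derive (th : R) :
  h' th = partial e1 (rext f) (circle th) * (- (mS s * sin th))
    + partial e2 (rext f) (circle th) * (mS s * cos th).
Proof.
rewrite <- (is_derive_unique _ _ _ (Dh th)).
apply is_derive_unique.
apply (is_derive_ext (fun th => rext f (circle th))).
{ intros u. rewrite <- Hh. unfold rext. rewrite radial_S2 by apply mer_rot_S2.
  f_equal. apply R3_ext; ring. }
replace (_ + _) with (partial e1 (rext f) (circle th) * (- (mS s * sin th))
    + partial e2 (rext f) (circle th) * (mS s * cos th)
    + partial e3 (rext f) (circle th) * 0) by ring.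
apply (is_derive_curve (rext f) (fun th => mS s * cos th) (fun th => mS s * sin th)
  (fun _ => - mT s)).
- apply rext_C1; [exact Hf | apply circle_nonzero].
- auto_derive; [easy|ring].
- auto_derive; [easy|ring].
- apply @is_derive_const.
Qed.

(** At angle 0 the parallel moves with velocity [mS s] along [e2] and acceleration [- mS s] along
    [e1]; the acceleration produces the first-order term. *)
Lemma rot_derive2 :
  h'' = - partial e1 (rext f) (mer s) * mS s + hess f e2 e2 (mer s) * mS s ^ 2.
Proof.
rewrite <- (is_derive_unique _ _ _ Dh').
apply is_derive_unique.
apply (is_derive_ext (fun th => partial e1 (rext f) (circle th) * (- (mS s * sin th))
    + partial e2 (rext f) (circle th) * (mS s * cos th))).
{ intros th. now rewrite rot_derive. }
assert (D : forall e, In e basis3 -> is_derive (fun th => partial e (rext f) (circle th)) 0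
   (hess f e e2 (mer s) * mS s)).
{ intros e He.
  replace (_ * _) with (hess f e e1 (circle 0) * 0 + hess f e e2 (circle 0) * mS s
    + hess f e e3 (circle 0) * 0) by (rewrite circle0; ring).
  apply (is_derive_curve (partial e (rext f)) (fun th => mS s * cos th)
    (fun th => mS s * sin th) (fun _ => - mT s)).
  - apply partial_rext_C1; trivial. apply circle_nonzero.
  - auto_derive; [easy|rewrite sin_0; ring].
  - auto_derive; [easy|rewrite cos_0; ring].
  - apply @is_derive_const. }
assert (D1 := D e1 ltac:(simpl; auto)). assert (D2 := D e2 ltac:(simpl; auto)). clear D.
rewrite <- circle0 at 1.
set (p1 := fun u => partial e1 (rext f) (circle u)) in *.
set (p2 := fun u => partial e2 (rext f) (circle u)) in *.
change (partial e1 (rext f) (circle 0)) with (p1 0).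
apply (is_derive_ext (fun th => p1 th * - (mS s * sin th) + p2 th * (mS s * cos th))).
{ reflexivity. }
auto_derive.
- repeat split; eexists; eassumption.
- rewrite (is_derive_unique p1 0 _ D1 : Derive (fun x : R => p1 x) 0 = _).
  rewrite (is_derive_unique p2 0 _ D2 : Derive (fun x : R => p2 x) 0 = _).
  rewrite sin_0, cos_0. ring.
Qed.

(* The cylinder coordinates (s, th) are conformal with factor [mS]. *)
Lemma dmer_derive_laplace : is_derive dmer s (mS s ^ 2 * laplaceT f (mer s) - h'').
Proof.
evar_last. apply dmer_derive.
rewrite rot_derive2, laplaceT_hess by (trivial; apply mer_S2).
pose proof (euler_first f Hf _ _ _ (S2_nonzero _ (mer_S2 s))) as E1.
pose proof (euler_second f Hf _ _ _ (S2_nonzero _ (mer_S2 s))) as E2. cbv zeta in E2.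
change (mS s, 0, - mT s) with (mer s) in E1, E2.
pose proof (mS_mT s) as ST.
set (S := mS s) in *. set (T := mT s) in *.
set (p1 := partial e1 (rext f) (mer s)) in *.
set (p3 := partial e3 (rext f) (mer s)) in *.
set (a := hess f e1 e1 (mer s)) in *. set (b := hess f e1 e3 (mer s)) in *.
set (c := hess f e3 e1 (mer s)) in *. set (d := hess f e3 e3 (mer s)) in *.
assert (E1' : p1 * S = p3 * T) by lra.
assert (E2' : a * S ^ 2 - (b + c) * S * T + d * T ^ 2 = 0) by nra.
assert (T2 : T ^ 2 = 1 - S ^ 2) by lra.
replace (S * T ^ 2 - S ^ 3) with (S - 2 * S * S ^ 2) by (rewrite T2; ring).
(* Euler's first identity collapses the first-order terms to [p1 * S], which is the one that
   [rot_derive2] contributes. *)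
assert (K : p1 * (S - 2 * S * S ^ 2) + p3 * (2 * S ^ 2 * T) = p1 * S).
{ transitivity (p1 * S - 2 * S ^ 2 * (p1 * S - p3 * T)); [ring|].
  rewrite E1'. ring. }
(* In the plane of the meridian the trace [a + d] is the sum of the second derivatives along the
   unit tangent and along the radius; the latter is zero by Euler's second identity. *)
assert (H2 : (a * - (S * T) + b * - S ^ 2) * - (S * T) + (c * - (S * T) + d * - S ^ 2) * - S ^ 2
  = S ^ 2 * (a + d)).
{ transitivity (S ^ 2 * (a * T ^ 2 + (b + c) * S * T + d * S ^ 2)); [ring|].
  f_equal. replace ((b + c) * S * T) with (a * S ^ 2 + d * T ^ 2) by lra.
  transitivity ((a + d) * (S ^ 2 + T ^ 2)); [ring|]. rewrite ST. ring. }
unfold Hierarchy.minus, plus, opp; simpl. lra.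
Qed.

(** The gradient of the radial extension has no radial part, so its square is the sum over the
    meridian and parallel directions, whose coordinate vectors both have length [mS s]. *)
Lemma tgrad_mer :
  mS s ^ 2 * Rsum (map (fun e => tgrad e f (mer s) ^ 2) basis3) = dmer s ^ 2 + h' 0 ^ 2.
Proof.
rewrite rot_derive, circle0, sin_0, cos_0.
change (Rsum _) with (partial e1 (rext f) (mer s) ^ 2 + (partial e2 (rext f) (mer s) ^ 2
  + (partial e3 (rext f) (mer s) ^ 2 + 0))).
unfold dmer.
pose proof (euler_first f Hf _ _ _ (S2_nonzero _ (mer_S2 s))) as E1.
change (mS s, 0, - mT s) with (mer s) in E1.
pose proof (mS_mT s) as ST.
set (S := mS s) in *. set (T := mT s) in *.
set (p1 := partial e1 (rext f) (mer s)) in *. set (p2 := partial e2 (rext f) (mer s)) in *.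
set (p3 := partial e3 (rext f) (mer s)) in *.
assert (E : p1 ^ 2 + p3 ^ 2 = (p1 * T + p3 * S) ^ 2).
{ transitivity ((p1 * T + p3 * S) ^ 2 + (p1 * S - p3 * T) ^ 2).
  - transitivity ((p1 ^ 2 + p3 ^ 2) * (S ^ 2 + T ^ 2)); [rewrite ST; ring|ring].
  - replace (p1 * S - p3 * T) with 0 by lra. ring. }
replace (p1 ^ 2 + (p2 ^ 2 + (p3 ^ 2 + 0))) with (p2 ^ 2 + (p1 ^ 2 + p3 ^ 2)) by ring.
rewrite E. ring.
Qed.

End Rotation.

Lemma north_nonzero : ((0, 0, 1) : R3) <> zero.
Proof. apply nonzero3_coords. lra. Qed.

Lemma south_nonzero : ((0, 0, -1) : R3) <> zero.
Proof. apply nonzero3_coords. lra. Qed.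

Lemma f_mer_lim_m : is_lim (fun s => f (mer s)) m_infty (f (0, 0, 1)).
Proof.
rewrite <- (radial_S2 (0, 0, 1)) by (unfold S2; ring).
apply (is_lim_ext (fun s => rext f (mer s))).
{ intros s. unfold rext. now rewrite radial_S2 by apply mer_S2. }
apply mer_lim_m, rext_C1. exact Hf. apply north_nonzero.
Qed.

Lemma f_mer_lim_p : is_lim (fun s => f (mer s)) p_infty (f (0, 0, -1)).
Proof.
rewrite <- (radial_S2 (0, 0, -1)) by (unfold S2; ring).
apply (is_lim_ext (fun s => rext f (mer s))).
{ intros s. unfold rext. now rewrite radial_S2 by apply mer_S2. }
apply mer_lim_p, rext_C1. exact Hf. apply south_nonzero.
Qed.

Lemma mS_lim_m : is_lim mS m_infty 0.
Proof.
replace 0 with (2 * 0 / (1 + 0 ^ 2)) by field.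
apply (is_lim_comp_continuous exp (fun r => 2 * r / (1 + r ^ 2)) m_infty 0).
- exact is_lim_exp_m.
- apply (ex_derive_continuous (fun r : R => 2 * r / (1 + r ^ 2)) 0). auto_derive. lra.
Qed.

Lemma mT_lim_m : is_lim mT m_infty (-1).
Proof.
replace (-1) with ((0 ^ 2 - 1) / (1 + 0 ^ 2)) by field.
apply (is_lim_comp_continuous exp (fun r => (r ^ 2 - 1) / (1 + r ^ 2)) m_infty 0).
- exact is_lim_exp_m.
- apply (ex_derive_continuous (fun r : R => (r ^ 2 - 1) / (1 + r ^ 2)) 0). auto_derive. lra.
Qed.

Lemma is_lim_mult_finite (g h : R -> R) (x : Rbar) (a b : R) :
  is_lim g x a -> is_lim h x b -> is_lim (fun s => g s * h s) x (a * b).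
Proof. intros Hg Hh. exact (is_lim_mult g h x a b Hg Hh I). Qed.

(** The partial derivatives converge at the pole, while the velocity of the meridian carries a
    factor [mS]. *)
Lemma dmer_lim_m : is_lim dmer m_infty 0.
Proof.
assert (L1 := mer_lim_m _ (partial_rext_C1 f Hf e1 _ ltac:(simpl; auto) north_nonzero)).
assert (L3 := mer_lim_m _ (partial_rext_C1 f Hf e3 _ ltac:(simpl; auto) north_nonzero)).
unfold dmer.
set (a1 := partial e1 (rext f) (0, 0, 1)) in *.
set (a3 := partial e3 (rext f) (0, 0, 1)) in *.
replace (Finite 0) with (Finite (a1 * (- (0 * -1)) + a3 * (- (0 * 0)))) by (f_equal; ring).
apply (is_lim_ext (fun s => partial e1 (rext f) (mer s) * - (mS s * mT s) +
   partial e3 (rext f) (mer s) * - (mS s * mS s))). { intros; ring. }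
apply is_lim_plus'; apply is_lim_mult_finite; trivial.
- apply (is_lim_opp (fun s => mS s * mT s) m_infty (0 * -1)).
  apply is_lim_mult_finite. apply mS_lim_m. apply mT_lim_m.
- apply (is_lim_opp (fun s => mS s * mS s) m_infty (0 * 0)).
  apply is_lim_mult_finite; apply mS_lim_m.
Qed.

End Meridian.

(** * The Neumann system *)

Lemma mean_value (g dg : R -> R) (a b : R) :
  (forall s, is_derive g s (dg s)) ->
  exists c, Rmin a b <= c <= Rmax a b /\ g b - g a = dg c * (b - a).
Proof.
intros H. apply MVT_gen.
- intros; apply H.
- intros s _. apply continuity_pt_filterlim.
  apply (ex_derive_continuous g s). eexists. apply H.
Qed.

Lemma is_derive_value (g : R -> R) (t l l' : R) :
  is_derive g t l -> l = l' -> is_derive g t l'.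
Proof. now intros H <-. Qed.

Lemma gronwall_zero (N dN : R -> R) (K s0 : R) :
  (forall s, is_derive N s (dN s)) -> (forall s, 0 <= N s) ->
  (forall s, Rabs (dN s) <= K * N s) -> N s0 = 0 -> forall s, N s = 0.
Proof.
intros HD HN HK H0 s.
(* [k = -1] treats the times after [s0] and [k = 1] those before; [N t * exp (k * K * t)] is
   monotone and stays below its value 0 at [s0]. *)
assert (G : forall k, (forall t, 0 <= k * (dN t + k * K * N t)) -> k = 1 \/ k = -1 ->
  0 <= k * (s0 - s) -> N s = 0).
{ intros k Hk K1 Hs.
  destruct (mean_value (fun t => N t * exp (k * K * t))
    (fun t => (dN t + k * K * N t) * exp (k * K * t)) s0 s) as [c [_ E]].
  - intros t. auto_derive. exact (ex_intro _ _ (HD t)).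
    rewrite (is_derive_unique N t _ (HD t) : Derive (fun x : R => N x) t = _). ring.
  - rewrite H0, Rmult_0_l, Rminus_0_r in E.
    assert (P1 := exp_pos (k * K * s)). assert (P2 := exp_pos (k * K * c)).
    assert (P3 := HN s). specialize (Hk c).
    assert (N s * exp (k * K * s) <= 0).
    { rewrite E.
      replace (_ * (s - s0)) with
        (- (k * (dN c + k * K * N c) * exp (k * K * c) * (k * (s0 - s)))).
      - assert (0 <= k * (dN c + k * K * N c) * exp (k * K * c) * (k * (s0 - s)))
          by (apply Rmult_le_pos; [apply Rmult_le_pos|]; lra). lra.
      - destruct K1 as [-> | ->]; ring. }
    apply Rle_antisym; [|easy].
    apply (Rmult_le_reg_r (exp (k * K * s))); lra. }
assert (B : forall t, - (K * N t) <= dN t <= K * N t).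
{ intros t. apply Rabs_le_between. apply HK. }
destruct (Rle_dec s0 s) as [L|L].
- apply (G (-1)); [|now right|lra]. intros t. specialize (B t). lra.
- apply (G 1); [|now left|lra]. intros t. specialize (B t). lra.
Qed.

Lemma first_integral (g : R -> R) (l : R) :
  (forall s, is_derive g s 0) -> is_lim g m_infty l -> forall s, g s = l.
Proof.
intros H L s.
assert (E : forall t, g t = g s).
{ intros t. destruct (mean_value g (fun _ => 0) s t H) as [c [_ Hc]]. lra. }
assert (L' : is_lim (fun _ => g s) m_infty l) by exact (is_lim_ext _ _ _ _ E L).
apply is_lim_unique in L'. rewrite Lim_const in L'. now injection L'.
Qed.

Lemma linear_uniqueness (y w k : R -> R) (M s0 : R) :
  (forall s, is_derive y s (w s)) -> (forall s, is_derive w s (k s * y s)) ->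
  (forall s, Rabs (k s) <= M) -> y s0 = 0 -> w s0 = 0 -> forall s, y s = 0.
Proof.
intros Hy Hw Hk Y0 W0 s.
assert (N : y s ^ 2 + w s ^ 2 = 0).
{ apply (gronwall_zero (fun s => y s ^ 2 + w s ^ 2)
    (fun s => 2 * (1 + k s) * (y s * w s)) (1 + M) s0).
  - intros t. auto_derive.
    + repeat split; eexists; auto.
    + rewrite (is_derive_unique y t _ (Hy t) : Derive (fun x : R => y x) t = _).
      rewrite (is_derive_unique w t _ (Hw t) : Derive (fun x : R => w x) t = _). ring.
  - intros t. nra.
  - intros t. rewrite !Rabs_mult, (Rabs_pos_eq 2) by lra.
    assert (A1 : Rabs (1 + k t) <= 1 + M).
    { eapply Rle_trans. apply Rabs_triang. rewrite Rabs_R1. specialize (Hk t). lra. }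
    rewrite <- (pow2_abs (y t)), <- (pow2_abs (w t)).
    assert (P1 := Rabs_pos (y t)). assert (P2 := Rabs_pos (w t)).
    assert (P3 := Rabs_pos (1 + k t)).
    apply Rle_trans with (Rabs (1 + k t) * (Rabs (y t) ^ 2 + Rabs (w t) ^ 2)).
    + assert (0 <= (Rabs (y t) - Rabs (w t)) ^ 2) by apply pow2_ge_0. nra.
    + apply Rmult_le_compat_r; nra.
  - rewrite Y0, W0. ring. }
nra.
Qed.

Lemma is_derive_sq_diff (g h : R -> R) (t a b : R) :
  is_derive g t a -> is_derive h t b ->
  is_derive (fun u => (g u - h u) ^ 2) t (2 * (g t - h t) * (a - b)).
Proof.
intros Hg Hh. auto_derive.
- repeat split; eexists; eassumption.
- rewrite (is_derive_unique g t a Hg : Derive (fun x : R => g x) t = _).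
  rewrite (is_derive_unique h t b Hh : Derive (fun x : R => h x) t = _). ring.
Qed.

(* The phase space of the Neumann system: a point of the unit sphere and its
   angular momentum (L01, L20, L12). *)
Record state := State { q0 : R; q1 : R; q2 : R; l01 : R; l20 : R; l12 : R }.

(** The velocity is the vector product of angular momentum and position, and the coefficients 1, -4,
    3 are differences of the eigenvalues 0, 1, 4. The multiplier of the constraint cancels in the
    momentum equations. *)
Definition neumann_solution (X : R -> state) : Prop :=
  forall s,
    is_derive (fun t => q0 (X t)) s (l20 (X s) * q2 (X s) - l01 (X s) * q1 (X s)) /\
    is_derive (fun t => q1 (X t)) s (l01 (X s) * q0 (X s) - l12 (X s) * q2 (X s)) /\
    is_derive (fun t => q2 (X t)) s (l12 (X s) * q1 (X s) - l20 (X s) * q0 (X s)) /\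
    is_derive (fun t => l01 (X t)) s (q0 (X s) * q1 (X s)) /\
    is_derive (fun t => l20 (X t)) s (- 4 * (q0 (X s) * q2 (X s))) /\
    is_derive (fun t => l12 (X t)) s (3 * (q1 (X s) * q2 (X s))).

Definition on_sphere (X : state) : Prop := q0 X ^ 2 + q1 X ^ 2 + q2 X ^ 2 = 1.

Lemma product_bound (a b k : R) : -1 <= k <= 1 ->
  - (a ^ 2 + b ^ 2) <= 2 * (a * b * k) <= a ^ 2 + b ^ 2.
Proof.
intros Hk.
assert (P1 := pow2_ge_0 (a - b)). assert (P2 := pow2_ge_0 (a + b)).
assert (P3 : 0 <= (1 + k) * (a + b) ^ 2) by (apply Rmult_le_pos; lra).
assert (P4 : 0 <= (1 - k) * (a - b) ^ 2) by (apply Rmult_le_pos; lra).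
assert (P5 : 0 <= (1 + k) * (a - b) ^ 2) by (apply Rmult_le_pos; lra).
assert (P6 : 0 <= (1 - k) * (a + b) ^ 2) by (apply Rmult_le_pos; lra).
split; lra.
Qed.

(** Gronwall for the squared distance. The terms containing the momenta of [Y] cancel by
    skew-symmetry of the vector product, so the remaining coefficients are positions, bounded by 1;
    30 is a generous bound for their total. *)
Lemma neumann_uniqueness (X Y : R -> state) (s0 : R) :
  neumann_solution X -> neumann_solution Y ->
  (forall s, on_sphere (X s)) -> (forall s, on_sphere (Y s)) ->
  X s0 = Y s0 -> forall s, q0 (X s) = q0 (Y s) /\ q1 (X s) = q1 (Y s) /\ q2 (X s) = q2 (Y s).
Proof.
intros HX HY SX SY E0 s.
assert (N : (q0 (X s) - q0 (Y s)) ^ 2 + (q1 (X s) - q1 (Y s)) ^ 2 + (q2 (X s) - q2 (Y s)) ^ 2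
  + (l01 (X s) - l01 (Y s)) ^ 2 + (l20 (X s) - l20 (Y s)) ^ 2 + (l12 (X s) - l12 (Y s)) ^ 2 = 0).
{ revert s.
  apply (gronwall_zero (fun s => (q0 (X s) - q0 (Y s)) ^ 2 + (q1 (X s) - q1 (Y s)) ^ 2
      + (q2 (X s) - q2 (Y s)) ^ 2 + (l01 (X s) - l01 (Y s)) ^ 2 + (l20 (X s) - l20 (Y s)) ^ 2
      + (l12 (X s) - l12 (Y s)) ^ 2) (fun s =>
    let d0 := q0 (X s) - q0 (Y s) in let d1 := q1 (X s) - q1 (Y s) in
    let d2 := q2 (X s) - q2 (Y s) in let dA := l01 (X s) - l01 (Y s) in
    let dB := l20 (X s) - l20 (Y s) in let dC := l12 (X s) - l12 (Y s) in
    2 * (d0 * dB * q2 (X s)) - 2 * (d0 * dA * q1 (X s))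
    + 2 * (d1 * dA * q0 (X s)) - 2 * (d1 * dC * q2 (X s))
    + 2 * (d2 * dC * q1 (X s)) - 2 * (d2 * dB * q0 (X s))
    + (2 * (dA * d0 * q1 (X s)) + 2 * (dA * d1 * q0 (Y s)))
    - 4 * (2 * (dB * d0 * q2 (X s)) + 2 * (dB * d2 * q0 (Y s)))
    + 3 * (2 * (dC * d1 * q2 (X s)) + 2 * (dC * d2 * q1 (Y s)))) 30 s0).
  - intros s. destruct (HX s) as [X0 [X1 [X2 [XA [XB XC]]]]].
    destruct (HY s) as [Y0 [Y1 [Y2 [YA [YB YC]]]]].
    eapply is_derive_value.
    + do 5 (apply @is_derive_plus; [|refine (is_derive_sq_diff _ _ s _ _ _ _); eassumption]).
      refine (is_derive_sq_diff _ _ s _ _ _ _); eassumption.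
    + unfold plus; simpl. ring.
  - intros s. repeat apply Rplus_le_le_0_compat; apply pow2_ge_0.
  - intros s. cbv zeta.
    assert (BX : -1 <= q0 (X s) <= 1 /\ -1 <= q1 (X s) <= 1 /\ -1 <= q2 (X s) <= 1).
    { specialize (SX s). unfold on_sphere in SX. repeat split; nra. }
    assert (BY : -1 <= q0 (Y s) <= 1 /\ -1 <= q1 (Y s) <= 1 /\ -1 <= q2 (Y s) <= 1).
    { specialize (SY s). unfold on_sphere in SY. repeat split; nra. }
    destruct BX as [BX0 [BX1 BX2]]. destruct BY as [BY0 [BY1 BY2]].
    set (d0 := q0 (X s) - q0 (Y s)). set (d1 := q1 (X s) - q1 (Y s)).
    set (d2 := q2 (X s) - q2 (Y s)). set (dA := l01 (X s) - l01 (Y s)).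
    set (dB := l20 (X s) - l20 (Y s)). set (dC := l12 (X s) - l12 (Y s)).
    pose proof (product_bound d0 dB _ BX2). pose proof (product_bound d0 dA _ BX1).
    pose proof (product_bound d1 dA _ BX0). pose proof (product_bound d1 dC _ BX2).
    pose proof (product_bound d2 dC _ BX1). pose proof (product_bound d2 dB _ BX0).
    pose proof (product_bound dA d0 _ BX1). pose proof (product_bound dA d1 _ BY0).
    pose proof (product_bound dB d0 _ BX2). pose proof (product_bound dB d2 _ BY0).
    pose proof (product_bound dC d1 _ BX2). pose proof (product_bound dC d2 _ BY1).
    pose proof (pow2_ge_0 d0). pose proof (pow2_ge_0 d1). pose proof (pow2_ge_0 d2).
    pose proof (pow2_ge_0 dA). pose proof (pow2_ge_0 dB). pose proof (pow2_ge_0 dC).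
    apply Rabs_le. lra.
  - rewrite E0. ring. }
assert (Z : forall a b, (a - b) ^ 2 <= 0 -> a = b).
{ intros a b H. apply Rminus_diag_uniq, Rsqr_0_uniq. unfold Rsqr.
  pose proof (pow2_ge_0 (a - b)). lra. }
pose proof (pow2_ge_0 (q0 (X s) - q0 (Y s))). pose proof (pow2_ge_0 (q1 (X s) - q1 (Y s))).
pose proof (pow2_ge_0 (q2 (X s) - q2 (Y s))). pose proof (pow2_ge_0 (l01 (X s) - l01 (Y s))).
pose proof (pow2_ge_0 (l20 (X s) - l20 (Y s))). pose proof (pow2_ge_0 (l12 (X s) - l12 (Y s))).
repeat split; apply Z; lra.
Qed.

(* [w1] and [w2] stand for [m1 * r] and [m2 * r ^ 2]. *)
Definition lift_norm (w1 w2 : R) : R := 1 + w1 ^ 2 + w2 ^ 2 + w1 ^ 2 * w2 ^ 2 / 9.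

(** The first three entries are [tau] of [(1, w1, w2, - w1 w2 / 3)]. The others are the angular
    momenta of the motion in which [w1] and [w2] are multiples of [exp s] and [exp s ^ 2]. *)
Definition lift_state (w1 w2 : R) : state :=
  let D := lift_norm w1 w2 in
  State ((1 - w1 ^ 2 - w2 ^ 2 + w1 ^ 2 * w2 ^ 2 / 9) / D)
        (2 * w1 * (1 - w2 ^ 2 / 3) / D) (2 * w2 * (1 + w1 ^ 2 / 3) / D)
        (2 * w1 * (1 + w2 ^ 2 / 3) / D) (- 4 * w2 * (1 - w1 ^ 2 / 3) / D)
        (4 * w1 * w2 / D).

Lemma lift_norm_pos (w1 w2 : R) : 0 < lift_norm w1 w2.
Proof.
unfold lift_norm. pose proof (pow2_ge_0 w1). pose proof (pow2_ge_0 w2).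
assert (0 <= w1 ^ 2 * w2 ^ 2) by now apply Rmult_le_pos. lra.
Qed.

Lemma lift_state_sphere (w1 w2 : R) : on_sphere (lift_state w1 w2).
Proof.
unfold on_sphere, lift_state; simpl q0; simpl q1; simpl q2.
pose proof (lift_norm_pos w1 w2). unfold lift_norm in *. field. lra.
Qed.

Lemma lift_state_neumann (m1 m2 : R) :
  neumann_solution (fun s => lift_state (m1 * exp s) (m2 * exp s ^ 2)).
Proof.
intros s. pose proof (lift_norm_pos (m1 * exp s) (m2 * exp s ^ 2)) as P.
unfold lift_state, lift_norm in *. cbn [q0 q1 q2 l01 l20 l12].
refine (conj _ (conj _ (conj _ (conj _ (conj _ _)))));
  (auto_derive; [lra | field; lra]).
Qed.

(** The quadratic relations factor as [(A + x1) (A - x1) = C^2 / 3] and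
    [(x2 - B/2) (x2 + B/2) = C^2 / 3]. On [lift_state w1 w2], with norm [D], the first factors are
    [4 w1 / D] and [4 w2 / D], and [C] is [4 w1 w2 / D]. This is where the two quotients come from,
    and why the product of the three is positive. *)
Lemma neumann_states (x0 x1 x2 A B C : R) :
  on_sphere (State x0 x1 x2 A B C) ->
  x0 * C + x1 * B + x2 * A = 0 ->
  x1 ^ 2 = A ^ 2 - C ^ 2 / 3 -> x2 ^ 2 = B ^ 2 / 4 + C ^ 2 / 3 ->
  0 < (A + x1) * (x2 - B / 2) * C ->
  State x0 x1 x2 A B C = lift_state (C / (x2 - B / 2)) (C / (A + x1)).
Proof.
unfold on_sphere. cbn [q0 q1 q2]. intros HS HL H1 H2 HP.
set (al := A + x1) in *. set (be := x2 - B / 2) in *.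
assert (Hal : al <> 0) by (intros E; rewrite E in HP; lra).
assert (Hbe : be <> 0) by (intros E; rewrite E in HP; lra).
assert (HC : C <> 0) by (intros E; rewrite E in HP; lra).
set (w1 := C / be). set (w2 := C / al).
assert (Hw1 : w1 <> 0) by (unfold w1; apply Rmult_integral_contrapositive_currified; [easy|now apply Rinv_neq_0_compat]).
assert (Hw2 : w2 <> 0) by (unfold w2; apply Rmult_integral_contrapositive_currified; [easy|now apply Rinv_neq_0_compat]).
assert (Eal : al = C / w2) by (unfold w2; field; auto).
assert (Ebe : be = C / w1) by (unfold w1; field; auto).
assert (Eal' : A - x1 = C * w2 / 3).
{ apply (Rmult_eq_reg_l al); [|easy]. unfold w2.
  transitivity (C ^ 2 / 3). unfold al; lra. field; auto. }
assert (Ebe' : x2 + B / 2 = C * w1 / 3).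
{ apply (Rmult_eq_reg_l be); [|easy]. unfold w1.
  transitivity (C ^ 2 / 3). unfold be; lra. field; auto. }
pose proof (lift_norm_pos w1 w2) as PD.
(* The relations are homogeneous and give the state as [k] times [lift_state w1 w2]; positivity
   makes [k > 0], and the sphere gives [k ^ 2 = 1]. *)
set (k := C * lift_norm w1 w2 / (4 * w1 * w2)).
assert (EC : C = k * (4 * w1 * w2 / lift_norm w1 w2)) by (unfold k; field; lra).
assert (Pk : 0 < k).
{ replace k with (al * be * C * (lift_norm w1 w2 / (4 * C ^ 2))).
  - apply Rmult_lt_0_compat; [easy|]. apply Rdiv_lt_0_compat; [easy|].
    assert (0 < C ^ 2) by nra. lra.
  - unfold k, w1, w2. field. auto. }
assert (E1 : x1 = k * (2 * w1 * (1 - w2 ^ 2 / 3) / lift_norm w1 w2)).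
{ replace x1 with ((al - (A - x1)) / 2) by (unfold al; field).
  rewrite Eal', Eal, EC. field. lra. }
assert (EA : A = k * (2 * w1 * (1 + w2 ^ 2 / 3) / lift_norm w1 w2)).
{ replace A with ((al + (A - x1)) / 2) by (unfold al; field).
  rewrite Eal', Eal, EC. field. lra. }
assert (E2 : x2 = k * (2 * w2 * (1 + w1 ^ 2 / 3) / lift_norm w1 w2)).
{ replace x2 with ((be + (x2 + B / 2)) / 2) by (unfold be; field).
  rewrite Ebe', Ebe, EC. field. lra. }
assert (EB : B = k * (- 4 * w2 * (1 - w1 ^ 2 / 3) / lift_norm w1 w2)).
{ replace B with ((x2 + B / 2) - be) by (unfold be; field).
  rewrite Ebe', Ebe, EC. field. lra. }
(* Orthogonality of position and angular momentum determines [x0], since [C] is not zero. *)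
assert (E0 : x0 = k * ((1 - w1 ^ 2 - w2 ^ 2 + w1 ^ 2 * w2 ^ 2 / 9) / lift_norm w1 w2)).
{ apply (Rmult_eq_reg_r C); [|easy].
  replace (x0 * C) with (- (x1 * B) - x2 * A) by lra.
  rewrite E1, E2, EA, EB, EC. unfold lift_norm in *. field. lra. }
assert (K1 : k = 1).
{ assert (k ^ 2 = 1); [|nra].
  pose proof (lift_state_sphere w1 w2) as L. unfold on_sphere, lift_state in L. cbn [q0 q1 q2] in L.
  rewrite E0, E1, E2 in HS. clear - HS L.
  set (a := (1 - _ - _ + _) / _) in HS, L. set (b := 2 * w1 * _ / _) in HS, L.
  set (c := 2 * w2 * _ / _) in HS, L.
  replace (k ^ 2) with (k ^ 2 * (a ^ 2 + b ^ 2 + c ^ 2)) by (rewrite L; ring).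
  lra. }
unfold lift_state. rewrite K1 in *. 
rewrite E0, E1, E2, EA, EB at 1. rewrite EC at 1. now rewrite !Rmult_1_l.
Qed.

Lemma is_lim_value (g : R -> R) (x : Rbar) (a b : R) :
  is_lim g x a -> a = b -> is_lim g x b.
Proof. now intros H <-. Qed.

Ltac lim_poly :=
  eapply is_lim_value;
  [ repeat first [ eassumption | apply is_lim_minus' | apply is_lim_plus'
                 | apply is_lim_mult_finite | apply is_lim_const ] | ].

Ltac derive_known :=
  repeat match goal with
  | H : forall s, is_derive ?g s _ |- context [Derive (fun x : R => ?g x) ?t] =>
      rewrite (is_derive_unique g t _ (H t) : Derive (fun x : R => g x) t = _)
  end.

Ltac derive_ring :=
  auto_derive; [repeat split; eexists; eauto | derive_known; try ring].

(** Two solutions of one linear equation with zero Wronskian are proportional: [p b - q a] solves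
    the equation, and taking for [(p, q)] the direction of [(a, b)] at a point where it is not zero
    makes value and derivative vanish there. *)
Lemma common_phase (a b c d k : R -> R) (M : R) :
  (forall s, is_derive a s (c s)) -> (forall s, is_derive b s (d s)) ->
  (forall s, is_derive c s (k s * a s)) -> (forall s, is_derive d s (k s * b s)) ->
  (forall s, Rabs (k s) <= M) -> (forall s, a s * d s - b s * c s = 0) ->
  exists p q, p ^ 2 + q ^ 2 = 1 /\ forall s, p * b s - q * a s = 0.
Proof.
intros Ha Hb Hc Hd Hk HW.
destruct (classic (exists s, 0 < a s ^ 2 + b s ^ 2)) as [[s0 H0]|N].
- set (n := sqrt (a s0 ^ 2 + b s0 ^ 2)).
  assert (Pn : 0 < n) by now apply sqrt_lt_R0.
  assert (En : n ^ 2 = a s0 ^ 2 + b s0 ^ 2) by (apply pow2_sqrt; lra).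
  exists (a s0 / n), (b s0 / n). split.
  + replace 1 with (n ^ 2 / n ^ 2) by (field; lra). rewrite En at 1. field. lra.
  + apply (linear_uniqueness _ (fun s => a s0 / n * d s - b s0 / n * c s) k M s0); trivial.
    * intros t. derive_ring.
    * intros t. derive_ring.
    * field. lra.
    * replace (_ - _) with ((a s0 * d s0 - b s0 * c s0) / n) by (field; lra).
      rewrite HW. field. lra.
- exists 1, 0. split. ring. intros s.
  assert (b s = 0); [|lra].
  destruct (Req_dec (b s) 0) as [E|E]; [exact E|]. exfalso. apply N. exists s.
  pose proof (pow2_ge_0 (a s)). assert (0 < b s ^ 2) by nra. lra.
Qed.

(** * Integration of the real Neumann system *)

Section RealSystem.

Variables x0 x1 x2 y0 y1 y2 e : R -> R.
Variable l0 : R.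
Hypothesis Dx0 : forall s, is_derive x0 s (y0 s).
Hypothesis Dx1 : forall s, is_derive x1 s (y1 s).
Hypothesis Dx2 : forall s, is_derive x2 s (y2 s).
Hypothesis Dy0 : forall s, is_derive y0 s ((0 - e s) * x0 s).
Hypothesis Dy1 : forall s, is_derive y1 s ((1 - e s) * x1 s).
Hypothesis Dy2 : forall s, is_derive y2 s ((4 - e s) * x2 s).
Hypothesis He : forall s, 0 <= e s <= 8.
Hypothesis Hsphere : forall s, x0 s * x0 s + x1 s * x1 s + x2 s * x2 s = 1.
Hypothesis Lx0 : is_lim x0 m_infty l0.
Hypothesis Lx1 : is_lim x1 m_infty 0.
Hypothesis Lx2 : is_lim x2 m_infty 0.
Hypothesis Ly0 : is_lim y0 m_infty 0.
Hypothesis Ly1 : is_lim y1 m_infty 0.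
Hypothesis Ly2 : is_lim y2 m_infty 0.
Hypothesis N1 : exists s, x1 s <> 0.
Hypothesis N2 : exists s, x2 s <> 0.

Let A (s : R) : R := x0 s * y1 s - x1 s * y0 s.
Let B (s : R) : R := x2 s * y0 s - x0 s * y2 s.
Let C (s : R) : R := x1 s * y2 s - x2 s * y1 s.

Let DA (s : R) : is_derive A s (x0 s * x1 s).
Proof. unfold A. derive_ring. Qed.

Let DB (s : R) : is_derive B s (- 4 * (x0 s * x2 s)).
Proof. unfold B. derive_ring. Qed.

Let DC (s : R) : is_derive C s (3 * (x1 s * x2 s)).
Proof. unfold C. derive_ring. Qed.

Let tangent (s : R) : x0 s * y0 s + x1 s * y1 s + x2 s * y2 s = 0.
Proof.
assert (D : is_derive (fun s => x0 s * x0 s + x1 s * x1 s + x2 s * x2 s) s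
  (2 * (x0 s * y0 s + x1 s * y1 s + x2 s * y2 s))) by derive_ring.
assert (D' : is_derive (fun s => x0 s * x0 s + x1 s * x1 s + x2 s * x2 s) s 0).
{ apply (is_derive_ext (fun _ => 1)). intros; now rewrite Hsphere. apply @is_derive_const. }
pose proof (is_derive_unique _ _ _ D). pose proof (is_derive_unique _ _ _ D'). lra.
Qed.

(** A double vector product: the angular momentum times [x] is [|x|^2 y - <x, y> x], where [x] has
    length 1 and is orthogonal to [y]. *)
Let velocity (s : R) :
  y0 s = B s * x2 s - A s * x1 s /\ y1 s = A s * x0 s - C s * x2 s /\
  y2 s = C s * x1 s - B s * x0 s.
Proof.
pose proof (tangent s) as T. pose proof (Hsphere s) as U. unfold A, B, C.
repeat split.
- transitivity (y0 s * (x0 s * x0 s + x1 s * x1 s + x2 s * x2 s)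
    - x0 s * (x0 s * y0 s + x1 s * y1 s + x2 s * y2 s)); [rewrite U, T|]; ring.
- transitivity (y1 s * (x0 s * x0 s + x1 s * x1 s + x2 s * x2 s)
    - x1 s * (x0 s * y0 s + x1 s * y1 s + x2 s * y2 s)); [rewrite U, T|]; ring.
- transitivity (y2 s * (x0 s * x0 s + x1 s * x1 s + x2 s * x2 s)
    - x2 s * (x0 s * y0 s + x1 s * y1 s + x2 s * y2 s)); [rewrite U, T|]; ring.
Qed.

(* Uhlenbeck's integrals of the Neumann system with frequencies 0, 1, 4. *)
Let integral1 (s : R) : x1 s * x1 s - A s * A s + C s * C s * (1 / 3) = 0.
Proof.
revert s. apply first_integral.
- intros s. destruct (velocity s) as [_ [V _]]. 
  (* The coefficients of the integral are inverse differences of 0, 1, 4; they make its derivative a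
     multiple of one line of [velocity]. *)
  apply (is_derive_value _ _ (2 * x1 s * (y1 s - (A s * x0 s - C s * x2 s)))).
  + derive_ring. field.
  + rewrite V. ring.
- unfold A, C. lim_poly. ring.
Qed.

Let integral2 (s : R) : x2 s * x2 s - B s * B s * (1 / 4) - C s * C s * (1 / 3) = 0.
Proof.
revert s. apply first_integral.
- intros s. destruct (velocity s) as [_ [_ V]].
  apply (is_derive_value _ _ (2 * x2 s * (y2 s - (C s * x1 s - B s * x0 s)))).
  + derive_ring. field.
  + rewrite V. ring.
- unfold B, C. lim_poly. ring.
Qed.

(** If [C] vanished identically, so would its derivative [3 x1 x2]. Where [x1] is not zero, [x2] and
    then, by [C = 0], also [y2] vanish, and linear uniqueness makes [x2] zero everywhere. *)
Let momentum_nonzero : exists s, C s <> 0.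
Proof.
apply NNPP. intros N.
assert (Z : forall s, C s = 0).
{ intros s. apply NNPP. intros H. apply N. now exists s. }
assert (P : forall s, x1 s * x2 s = 0).
{ intros s. assert (D : is_derive C s 0).
  { apply (is_derive_ext (fun _ => 0)). intros; now rewrite Z. apply @is_derive_const. }
  pose proof (is_derive_unique _ _ _ D). pose proof (is_derive_unique _ _ _ (DC s)). lra. }
destruct N1 as [s1 H1]. destruct N2 as [s2 H2]. apply H2.
apply (linear_uniqueness x2 y2 (fun s => 4 - e s) 4 s1); trivial.
- intros s. apply Rabs_le. specialize (He s). lra.
- destruct (Rmult_integral _ _ (P s1)); easy.
- assert (x2 s1 = 0) as E by (destruct (Rmult_integral _ _ (P s1)); easy).
  pose proof (Z s1) as Z1. unfold C in Z1. rewrite E in Z1.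
  destruct (Rmult_integral (x1 s1) (y2 s1)); [lra|easy|easy].
Qed.

Lemma real_system_solution : exists eps m1 m2,
  (eps = 1 \/ eps = -1) /\ m1 <> 0 /\ m2 <> 0 /\
  forall s, let X := lift_state (m1 * exp s) (m2 * exp s ^ 2) in
    eps * x0 s = q0 X /\ eps * x1 s = q1 X /\ eps * x2 s = q2 X.
Proof.
destruct momentum_nonzero as [s0 HC].
assert (I1 := integral1 s0). assert (I2 := integral2 s0).
set (al := fun k => A s0 + k * x1 s0). set (be := fun k => k * x2 s0 - B s0 / 2).
(* By the integrals these two products are [C^2 / 3] and [- C^2 / 3]. Hence [al k * be k * C s0] has
   opposite signs for [k = 1] and [k = -1], and exactly one of them is admissible. *)
assert (Pal : 0 < al 1 * al (-1)).
{ unfold al. assert (0 < C s0 * C s0) by (apply Rsqr_pos_lt; easy). lra. }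
assert (Pbe : be 1 * be (-1) < 0).
{ unfold be. assert (0 < C s0 * C s0) by (apply Rsqr_pos_lt; easy). lra. }
assert (HE : exists k, (k = 1 \/ k = -1) /\ 0 < al k * be k * C s0).
{ assert (NZ : al 1 * be 1 * C s0 <> 0).
  { repeat apply Rmult_integral_contrapositive_currified; trivial; intros Q; rewrite Q in *; lra. }
  destruct (Rlt_le_dec 0 (al 1 * be 1 * C s0)) as [L|L].
  - exists 1. auto.
  - exists (-1). split; [auto|].
    assert (Q : (al 1 * al (-1)) * (be 1 * be (-1)) < 0) by nra.
    assert (L' : al 1 * be 1 * C s0 < 0) by lra.
    assert (Q2 : 0 < C s0 * C s0) by (apply Rsqr_pos_lt; easy).
    assert (Q3 : (al 1 * be 1 * C s0) * (al (-1) * be (-1) * C s0) < 0).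
    { replace (_ * _) with ((al 1 * al (-1)) * (be 1 * be (-1)) * (C s0 * C s0)) by ring. nra. }
    nra. }
destruct HE as [eps [Heps HP]]. clear Pal Pbe.
assert (E2 : eps * eps = 1) by (destruct Heps; subst; ring).
(* The momenta are quadratic in position and velocity, so they are not affected by [eps]. *)
set (X := fun s => State (eps * x0 s) (eps * x1 s) (eps * x2 s) (A s) (B s) (C s)).
assert (SX : forall s, on_sphere (X s)).
{ intros s. unfold on_sphere, X. cbn [q0 q1 q2]. rewrite <- (Hsphere s).
  transitivity (eps * eps * (x0 s * x0 s + x1 s * x1 s + x2 s * x2 s)); [ring|].
  rewrite E2. ring. }
assert (ES : X s0 = lift_state (C s0 / be eps) (C s0 / al eps)).
{ apply neumann_states.
  - apply SX.
  - unfold A, B, C. ring.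
  - transitivity (eps * eps * (x1 s0 * x1 s0)); [ring|]. rewrite E2. lra.
  - transitivity (eps * eps * (x2 s0 * x2 s0)); [ring|]. rewrite E2. lra.
  - exact HP. }
assert (Hal : al eps <> 0) by (intros Q; rewrite Q in HP; lra).
assert (Hbe : be eps <> 0) by (intros Q; rewrite Q in HP; lra).
pose proof (exp_pos s0) as Pe.
(* Normalised so that the explicit solution passes at [s0] through the state found by
   [neumann_states]. *)
exists eps, (C s0 / be eps / exp s0), (C s0 / al eps / exp s0 ^ 2).
split; [exact Heps|].
assert (Pe2 : 0 < exp s0 ^ 2) by now apply pow_lt.
split. { unfold Rdiv. repeat apply Rmult_integral_contrapositive_currified; trivial; apply Rinv_neq_0_compat; lra. }
split. { unfold Rdiv. repeat apply Rmult_integral_contrapositive_currified; trivial; apply Rinv_neq_0_compat; lra. }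
apply (neumann_uniqueness X
  (fun s => lift_state (C s0 / be eps / exp s0 * exp s) (C s0 / al eps / exp s0 ^ 2 * exp s ^ 2)) s0).
- intros s. destruct (velocity s) as [V0 [V1 V2]]. unfold X. cbn [q0 q1 q2 l01 l20 l12].
  refine (conj _ (conj _ (conj _ (conj _ (conj _ _))))).
  + apply (is_derive_value _ _ (eps * y0 s)). derive_ring. rewrite V0. ring.
  + apply (is_derive_value _ _ (eps * y1 s)). derive_ring. rewrite V1. ring.
  + apply (is_derive_value _ _ (eps * y2 s)). derive_ring. rewrite V2. ring.
  + eapply is_derive_value. apply DA. transitivity (eps * eps * (x0 s * x1 s)); [rewrite E2|]; ring.
  + eapply is_derive_value. apply DB. transitivity (eps * eps * (-4 * (x0 s * x2 s))); [rewrite E2|]; ring.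
  + eapply is_derive_value. apply DC. transitivity (eps * eps * (3 * (x1 s * x2 s))); [rewrite E2|]; ring.
- apply lift_state_neumann.
- exact SX.
- intros s. apply lift_state_sphere.
- rewrite ES. f_equal; field; lra.
Qed.

End RealSystem.

Lemma cylinder_system_solution (u0 a1 b1 a2 b2 v0 c1 d1 c2 d2 : R -> R) (l0 : R) :
  let e := fun s => v0 s * v0 s + (c1 s * c1 s + d1 s * d1 s) + (c2 s * c2 s + d2 s * d2 s)
      + (a1 s * a1 s + b1 s * b1 s) + 4 * (a2 s * a2 s + b2 s * b2 s) in
  (forall s, is_derive u0 s (v0 s)) ->
  (forall s, is_derive a1 s (c1 s)) -> (forall s, is_derive b1 s (d1 s)) ->
  (forall s, is_derive a2 s (c2 s)) -> (forall s, is_derive b2 s (d2 s)) ->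
  (forall s, is_derive v0 s ((0 - e s) * u0 s)) ->
  (forall s, is_derive c1 s ((1 - e s) * a1 s)) ->
  (forall s, is_derive d1 s ((1 - e s) * b1 s)) ->
  (forall s, is_derive c2 s ((4 - e s) * a2 s)) ->
  (forall s, is_derive d2 s ((4 - e s) * b2 s)) ->
  (forall s, u0 s * u0 s + (a1 s * a1 s + b1 s * b1 s) + (a2 s * a2 s + b2 s * b2 s) = 1) ->
  is_lim u0 m_infty l0 ->
  is_lim a1 m_infty 0 -> is_lim b1 m_infty 0 -> is_lim a2 m_infty 0 -> is_lim b2 m_infty 0 ->
  is_lim v0 m_infty 0 ->
  is_lim c1 m_infty 0 -> is_lim d1 m_infty 0 -> is_lim c2 m_infty 0 -> is_lim d2 m_infty 0 ->
  (exists s, a1 s <> 0 \/ b1 s <> 0) -> (exists s, a2 s <> 0 \/ b2 s <> 0) ->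
  exists eps m1 m2 p1 r1 p2 r2,
    (eps = 1 \/ eps = -1) /\ m1 <> 0 /\ m2 <> 0 /\
    p1 ^ 2 + r1 ^ 2 = 1 /\ p2 ^ 2 + r2 ^ 2 = 1 /\
    forall s, let X := lift_state (m1 * exp s) (m2 * exp s ^ 2) in
      eps * u0 s = q0 X /\ eps * a1 s = p1 * q1 X /\ eps * b1 s = r1 * q1 X /\
      eps * a2 s = p2 * q2 X /\ eps * b2 s = r2 * q2 X.
Proof.
intros e Du0 Da1 Db1 Da2 Db2 Dv0 Dc1 Dd1 Dc2 Dd2 HS Lu0 La1 Lb1 La2 Lb2 Lv0 Lc1 Ld1 Lc2 Ld2 N1 N2.
assert (T : forall s, u0 s * v0 s + (a1 s * c1 s + b1 s * d1 s) + (a2 s * c2 s + b2 s * d2 s) = 0).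
{ intros s.
  assert (D : is_derive (fun s => u0 s * u0 s + (a1 s * a1 s + b1 s * b1 s)
    + (a2 s * a2 s + b2 s * b2 s)) s
    (2 * (u0 s * v0 s + (a1 s * c1 s + b1 s * d1 s) + (a2 s * c2 s + b2 s * d2 s)))) by derive_ring.
  assert (D' : is_derive (fun s => u0 s * u0 s + (a1 s * a1 s + b1 s * b1 s)
    + (a2 s * a2 s + b2 s * b2 s)) s 0).
  { apply (is_derive_ext (fun _ => 1)). intros; now rewrite HS. apply @is_derive_const. }
  pose proof (is_derive_unique _ _ _ D). pose proof (is_derive_unique _ _ _ D'). lra. }
(* The derivative of the energy is a multiple of the scalar product of [u] and [u'], which is zero
   on the sphere. The value 0, taken from the pole, says that the derivatives in [s] and in the
   angle have equal length. *)
assert (En : forall s, v0 s * v0 s + (c1 s * c1 s + d1 s * d1 s) + (c2 s * c2 s + d2 s * d2 s)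
      - (a1 s * a1 s + b1 s * b1 s) - 4 * (a2 s * a2 s + b2 s * b2 s) = 0).
{ apply first_integral.
  - intros s. 
    apply (is_derive_value _ _ (- 2 * e s * (u0 s * v0 s + (a1 s * c1 s + b1 s * d1 s)
      + (a2 s * c2 s + b2 s * d2 s)))).
    + derive_ring.
    + rewrite T. ring.
  - lim_poly. ring. }
(* With zero energy [e] is twice [|u1|^2 + 4 |u2|^2], at most 8 on the sphere. The linear uniqueness
   arguments rely on this bound. *)
assert (He : forall s, 0 <= e s <= 8).
{ intros s. specialize (En s). specialize (HS s). unfold e.
  pose proof (Rle_0_sqr (u0 s)) as Q0. pose proof (Rle_0_sqr (a1 s)) as Q1.
  pose proof (Rle_0_sqr (b1 s)) as Q2. pose proof (Rle_0_sqr (a2 s)) as Q3.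
  pose proof (Rle_0_sqr (b2 s)) as Q4. unfold Rsqr in *. lra. }
assert (W1 : forall s, a1 s * d1 s - b1 s * c1 s = 0).
{ apply first_integral. intros s. derive_ring. lim_poly. ring. }
assert (W2 : forall s, a2 s * d2 s - b2 s * c2 s = 0).
{ apply first_integral. intros s. derive_ring. lim_poly. ring. }
destruct (common_phase a1 b1 c1 d1 (fun s => 1 - e s) 8) as [p1 [r1 [U1 P1]]]; trivial.
{ intros s. apply Rabs_le. specialize (He s). lra. }
destruct (common_phase a2 b2 c2 d2 (fun s => 4 - e s) 8) as [p2 [r2 [U2 P2]]]; trivial.
{ intros s. apply Rabs_le. specialize (He s). lra. }
assert (PH : forall p r a b, p ^ 2 + r ^ 2 = 1 -> p * b - r * a = 0 ->
  a = p * (p * a + r * b) /\ b = r * (p * a + r * b)).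
{ intros p r a b U P. split.
  - transitivity ((p ^ 2 + r ^ 2) * a + r * (p * b - r * a)); [rewrite U, P|]; ring.
  - transitivity ((p ^ 2 + r ^ 2) * b - p * (p * b - r * a)); [rewrite U, P|]; ring. }
set (x1 := fun s => p1 * a1 s + r1 * b1 s). set (x2 := fun s => p2 * a2 s + r2 * b2 s).
assert (F1 : forall s, a1 s = p1 * x1 s /\ b1 s = r1 * x1 s) by (intros; now apply PH).
assert (F2 : forall s, a2 s = p2 * x2 s /\ b2 s = r2 * x2 s) by (intros; now apply PH).
destruct (real_system_solution u0 x1 x2 v0 (fun s => p1 * c1 s + r1 * d1 s)
  (fun s => p2 * c2 s + r2 * d2 s) e l0) as [eps [m1 [m2 [Heps [M1 [M2 K]]]]]]; trivial.
- intros s. unfold x1. derive_ring.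
- intros s. unfold x2. derive_ring.
- intros s. unfold x1. derive_ring.
- intros s. unfold x2. derive_ring.
- intros s. rewrite <- (HS s).
  destruct (F1 s) as [-> ->]. destruct (F2 s) as [-> ->].
  transitivity (u0 s * u0 s + (p1 ^ 2 + r1 ^ 2) * (x1 s * x1 s)
    + (p2 ^ 2 + r2 ^ 2) * (x2 s * x2 s)); [rewrite U1, U2|]; ring.
- unfold x1. lim_poly. ring.
- unfold x2. lim_poly. ring.
- lim_poly. ring.
- lim_poly. ring.
- destruct N1 as [s Hs]. exists s. intros Q. destruct (F1 s) as [Fa Fb].
  rewrite Q, Rmult_0_r in Fa, Fb. destruct Hs; auto.
- destruct N2 as [s Hs]. exists s. intros Q. destruct (F2 s) as [Fa Fb].
  rewrite Q, Rmult_0_r in Fa, Fb. destruct Hs; auto.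
- exists eps, m1, m2, p1, r1, p2, r2. repeat (split; [assumption|]).
  intros s X. destruct (K s) as [K0 [K1 K2]]. fold X in K0, K1, K2.
  destruct (F1 s) as [-> ->]. destruct (F2 s) as [-> ->].
  rewrite <- K0, <- K1, <- K2. repeat split; ring.
Qed.

(** * The profile of an equivariant harmonic sphere *)

Lemma unit_circle (p q : R) : p ^ 2 + q ^ 2 = 1 -> exists th, p = cos th /\ q = sin th.
Proof.
intros H. assert (Hp : -1 <= p <= 1) by nra.
assert (Hs : sin (acos p) ^ 2 = q ^ 2).
{ rewrite sin_acos by exact Hp. rewrite pow2_sqrt; unfold Rsqr; nra. }
destruct (Req_dec (sin (acos p)) q) as [E|E].
- exists (acos p). now rewrite cos_acos.
- exists (- acos p). rewrite cos_neg, sin_neg, cos_acos by exact Hp. split; [easy|].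
  assert ((sin (acos p) - q) * (sin (acos p) + q) = 0) as Z by lra.
  destruct (Rmult_integral _ _ Z); lra.
Qed.

Lemma S2_polar (x : R3) : S2 x ->
  x = (0, 0, 1) \/ x = (0, 0, -1) \/ exists s th, x = rotS2 th (mer s).
Proof.
destruct x as [[x1 x2] x3]. unfold S2. intros Hx.
destruct (Req_dec (x1 ^ 2 + x2 ^ 2) 0) as [Z|Z].
- assert (x1 = 0) by nra. assert (x2 = 0) by nra. subst.
  assert ((x3 - 1) * (x3 + 1) = 0) as Q by lra.
  destruct (Rmult_integral _ _ Q) as [Q1|Q1]; [left|right; left]; apply R3_ext; lra.
- right; right. set (rho := sqrt (x1 ^ 2 + x2 ^ 2)).
  assert (P : 0 < x1 ^ 2 + x2 ^ 2) by nra.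
  assert (Pr : 0 < rho) by now apply sqrt_lt_R0.
  assert (Er : rho ^ 2 = x1 ^ 2 + x2 ^ 2) by (apply pow2_sqrt; lra).
  assert (P3 : 0 < 1 + x3) by nra.
  destruct (unit_circle (x1 / rho) (x2 / rho)) as [th [C S]].
  { transitivity (rho ^ 2 / rho ^ 2); [rewrite Er at 1|]; field; lra. }
  (* [rho / (1 + x3)] is the modulus of the stereographic coordinate, that is [exp s]. *)
  exists (ln (rho / (1 + x3))), th.
  assert (Pq : 0 < rho / (1 + x3)) by (apply Rdiv_lt_0_compat; lra).
  assert (ES : mS (ln (rho / (1 + x3))) = rho).
  { unfold mS. rewrite exp_ln by exact Pq.
    replace (1 + (rho / (1 + x3)) ^ 2) with (2 / (1 + x3)). field; lra.
    transitivity (((1 + x3) ^ 2 + rho ^ 2) / (1 + x3) ^ 2); [|field; lra].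
    replace ((1 + x3) ^ 2 + rho ^ 2) with (2 * (1 + x3)) by (rewrite Er; lra).
    field; lra. }
  assert (ET : mT (ln (rho / (1 + x3))) = - x3).
  { unfold mT. rewrite exp_ln by exact Pq.
    replace (1 + (rho / (1 + x3)) ^ 2) with (2 / (1 + x3)).
    - replace ((rho / (1 + x3)) ^ 2) with (rho ^ 2 / (1 + x3) ^ 2) by (field; lra).
      replace (rho ^ 2) with ((1 - x3) * (1 + x3)) by (rewrite Er; lra). field; lra.
    - transitivity (((1 + x3) ^ 2 + rho ^ 2) / (1 + x3) ^ 2); [|field; lra].
      replace ((1 + x3) ^ 2 + rho ^ 2) with (2 * (1 + x3)) by (rewrite Er; lra).
      field; lra. }
  unfold mer, rotS2. rewrite ES, ET, <- C, <- S. apply R3_ext; field; lra.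
Qed.

Lemma lift_state_lim_m (m1 m2 : R) :
  is_lim (fun s => q0 (lift_state (m1 * exp s) (m2 * exp s ^ 2))) m_infty 1.
Proof.
set (P := fun r => q0 (lift_state (m1 * r) (m2 * r ^ 2))).
replace (Finite 1) with (Finite (P 0)).
2: { f_equal. unfold P, lift_state, lift_norm. cbn [q0]. field. }
apply (is_lim_comp_continuous exp P m_infty 0).
- exact is_lim_exp_m.
- apply (ex_derive_continuous P 0). unfold P, lift_state, lift_norm. cbn [q0].
  auto_derive. lra.
Qed.

(** With [r = exp (- s)] the fraction, expanded by [r ^ 6], has the same nonzero constant term
    [m1^2 m2^2 / 9] above and below; thus both poles go to the same point. *)
Lemma lift_state_lim_p (m1 m2 : R) : m1 <> 0 -> m2 <> 0 ->
  is_lim (fun s => q0 (lift_state (m1 * exp s) (m2 * exp s ^ 2))) p_infty 1.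
Proof.
intros M1 M2.
set (P := fun r => (r ^ 6 - m1 ^ 2 * r ^ 4 - m2 ^ 2 * r ^ 2 + m1 ^ 2 * m2 ^ 2 / 9)
  / (r ^ 6 + m1 ^ 2 * r ^ 4 + m2 ^ 2 * r ^ 2 + m1 ^ 2 * m2 ^ 2 / 9)).
assert (PM : 0 < m1 ^ 2 * m2 ^ 2).
{ apply Rmult_lt_0_compat; rewrite <- Rsqr_pow2; now apply Rsqr_pos_lt. }
replace (Finite 1) with (Finite (P 0)).
2: { f_equal. unfold P. field. split; assumption. }
apply (is_lim_ext (fun s => P (exp (- s)))).
{ intros s. unfold P. rewrite exp_Ropp. pose proof (exp_pos s).
  pose proof (lift_norm_pos (m1 * exp s) (m2 * exp s ^ 2)) as PD.
  unfold lift_state, lift_norm in *. cbn [q0].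
  set (r := exp s) in *.
  assert (Pr : 0 < r ^ 6) by now apply pow_lt.
  field. repeat split; lra. }
apply (is_lim_comp_continuous (fun s => exp (- s)) P p_infty 0).
- apply is_lim_exp_opp_p.
- apply (ex_derive_continuous P 0). unfold P. auto_derive. lra.
Qed.

Section Profile.

Variable omega : R3 -> E5.
Hypothesis Hharm : harmonic_sphere omega.
Hypothesis Hequi : equivariant omega.
Hypothesis Hfull : linearly_full omega.

Let f0 (x : R3) : R := fst (fst (omega x)).
Let f1 (x : R3) : R := Re (snd (fst (omega x))).
Let f2 (x : R3) : R := Im (snd (fst (omega x))).
Let f3 (x : R3) : R := Re (snd (omega x)).
Let f4 (x : R3) : R := Im (snd (omega x)).

Let omega_coords (x : R3) : omega x = (f0 x, (f1 x, f2 x), (f3 x, f4 x)).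
Proof. unfold f0, f1, f2, f3, f4. now destruct (omega x) as [[t [a b]] [c d]]. Qed.

Let smooth0 : smooth_on_S2 f0.
Proof. exact (proj1 (proj2 Hharm) (fun y => fst (fst y)) ltac:(simpl; auto)). Qed.
Let smooth1 : smooth_on_S2 f1.
Proof. exact (proj1 (proj2 Hharm) (fun y => Re (snd (fst y))) ltac:(simpl; auto)). Qed.
Let smooth2 : smooth_on_S2 f2.
Proof. exact (proj1 (proj2 Hharm) (fun y => Im (snd (fst y))) ltac:(simpl; auto)). Qed.
Let smooth3 : smooth_on_S2 f3.
Proof. exact (proj1 (proj2 Hharm) (fun y => Re (snd y)) ltac:(simpl; auto)). Qed.
Let smooth4 : smooth_on_S2 f4.
Proof. exact (proj1 (proj2 Hharm) (fun y => Im (snd y)) ltac:(simpl; auto 6)). Qed.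

Let sphere (x : R3) : S2 x ->
  f0 x * f0 x + (f1 x * f1 x + f2 x * f2 x) + (f3 x * f3 x + f4 x * f4 x) = 1.
Proof.
intros Hx. pose proof (proj1 Hharm x Hx) as H. rewrite omega_coords in H.
unfold S4 in H.
rewrite <- !Rsqr_pow2 in H. unfold Cmod in H. simpl fst in H. simpl snd in H.
rewrite !Rsqr_sqrt in H by nra. unfold Rsqr in H. lra.
Qed.

Let rot (th : R) (x : R3) : S2 x ->
  f0 (rotS2 th x) = f0 x /\
  f1 (rotS2 th x) = cos th * f1 x - sin th * f2 x /\
  f2 (rotS2 th x) = sin th * f1 x + cos th * f2 x /\
  f3 (rotS2 th x) = cos (2 * th) * f3 x - sin (2 * th) * f4 x /\
  f4 (rotS2 th x) = sin (2 * th) * f3 x + cos (2 * th) * f4 x.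
Proof.
intros Hx. pose proof (Hequi th x Hx) as H. rewrite !omega_coords in H.
unfold rotS4, cis, Cmult in H. simpl in H.
injection H as -> -> H2 -> H4. rewrite H2, H4.
repeat split; ring.
Qed.

Let e (s : R) : R :=
  dmer f0 s * dmer f0 s + (dmer f1 s * dmer f1 s + dmer f2 s * dmer f2 s)
  + (dmer f3 s * dmer f3 s + dmer f4 s * dmer f4 s)
  + (f1 (mer s) * f1 (mer s) + f2 (mer s) * f2 (mer s))
  + 4 * (f3 (mer s) * f3 (mer s) + f4 (mer s) * f4 (mer s)).

(** Every coordinate has this shape along a parallel, with weight [k] equal to 0, 1 or 2; for an
    imaginary part the pair [(a, b)] is the imaginary part and minus the real part. *)
Let h (k a b th : R) : R := cos (k * th) * a - sin (k * th) * b.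
Let h' (k a b th : R) : R := k * (- sin (k * th) * a - cos (k * th) * b).

Let Dh (k a b th : R) : is_derive (h k a b) th (h' k a b th).
Proof. unfold h, h'. auto_derive; [easy|ring]. Qed.

Let Dh' (k a b : R) : is_derive (h' k a b) 0 (- k ^ 2 * a).
Proof.
unfold h, h'. auto_derive; [easy|]. rewrite !Rmult_0_r, sin_0, cos_0. ring.
Qed.

Let rotation (s : R) :
  (forall th, f0 (rotS2 th (mer s)) = h 0 (f0 (mer s)) 0 th) /\
  (forall th, f1 (rotS2 th (mer s)) = h 1 (f1 (mer s)) (f2 (mer s)) th) /\
  (forall th, f2 (rotS2 th (mer s)) = h 1 (f2 (mer s)) (- f1 (mer s)) th) /\
  (forall th, f3 (rotS2 th (mer s)) = h 2 (f3 (mer s)) (f4 (mer s)) th) /\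
  (forall th, f4 (rotS2 th (mer s)) = h 2 (f4 (mer s)) (- f3 (mer s)) th).
Proof.
unfold h. repeat split; intros th; destruct (rot th (mer s) (mer_S2 s)) as [E0 [E1 [E2 [E3 E4]]]].
- rewrite E0, !Rmult_0_l, cos_0. ring.
- rewrite E1, !Rmult_1_l. ring.
- rewrite E2, !Rmult_1_l. ring.
- rewrite E3. ring.
- rewrite E4. ring.
Qed.

Let energy (s : R) : mS s ^ 2 * energyT omega (mer s) = e s.
Proof.
destruct (rotation s) as [R0 [R1 [R2 [R3 R4]]]].
pose proof (tgrad_mer f0 smooth0 s _ _ R0 (Dh _ _ _)) as T0.
pose proof (tgrad_mer f1 smooth1 s _ _ R1 (Dh _ _ _)) as T1.
pose proof (tgrad_mer f2 smooth2 s _ _ R2 (Dh _ _ _)) as T2.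
pose proof (tgrad_mer f3 smooth3 s _ _ R3 (Dh _ _ _)) as T3.
pose proof (tgrad_mer f4 smooth4 s _ _ R4 (Dh _ _ _)) as T4.
unfold h' in T0, T1, T2, T3, T4.
rewrite !Rmult_0_r, sin_0, cos_0 in T0, T1, T2, T3, T4.
assert (EE : energyT omega (mer s) =
  Rsum (map (fun e => tgrad e f0 (mer s) ^ 2) basis3)
  + (Rsum (map (fun e => tgrad e f1 (mer s) ^ 2) basis3)
  + (Rsum (map (fun e => tgrad e f2 (mer s) ^ 2) basis3)
  + (Rsum (map (fun e => tgrad e f3 (mer s) ^ 2) basis3)
  + (Rsum (map (fun e => tgrad e f4 (mer s) ^ 2) basis3) + 0))))) by reflexivity.
rewrite EE, !Rmult_plus_distr_l, T0, T1, T2, T3, T4. unfold e. ring.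
Qed.

(** The second derivative along the parallel is [- k^2] times the coordinate; moved to the other
    side, it leaves an ordinary differential equation along the meridian. *)
Let harmonic_ode (c : E5 -> R) (k a b s : R) : In c coords ->
  (forall th, c (omega (rotS2 th (mer s))) = h k a b th) ->
  is_derive (dmer (fun x => c (omega x))) s ((k ^ 2 - e s) * c (omega (mer s))).
Proof.
intros Hc Hr.
eapply is_derive_value.
- apply (dmer_derive_laplace (fun x => c (omega x)) (proj1 (proj2 Hharm) c Hc) s
    (h k a b) (h' k a b) (- k ^ 2 * a)); trivial.
- pose proof (proj2 (proj2 Hharm) c (mer s) Hc (mer_S2 s)) as HL.
  pose proof (Hr 0) as H0. unfold h in H0. rewrite !Rmult_0_r, sin_0, cos_0 in H0.
  replace (rotS2 0 (mer s)) with (mer s) in H0.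
  2: { unfold rotS2, mer. rewrite sin_0, cos_0. apply R3_ext; ring. }
  rewrite H0 in *. rewrite <- energy.
  replace (laplaceT _ _) with (- (energyT omega (mer s) * (1 * a - 0 * b))) by lra. ring.
Qed.

(** The poles are fixed, while the rotation by [PI] acts as -1 on the plane of weight 1 and the
    rotation by [PI / 2] acts as -1 on the plane of weight 2. *)
Let pole_fixed (t : R) : t = 1 \/ t = -1 ->
  f1 (0, 0, t) = 0 /\ f2 (0, 0, t) = 0 /\ f3 (0, 0, t) = 0 /\ f4 (0, 0, t) = 0.
Proof.
intros Ht.
assert (N : S2 (0, 0, t)) by (unfold S2; destruct Ht; subst; ring).
assert (F : forall th, rotS2 th (0, 0, t) = (0, 0, t)).
{ intros th. unfold rotS2. apply R3_ext; ring. }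
destruct (rot PI _ N) as [_ [E1 [E2 _]]].
destruct (rot (PI / 2) _ N) as [_ [_ [_ [E3 E4]]]].
rewrite F in *. replace (2 * (PI / 2)) with PI in * by field.
rewrite cos_PI, sin_PI in *. lra.
Qed.

(** Fullness in dual form: a linear [c] that vanishes on the image vanishes on its span, which
    contains [v]. *)
Let full_component (c : E5 -> R) (v : E5) :
  (forall k y z, c (plus (scal k y) z) = k * c y + c z) -> c v <> 0 -> c zero = 0 ->
  exists x, S2 x /\ c (omega x) <> 0.
Proof.
intros Hc Hv H0. apply NNPP. intros N.
assert (Z : forall x, S2 x -> c (omega x) = 0).
{ intros x Hx. apply NNPP. intros Q. apply N. now exists x. }
destruct (Hfull v) as [l [Hl ->]]. apply Hv. clear Hv.
induction Hl as [|p l Hp Hl IH]. exact H0.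
etransitivity. apply (Hc (fst p) (omega (snd p))).
rewrite (Z _ Hp), Rmult_0_r, Rplus_0_l. exact IH.
Qed.

Let nonzero_on_meridian (g1 g2 : R3 -> R) (k : R) (x : R3) :
  (forall th x, S2 x -> g1 (rotS2 th x) = cos (k * th) * g1 x - sin (k * th) * g2 x) ->
  g1 (0, 0, 1) = 0 -> g1 (0, 0, -1) = 0 -> S2 x -> g1 x <> 0 ->
  exists s, g1 (mer s) <> 0 \/ g2 (mer s) <> 0.
Proof.
intros Hr HN HS Hx Hn.
destruct (S2_polar x Hx) as [-> | [-> | [s [th ->]]]]; [easy|easy|].
exists s. apply NNPP. intros Q. apply Hn. rewrite Hr by apply mer_S2.
assert (g1 (mer s) = 0) as -> by (apply NNPP; tauto).
assert (g2 (mer s) = 0) as -> by (apply NNPP; tauto). ring.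
Qed.

Lemma meridian_profile : exists eps m1 m2 p1 r1 p2 r2,
  (eps = 1 \/ eps = -1) /\ m1 <> 0 /\ m2 <> 0 /\
  p1 ^ 2 + r1 ^ 2 = 1 /\ p2 ^ 2 + r2 ^ 2 = 1 /\
  (forall t, t = 1 \/ t = -1 -> scal eps (omega (0, 0, t)) = (1, (0, 0), (0, 0))) /\
  forall s, let X := lift_state (m1 * exp s) (m2 * exp s ^ 2) in
    scal eps (omega (mer s)) = (q0 X, (p1 * q1 X, r1 * q1 X), (p2 * q2 X, r2 * q2 X)).
Proof.
destruct (pole_fixed 1 (or_introl eq_refl)) as [N1 [N2 [N3 N4]]].
destruct (pole_fixed (-1) (or_intror eq_refl)) as [P1 [P2 [P3 P4]]].
destruct (full_component (fun y => Re (snd (fst y))) (0, (1, 0), (0, 0))) as [x1 [X1 Y1]].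
{ reflexivity. } { simpl. lra. } { reflexivity. }
destruct (full_component (fun y => Re (snd y)) (0, (0, 0), (1, 0))) as [x2 [X2 Y2]].
{ reflexivity. } { simpl. lra. } { reflexivity. }
destruct (cylinder_system_solution (fun s => f0 (mer s)) (fun s => f1 (mer s))
  (fun s => f2 (mer s)) (fun s => f3 (mer s)) (fun s => f4 (mer s))
  (dmer f0) (dmer f1) (dmer f2) (dmer f3) (dmer f4) (f0 (0, 0, 1)))
  as [eps [m1 [m2 [p1 [r1 [p2 [r2 [Heps [M1 [M2 [U1 [U2 K]]]]]]]]]]]].
1-5: intros s; now apply mer_derive.
1-5: intros s; destruct (rotation s) as [R0 [R1 [R2 [R3 R4]]]].
- eapply is_derive_value.
  apply (harmonic_ode (fun y => fst (fst y)) _ _ _ s ltac:(simpl; auto) R0).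
  fold (f0 (mer s)). fold (e s). ring.
- eapply is_derive_value.
  apply (harmonic_ode (fun y => Re (snd (fst y))) _ _ _ s ltac:(simpl; auto) R1).
  fold (f1 (mer s)). fold (e s). ring.
- eapply is_derive_value.
  apply (harmonic_ode (fun y => Im (snd (fst y))) _ _ _ s ltac:(simpl; auto) R2).
  fold (f2 (mer s)). fold (e s). ring.
- eapply is_derive_value.
  apply (harmonic_ode (fun y => Re (snd y)) _ _ _ s ltac:(simpl; auto) R3).
  fold (f3 (mer s)). fold (e s). ring.
- eapply is_derive_value.
  apply (harmonic_ode (fun y => Im (snd y)) _ _ _ s ltac:(simpl; auto 6) R4).
  fold (f4 (mer s)). fold (e s). ring.
- intros s. apply sphere, mer_S2.
- now apply f_mer_lim_m.
- rewrite <- N1. now apply f_mer_lim_m.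
- rewrite <- N2. now apply f_mer_lim_m.
- rewrite <- N3. now apply f_mer_lim_m.
- rewrite <- N4. now apply f_mer_lim_m.
- now apply dmer_lim_m.
- now apply dmer_lim_m.
- now apply dmer_lim_m.
- now apply dmer_lim_m.
- now apply dmer_lim_m.
- apply (nonzero_on_meridian f1 f2 1 x1); trivial.
  intros th x Hx. rewrite !Rmult_1_l. now apply rot.
- apply (nonzero_on_meridian f3 f4 2 x2); trivial.
  intros th x Hx. now apply rot.
- exists eps, m1, m2, p1, r1, p2, r2. repeat (split; [assumption|]). split.
  (* The sign found along the meridian is also the sign at the poles, because the explicit solution
     tends to 1 at both ends. *)
  + assert (LN : eps * f0 (0, 0, 1) = 1).
    { assert (L : is_lim (fun s => eps * f0 (mer s)) m_infty (eps * f0 (0, 0, 1))).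
      { apply is_lim_mult_finite. apply is_lim_const. now apply f_mer_lim_m. }
      assert (L' : is_lim (fun s => eps * f0 (mer s)) m_infty 1).
      { apply (is_lim_ext (fun s => q0 (lift_state (m1 * exp s) (m2 * exp s ^ 2)))).
        intros s. symmetry. apply K. apply lift_state_lim_m. }
      apply is_lim_unique in L. apply is_lim_unique in L'. rewrite L in L'.
      now injection L'. }
    assert (LS : eps * f0 (0, 0, -1) = 1).
    { assert (L : is_lim (fun s => eps * f0 (mer s)) p_infty (eps * f0 (0, 0, -1))).
      { apply is_lim_mult_finite. apply is_lim_const. now apply f_mer_lim_p. }
      assert (L' : is_lim (fun s => eps * f0 (mer s)) p_infty 1).
      { apply (is_lim_ext (fun s => q0 (lift_state (m1 * exp s) (m2 * exp s ^ 2)))).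
        intros s. symmetry. apply K. now apply lift_state_lim_p. }
      apply is_lim_unique in L. apply is_lim_unique in L'. rewrite L in L'.
      now injection L'. }
    intros t Ht. destruct (pole_fixed t Ht) as [Q1 [Q2 [Q3 Q4]]].
    rewrite omega_coords, Q1, Q2, Q3, Q4.
    assert (E : eps * f0 (0, 0, t) = 1) by (destruct Ht; subst; assumption).
    change (scal eps ((f0 (0, 0, t), (0, 0), (0, 0)) : E5))
      with ((eps * f0 (0, 0, t), (eps * 0, eps * 0), (eps * 0, eps * 0)) : E5).
    now rewrite E, Rmult_0_r.
  + intros s X. destruct (K s) as [K0 [K1 [K2 [K3 K4]]]]. fold X in K0, K1, K2, K3, K4.
    rewrite <- K0, <- K1, <- K2, <- K3, <- K4. rewrite omega_coords. reflexivity.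
Qed.

End Profile.

(** * The twistor lift *)

(** The last coefficient is forced by the contact form, which on the curve
    [(1, mu1 z, mu2 z^2, c z^3)] is [(3 c + mu1 mu2) z^2]. *)
Definition twistor_lift (mu1 mu2 : C) (z : C2) : C4 :=
  let '(z0, z1) := z in
  (z0 ^ 3, mu1 * z0 ^ 2 * z1, mu2 * z0 * z1 ^ 2, - (mu1 * mu2 / 3) * z1 ^ 3)%C.

Lemma triple_eq {X Y Z : Type} (x x' : X) (y y' : Y) (z z' : Z) :
  x = x' -> y = y' -> z = z' -> (x, y, z) = (x', y', z').
Proof. now intros -> -> ->. Qed.

Lemma C4_eq (a b c d a' b' c' d' : C) :
  a = a' -> b = b' -> c = c' -> d = d' -> (a, b, c, d) = (a', b', c', d') :> C4.
Proof. now intros -> -> -> ->. Qed.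

Lemma C2_nonzero (z0 z1 : C) : ((z0, z1) : C2) <> zero -> z0 <> RtoC 0 \/ z1 <> RtoC 0.
Proof.
intros H. apply NNPP. intros N. apply H.
assert (z0 = RtoC 0) as -> by (apply NNPP; tauto).
assert (z1 = RtoC 0) as -> by (apply NNPP; tauto). reflexivity.
Qed.

Lemma C2_nonzero_l (z0 z1 : C) : z0 <> RtoC 0 -> ((z0, z1) : C2) <> zero.
Proof. intros H E. apply H. exact (f_equal fst E). Qed.

Lemma C2_nonzero_r (z0 z1 : C) : z1 <> RtoC 0 -> ((z0, z1) : C2) <> zero.
Proof. intros H E. apply H. exact (f_equal snd E). Qed.

Lemma C3_nz : RtoC 3 <> RtoC 0.
Proof. intros E. apply RtoC_inj in E. lra. Qed.

Lemma RtoC_nz (x : R) : x <> 0 -> RtoC x <> RtoC 0.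
Proof. intros H E. apply RtoC_inj in E. lra. Qed.

Lemma proj_eq_intro (w w' : C4) (c : C) : c <> RtoC 0 ->
  (let '(w0, w1, w2, w3) := w in let '(w0', w1', w2', w3') := w' in
   w0 = (c * w0')%C /\ w1 = (c * w1')%C /\ w2 = (c * w2')%C /\ w3 = (c * w3')%C) ->
  proj_eq w w'.
Proof.
destruct w as [[[w0 w1] w2] w3], w' as [[[w0' w1'] w2'] w3'].
intros Hc [-> [-> [-> ->]]]. now exists c.
Qed.

Lemma proj_eq_refl {V : ModuleSpace C_Ring} (v : V) : proj_eq v v.
Proof. exists (RtoC 1). split. apply C1_nz. symmetry. exact (scal_one v). Qed.

Lemma proj_eq_sym {V : ModuleSpace C_Ring} (u v : V) : proj_eq u v -> proj_eq v u.
Proof.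
intros [a [Ha ->]]. exists (/ a)%C. split.
- intros E. apply C1_nz. rewrite <- (Cinv_r a Ha), E. ring.
- rewrite scal_assoc. change (mult (/ a)%C a) with (/ a * a)%C.
  rewrite Cinv_l by exact Ha. symmetry. exact (scal_one v).
Qed.

Lemma proj_eq_trans {V : ModuleSpace C_Ring} (u v w : V) :
  proj_eq u v -> proj_eq v w -> proj_eq u w.
Proof.
intros [a [Ha ->]] [b [Hb ->]]. exists (a * b)%C. split.
- now apply Cmult_neq_0.
- rewrite scal_assoc. reflexivity.
Qed.

Lemma Cmod_div3 (x : C) : Cmod (x / 3) = Cmod x / 3.
Proof.
rewrite Cmod_div by apply C3_nz. rewrite Cmod_R, Rabs_pos_eq by lra. reflexivity.
Qed.

Lemma Cmod_pow4 (x : C) : RtoC (Cmod x ^ 4) = ((x * Cconj x) ^ 2)%C.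
Proof. rewrite <- Cmod2_conj, <- RtoC_pow. f_equal. ring. Qed.

Lemma RtoC_3 (x : R) : RtoC (x / 3) = (RtoC x / 3)%C.
Proof. apply RtoC_div. lra. Qed.

Lemma Cconj_RtoC (x : R) : Cconj (RtoC x) = RtoC x.
Proof. unfold Cconj, RtoC. simpl. now rewrite Ropp_0. Qed.

Lemma Cconj_div3 (x : C) : Cconj (x / 3) = (Cconj x / 3)%C.
Proof. rewrite Cdiv_conj by apply C3_nz. now rewrite Cconj_RtoC. Qed.

Definition lift_norm_sq (mu1 mu2 z0 z1 : C) : R :=
  Cmod z0 ^ 6 + Cmod mu1 ^ 2 * Cmod z0 ^ 4 * Cmod z1 ^ 2
  + Cmod mu2 ^ 2 * Cmod z0 ^ 2 * Cmod z1 ^ 4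
  + Cmod mu1 ^ 2 * Cmod mu2 ^ 2 / 9 * Cmod z1 ^ 6.

Lemma tau_twistor_lift (mu1 mu2 z0 z1 : C) :
  tau (twistor_lift mu1 mu2 (z0, z1)) =
    let a0 := Cmod z0 in let a1 := Cmod z1 in
    let m1 := Cmod mu1 in let m2 := Cmod mu2 in
    let D := lift_norm_sq mu1 mu2 z0 z1 in
    ((a0 ^ 6 - m1 ^ 2 * a0 ^ 4 * a1 ^ 2 - m2 ^ 2 * a0 ^ 2 * a1 ^ 4
        + m1 ^ 2 * m2 ^ 2 / 9 * a1 ^ 6) / D,
     (2 * mu1 * Cconj z0 * z1 * RtoC (a0 ^ 4 - m2 ^ 2 / 3 * a1 ^ 4) / RtoC D)%C,
     (2 * mu2 * Cconj z0 ^ 2 * z1 ^ 2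
        * RtoC (a0 ^ 2 + m1 ^ 2 / 3 * a1 ^ 2) / RtoC D)%C).
Proof.
cbv zeta. unfold twistor_lift, tau.
assert (EN : Cmod (z0 ^ 3) ^ 2 + Cmod (mu1 * z0 ^ 2 * z1) ^ 2 + Cmod (mu2 * z0 * z1 ^ 2) ^ 2
  + Cmod (- (mu1 * mu2 / 3) * z1 ^ 3) ^ 2 = lift_norm_sq mu1 mu2 z0 z1).
{ unfold lift_norm_sq. rewrite !Cmod_mult, !Cmod_opp, !Cmod_div3, !Cmod_mult, !Cmod_pow. field. }
rewrite EN.
apply triple_eq.
- f_equal. rewrite !Cmod_mult, !Cmod_opp, !Cmod_div3, !Cmod_mult, !Cmod_pow. field.
- f_equal.
  rewrite RtoC_minus, RtoC_mult, RtoC_3, !Cmod_pow4, Cmod2_conj.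
  rewrite !Cmult_conj, !Cpow_conj. field; apply C3_nz.
- f_equal.
  rewrite RtoC_plus, RtoC_mult, RtoC_3, !Cmod2_conj.
  rewrite !Cmult_conj, !Cpow_conj. field; apply C3_nz.
Qed.

Lemma twistor_lift_scal (mu1 mu2 c z0 z1 : C) :
  twistor_lift mu1 mu2 (c * z0, c * z1)%C =
  (let '(w0, w1, w2, w3) := twistor_lift mu1 mu2 (z0, z1) in
   (c ^ 3 * w0, c ^ 3 * w1, c ^ 3 * w2, c ^ 3 * w3)%C).
Proof. unfold twistor_lift. apply C4_eq; ring. Qed.

Lemma twistor_lift_nonzero (mu1 mu2 : C) (z : C2) : mu1 <> RtoC 0 -> mu2 <> RtoC 0 ->
  z <> zero -> twistor_lift mu1 mu2 z <> zero.
Proof.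
destruct z as [z0 z1]. intros H1 H2 Hz E. unfold twistor_lift in E.
destruct (C2_nonzero _ _ Hz) as [H|H].
- apply (Cpow_nz z0 3 H). exact (f_equal (fun w : C4 => fst (fst (fst w))) E).
- apply (f_equal (fun w : C4 => snd w)) in E. simpl snd in E. revert E.
  apply Cmult_neq_0; [|exact (Cpow_nz z1 3 H)].
  intros Q. apply (Cmult_neq_0 mu1 mu2 H1 H2).
  replace (mu1 * mu2)%C with (- (3 * (- (mu1 * mu2 / 3))))%C by (field; apply C3_nz).
  rewrite Q. ring.
Qed.

Lemma C4_norm_pos (w0 w1 w2 w3 : C) : ((w0, w1, w2, w3) : C4) <> zero ->
  0 < Cmod w0 ^ 2 + Cmod w1 ^ 2 + Cmod w2 ^ 2 + Cmod w3 ^ 2.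
Proof.
intros H.
assert (P : forall w : C, w = RtoC 0 \/ 0 < Cmod w ^ 2).
{ intros w. destruct (classic (w = RtoC 0)) as [E|E]. now left.
  right. apply pow_lt. now apply Cmod_gt_0. }
pose proof (pow2_ge_0 (Cmod w0)). pose proof (pow2_ge_0 (Cmod w1)).
pose proof (pow2_ge_0 (Cmod w2)). pose proof (pow2_ge_0 (Cmod w3)).
destruct (P w0) as [->|]; [|lra]. destruct (P w1) as [->|]; [|lra].
destruct (P w2) as [->|]; [|lra]. destruct (P w3) as [->|]; [|lra].
now contradiction H.
Qed.

Lemma tau_proj_eq (w w' : C4) : w' <> zero -> proj_eq w w' -> tau w = tau w'.
Proof.
destruct w' as [[[w0 w1] w2] w3]. intros Hw [c [Hc ->]].
change (tau (c * w0, c * w1, c * w2, c * w3)%C = tau (w0, w1, w2, w3)).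
apply C4_norm_pos in Hw.
unfold tau. rewrite !Cmod_mult, !Rpow_mult_distr, <- !Rmult_plus_distr_l, <- !Rmult_minus_distr_l.
set (N := _ + Cmod w3 ^ 2) in *.
assert (Pc : Cmod c ^ 2 <> 0).
{ apply pow_nonzero. apply Cmod_gt_0 in Hc. lra. }
assert (RtoC (Cmod c ^ 2) <> RtoC 0) as Pc' by now apply RtoC_nz.
assert (HN : N <> 0) by lra.
rewrite !Cmult_conj, RtoC_mult.
apply RtoC_nz in HN as HN'. apply triple_eq.
- field. split; [exact HN|]. apply Cmod_gt_0 in Hc. lra.
- revert Pc'. rewrite Cmod2_conj. intros Pc'. field. split; [exact HN'|].
  split; intros Q; apply Pc'; rewrite Q; ring.
- revert Pc'. rewrite Cmod2_conj. intros Pc'. field. split; [exact HN'|].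
  split; intros Q; apply Pc'; rewrite Q; ring.
Qed.

Lemma C2_norm_pos (z0 z1 : C) : ((z0, z1) : C2) <> zero -> 0 < Cmod z0 ^ 2 + Cmod z1 ^ 2.
Proof.
intros H. pose proof (pow2_ge_0 (Cmod z0)). pose proof (pow2_ge_0 (Cmod z1)).
destruct (C2_nonzero _ _ H) as [Hz|Hz]; apply Cmod_gt_0 in Hz;
  apply (pow_lt _ 2) in Hz; lra.
Qed.

Lemma sigma2_inv_scal (c z0 z1 : C) : c <> RtoC 0 -> ((z0, z1) : C2) <> zero ->
  sigma2_inv (c * z0, c * z1)%C = sigma2_inv (z0, z1).
Proof.
intros Hc Hz. apply C2_norm_pos in Hz.
apply Cmod_gt_0, (pow_lt _ 2) in Hc.
unfold sigma2_inv. rewrite !Cmod_mult, !Rpow_mult_distr.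
replace (Cconj (c * z0) * (c * z1))%C with (RtoC (Cmod c ^ 2) * (Cconj z0 * z1))%C
  by (rewrite Cmod2_conj, Cmult_conj; ring).
rewrite re_scal_l, im_scal_l, <- Rmult_plus_distr_l, <- Rmult_minus_distr_l.
set (k := Cmod c ^ 2) in *. set (N := _ + _ ^ 2) in *.
apply R3_ext; field; lra.
Qed.

Lemma Cmod_cis (al : R) : Cmod (cis al) = 1.
Proof.
unfold cis, Cmod. simpl fst. simpl snd. rewrite <- sqrt_1. f_equal.
pose proof (sin2_cos2 al) as E. unfold Rsqr in E. lra.
Qed.

Lemma cis_conj (al : R) : (cis al * Cconj (cis al))%C = RtoC 1.
Proof. rewrite <- Cmod2_conj, Cmod_cis. f_equal. ring. Qed.

Lemma cis_2 (al : R) : cis (2 * al) = (cis al ^ 2)%C.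
Proof.
replace (2 * al) with (al + al) by ring. unfold cis. rewrite cos_plus, sin_plus.
simpl. unfold Cmult; simpl. apply f_equal2; ring.
Qed.

Lemma cis_3 (al : R) : cis (3 * al) = (cis al ^ 3)%C.
Proof.
transitivity (cis al * cis (2 * al))%C.
- replace (3 * al) with (al + 2 * al) by ring. unfold cis. rewrite cos_plus, sin_plus.
  unfold Cmult; simpl. apply f_equal2; ring.
- rewrite cis_2. ring.
Qed.

Lemma polar_form (z : C) : z <> RtoC 0 -> exists s al, z = (cis al * RtoC (exp s))%C.
Proof.
intros Hz. apply Cmod_gt_0 in Hz.
destruct (unit_circle (fst z / Cmod z) (snd z / Cmod z)) as [al [Hc Hs]].
{ transitivity (Cmod z ^ 2 / Cmod z ^ 2); [|field; lra].
  rewrite Cmod2_alt at 1. unfold Re, Im. field. lra. }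
exists (ln (Cmod z)), al. rewrite exp_ln by exact Hz. unfold cis. rewrite <- Hc, <- Hs.
destruct z as [x y]. unfold Cmult, RtoC. simpl fst. simpl snd. apply f_equal2; field; lra.
Qed.

Lemma sigma2_inv_cis (al s : R) :
  sigma2_inv (RtoC 1, cis al * RtoC (exp s))%C = rotS2 al (mer s).
Proof.
unfold sigma2_inv. rewrite Cmod_mult, Cmod_cis, !Cmod_R, Cconj_RtoC.
pose proof (exp_pos s). rewrite (Rabs_pos_eq (exp s)), Rabs_R1 by lra.
rewrite Cmult_1_l, re_scal_r, im_scal_r. unfold cis, Re, Im. simpl fst. simpl snd.
unfold rotS2, mer, mS, mT. apply R3_ext; field; nra.
Qed.

Lemma twistor_lift_rot (mu1 mu2 : C) (al : R) (z : C2) :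
  twistor_lift mu1 mu2 (rotCP1 al z) = rotCP3 al (twistor_lift mu1 mu2 z).
Proof.
destruct z as [z0 z1]. unfold twistor_lift, rotCP1, rotCP3. rewrite cis_2, cis_3.
apply C4_eq; ring.
Qed.

(** The coordinates have weights 0, 1, 2, 3, so [Cconj w0 * w1] and [Cconj w2 * w3] both have weight
    1, while [Cconj w0 * w2] and [Cconj w1 * w3] both have weight 2. *)
Lemma tau_rot (al : R) (w : C4) : tau (rotCP3 al w) = rotS4 al (tau w).
Proof.
destruct w as [[[w0 w1] w2] w3]. unfold tau, rotCP3, rotS4.
rewrite !Cmod_mult, !Cmod_cis, !Rmult_1_l, !Cmult_conj.
rewrite cis_2, cis_3, !Cpow_conj.
pose proof (cis_conj al) as E. set (c := cis al) in *. set (c' := Cconj c) in *.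
apply triple_eq; [reflexivity| |]; unfold Cdiv; rewrite !Cmult_assoc; f_equal.
- transitivity (2 * (Cconj w0 * w1 * c + Cconj w2 * w3 * c * (c * c') ^ 2))%C; [ring|].
  rewrite E. ring.
- transitivity (2 * (Cconj w0 * w2 * c ^ 2 - Cconj w1 * w3 * c ^ 2 * (c * c')))%C; [ring|].
  rewrite E. ring.
Qed.

(** * From the meridian to the whole sphere *)

Section Recovery.

Variables (psi : R3 -> E5) (m1 m2 p1 r1 p2 r2 : R).
Hypothesis Hequi : equivariant psi.
Hypothesis M1 : m1 <> 0.
Hypothesis M2 : m2 <> 0.
Hypothesis U1 : p1 ^ 2 + r1 ^ 2 = 1.
Hypothesis U2 : p2 ^ 2 + r2 ^ 2 = 1.
Hypothesis Hpole : forall t, t = 1 \/ t = -1 -> psi (0, 0, t) = (1, (0, 0), (0, 0)).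
Hypothesis Hmer : forall s, let X := lift_state (m1 * exp s) (m2 * exp s ^ 2) in
  psi (mer s) = (q0 X, (p1 * q1 X, r1 * q1 X), (p2 * q2 X, r2 * q2 X)).

Let mu1 : C := (m1 * p1, m1 * r1).
Let mu2 : C := (m2 * p2, m2 * r2).

Let Cmod_mu1 : Cmod mu1 ^ 2 = m1 ^ 2.
Proof.
rewrite Cmod2_alt. unfold mu1, Re, Im. simpl fst. simpl snd.
transitivity (m1 ^ 2 * (p1 ^ 2 + r1 ^ 2)); [|rewrite U1]; ring.
Qed.

Let Cmod_mu2 : Cmod mu2 ^ 2 = m2 ^ 2.
Proof.
rewrite Cmod2_alt. unfold mu2, Re, Im. simpl fst. simpl snd.
transitivity (m2 ^ 2 * (p2 ^ 2 + r2 ^ 2)); [|rewrite U2]; ring.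
Qed.

Let mu1_nz : mu1 <> RtoC 0.
Proof.
intros E. assert (Q : m1 ^ 2 = 0) by (rewrite <- Cmod_mu1, E, Cmod_0; ring).
apply M1. now apply Rsqr_0_uniq; rewrite Rsqr_pow2.
Qed.

Let mu2_nz : mu2 <> RtoC 0.
Proof.
intros E. assert (Q : m2 ^ 2 = 0) by (rewrite <- Cmod_mu2, E, Cmod_0; ring).
apply M2. now apply Rsqr_0_uniq; rewrite Rsqr_pow2.
Qed.

Let psi_mer (s : R) : psi (mer s) = tau (twistor_lift mu1 mu2 (RtoC 1, RtoC (exp s))).
Proof.
rewrite tau_twistor_lift. cbv zeta. unfold lift_norm_sq.
rewrite Cmod_mu1, Cmod_mu2, !Cmod_R, Rabs_R1, Cconj_RtoC.
pose proof (exp_pos s). rewrite (Rabs_pos_eq (exp s)) by lra.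
set (D := _ + _ + _ + _).
assert (ED : D = lift_norm (m1 * exp s) (m2 * exp s ^ 2)).
{ unfold D, lift_norm. field. }
assert (PD : 0 < D) by (rewrite ED; apply lift_norm_pos).
rewrite Hmer. unfold lift_state. cbn [q0 q1 q2]. rewrite <- ED.
rewrite <- !RtoC_pow. unfold Cdiv. rewrite <- !RtoC_inv by lra.
unfold mu1, mu2.
apply triple_eq.
- field. lra.
- unfold Cmult, RtoC; simpl fst; simpl snd. apply f_equal2; field; lra.
- unfold Cmult, RtoC; simpl fst; simpl snd. apply f_equal2; field; lra.
Qed.

Let tau_pole (z0 z1 : C) : ((z0, z1) : C2) <> zero -> z0 = RtoC 0 \/ z1 = RtoC 0 ->
  tau (twistor_lift mu1 mu2 (z0, z1)) = (1, (0, 0), (0, 0)).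
Proof.
intros Hz H0. destruct (C2_nonzero _ _ Hz) as [H|H].
- destruct H0 as [H0 | ->]; [contradiction|]. rewrite tau_twistor_lift. cbv zeta.
  unfold lift_norm_sq. rewrite !Cmod_0. apply Cmod_gt_0, (pow_lt _ 6) in H.
  apply triple_eq.
  + transitivity (Cmod z0 ^ 6 / Cmod z0 ^ 6). f_equal; ring. apply Rdiv_diag. lra.
  + unfold Cdiv; simpl; ring_simplify; reflexivity.
  + unfold Cdiv; simpl; ring_simplify; reflexivity.
- destruct H0 as [-> | H0]; [|contradiction]. rewrite tau_twistor_lift. cbv zeta.
  unfold lift_norm_sq. rewrite !Cmod_0, Cconj_RtoC. apply Cmod_gt_0, Rgt_not_eq in H.
  rewrite Cmod_mu1, Cmod_mu2.
  apply triple_eq.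
  + transitivity (m1 ^ 2 * m2 ^ 2 / 9 * Cmod z1 ^ 6 / (m1 ^ 2 * m2 ^ 2 / 9 * Cmod z1 ^ 6)).
    f_equal; ring. apply Rdiv_diag. unfold Rdiv.
    repeat apply Rmult_integral_contrapositive_currified; first [assumption | lra].
  + unfold Cdiv; simpl; ring_simplify; reflexivity.
  + unfold Cdiv; simpl; ring_simplify; reflexivity.
Qed.

(** Off the poles [z1 / z0] is [exp (s + i al)] and both sides are equivariant, which reduces the
    claim to [psi_mer]. The poles lie on no rotated meridian and are compared directly. *)
Lemma psi_sigma2_inv (z0 z1 : C) : ((z0, z1) : C2) <> zero ->
  psi (sigma2_inv (z0, z1)) = tau (twistor_lift mu1 mu2 (z0, z1)).
Proof.
intros Hz.
destruct (classic (z0 = RtoC 0)) as [E0|E0].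
- rewrite tau_pole by auto. rewrite <- (Hpole (-1)) by auto. f_equal.
  subst. destruct (C2_nonzero _ _ Hz) as [H|H]; [easy|].
  unfold sigma2_inv. rewrite Cmod_0, Cconj_RtoC, Cmult_0_l.
  apply Cmod_gt_0 in H. unfold Re, Im; simpl fst; simpl snd.
  apply R3_ext; field; lra.
- destruct (classic (z1 = RtoC 0)) as [E1|E1].
  + rewrite tau_pole by auto. rewrite <- (Hpole 1) by auto. f_equal.
    subst. unfold sigma2_inv. rewrite Cmod_0, Cmult_0_r.
    apply Cmod_gt_0 in E0. unfold Re, Im; simpl fst; simpl snd.
    apply R3_ext; field; lra.
  + destruct (polar_form (z1 / z0)%C) as [s [al E]].
    { apply Cmult_neq_0; [easy|]. intros Q. apply C1_nz.
      rewrite <- (Cinv_r z0 E0), Q. ring. }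
    assert (F : (z0, z1) = (z0 * RtoC 1, z0 * (cis al * RtoC (exp s)))%C).
    { rewrite <- E. apply f_equal2; field; trivial. }
    assert (N1 : ((RtoC 1, cis al * RtoC (exp s))%C : C2) <> zero).
    { apply C2_nonzero_l, C1_nz. }
    rewrite F, sigma2_inv_scal, sigma2_inv_cis, Hequi by (trivial; apply mer_S2).
    rewrite psi_mer, <- tau_rot, <- twistor_lift_rot.
    symmetry. apply tau_proj_eq.
    * now apply twistor_lift_nonzero.
    * rewrite twistor_lift_scal. exists (z0 ^ 3)%C. split; [now apply Cpow_nz|]. reflexivity.
Qed.

End Recovery.

(** * Wirtinger calculus and the positive lift *)

(** [a] and [b] are the derivatives with respect to [z] and its conjugate. Derivatives are taken
    along real lines, as in [dzbar]; asking for a real-linear differential in all directions makes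
    the notion stable under the rules below. *)
Definition wirtinger (f : C -> C) (z a b : C) : Prop :=
  forall h : C,
    is_derive (fun t : R => Re (f (z + RtoC t * h)%C)) 0 (Re (a * h + b * Cconj h)%C) /\
    is_derive (fun t : R => Im (f (z + RtoC t * h)%C)) 0 (Im (a * h + b * Cconj h)%C).

Lemma wirtinger_dzbar (f : C -> C) (z a b : C) : wirtinger f z a b -> dzbar f z = b.
Proof.
intros H. unfold dzbar, dirC.
destruct (H (RtoC 1)) as [R1 I1]. destruct (H Ci) as [R2 I2].
rewrite (is_derive_unique _ _ _ R1), (is_derive_unique _ _ _ I1),
  (is_derive_unique _ _ _ R2), (is_derive_unique _ _ _ I2).
destruct a as [a1 a2], b as [b1 b2].
unfold Cdiv, Cinv, Cmult, Cplus, Cconj, Ci, RtoC, Re, Im; simpl fst; simpl snd.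
apply f_equal2; field.
Qed.

Lemma wirtinger_ext (f g : C -> C) (z a b : C) :
  (forall u, f u = g u) -> wirtinger f z a b -> wirtinger g z a b.
Proof.
intros E H h. destruct (H h) as [H1 H2]. split.
- apply (is_derive_ext (fun t : R => Re (f (z + RtoC t * h)%C))); [|exact H1].
  intros t. now rewrite E.
- apply (is_derive_ext (fun t : R => Im (f (z + RtoC t * h)%C))); [|exact H2].
  intros t. now rewrite E.
Qed.

Lemma wirtinger_value (f : C -> C) (z a b a' b' : C) :
  wirtinger f z a b -> a = a' -> b = b' -> wirtinger f z a' b'.
Proof. now intros H <- <-. Qed.

Lemma wirtinger_const (c z : C) : wirtinger (fun _ => c) z 0 0.
Proof.
intros h. split; (eapply is_derive_value; [apply @is_derive_const|]);
  unfold zero, Re, Im; simpl; ring.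
Qed.

Lemma wirtinger_id (z : C) : wirtinger (fun u => u) z 1 0.
Proof.
intros [h1 h2]. destruct z as [x y].
unfold Cmult, Cplus, Cconj, RtoC, Re, Im; simpl fst; simpl snd.
split; (auto_derive; [easy|ring]).
Qed.

Lemma wirtinger_conj (f : C -> C) (z a b : C) :
  wirtinger f z a b -> wirtinger (fun u => Cconj (f u)) z (Cconj b) (Cconj a).
Proof.
intros H h. destruct (H h) as [H1 H2]. split.
- apply (is_derive_ext (fun t : R => Re (f (z + RtoC t * h)%C))).
  { intros t. now rewrite re_conj. }
  eapply is_derive_value. exact H1.
  rewrite <- re_conj, Cplus_conj, !Cmult_conj, Cconj_conj. f_equal. ring.
- apply (is_derive_ext (fun t : R => - Im (f (z + RtoC t * h)%C))).
  { intros t. now rewrite im_conj. }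
  eapply is_derive_value. apply (is_derive_opp (K := R_AbsRing) (V := R_NormedModule)). exact H2.
  change (- Im (a * h + b * Cconj h)%C = Im (Cconj b * h + Cconj a * Cconj h)%C).
  rewrite <- im_conj, Cplus_conj, !Cmult_conj, Cconj_conj. f_equal. ring.
Qed.

Lemma wirtinger_plus (f g : C -> C) (z a b c d : C) :
  wirtinger f z a b -> wirtinger g z c d ->
  wirtinger (fun u => f u + g u)%C z (a + c) (b + d).
Proof.
intros Hf Hg h. destruct (Hf h) as [F1 F2]. destruct (Hg h) as [G1 G2]. split.
- eapply is_derive_value.
  apply (is_derive_plus (K := R_AbsRing) (V := R_NormedModule) _ _ _ _ _ F1 G1).
  unfold plus, Re; simpl. ring.
- eapply is_derive_value.
  apply (is_derive_plus (K := R_AbsRing) (V := R_NormedModule) _ _ _ _ _ F2 G2).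
  unfold plus, Im; simpl. ring.
Qed.

Lemma Cplus_0_scal (z h : C) : (z + RtoC 0 * h)%C = z.
Proof. ring. Qed.

Lemma wirtinger_mult (f g : C -> C) (z a b c d : C) :
  wirtinger f z a b -> wirtinger g z c d ->
  wirtinger (fun u => f u * g u)%C z (a * g z + f z * c) (b * g z + f z * d).
Proof.
intros Hf Hg h. destruct (Hf h) as [F1 F2]. destruct (Hg h) as [G1 G2].
set (fr := fun t : R => Re (f (z + RtoC t * h)%C)) in *.
set (fi := fun t : R => Im (f (z + RtoC t * h)%C)) in *.
set (gr := fun t : R => Re (g (z + RtoC t * h)%C)) in *.
set (gi := fun t : R => Im (g (z + RtoC t * h)%C)) in *.
assert (Ef : f z = (fr 0, fi 0)).
{ unfold fr, fi. rewrite Cplus_0_scal. apply surjective_pairing. }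
assert (Eg : g z = (gr 0, gi 0)).
{ unfold gr, gi. rewrite Cplus_0_scal. apply surjective_pairing. }
rewrite Ef, Eg. split.
- apply (is_derive_ext (fun t => fr t * gr t - fi t * gi t)). { reflexivity. }
  auto_derive. repeat split; eexists; eassumption.
  rewrite (is_derive_unique fr 0 _ F1 : Derive (fun x : R => fr x) 0 = _).
  rewrite (is_derive_unique fi 0 _ F2 : Derive (fun x : R => fi x) 0 = _).
  rewrite (is_derive_unique gr 0 _ G1 : Derive (fun x : R => gr x) 0 = _).
  rewrite (is_derive_unique gi 0 _ G2 : Derive (fun x : R => gi x) 0 = _).
  unfold Re, Im; simpl. ring.
- apply (is_derive_ext (fun t => fr t * gi t + fi t * gr t)). { reflexivity. }
  auto_derive. repeat split; eexists; eassumption.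
  rewrite (is_derive_unique fr 0 _ F1 : Derive (fun x : R => fr x) 0 = _).
  rewrite (is_derive_unique fi 0 _ F2 : Derive (fun x : R => fi x) 0 = _).
  rewrite (is_derive_unique gr 0 _ G1 : Derive (fun x : R => gr x) 0 = _).
  rewrite (is_derive_unique gi 0 _ G2 : Derive (fun x : R => gi x) 0 = _).
  unfold Re, Im; simpl. ring.
Qed.

Lemma wirtinger_inv (f : C -> C) (z a b : C) : f z <> RtoC 0 ->
  wirtinger f z a b -> wirtinger (fun u => / f u)%C z (- a / f z ^ 2) (- b / f z ^ 2).
Proof.
intros Hn Hf h. destruct (Hf h) as [F1 F2].
set (fr := fun t : R => Re (f (z + RtoC t * h)%C)) in *.
set (fi := fun t : R => Im (f (z + RtoC t * h)%C)) in *.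
assert (Ef : f z = (fr 0, fi 0)).
{ unfold fr, fi. rewrite Cplus_0_scal. apply surjective_pairing. }
assert (P : 0 < fr 0 ^ 2 + fi 0 ^ 2).
{ rewrite Ef in Hn. apply Cmod_gt_0, (pow_lt _ 2) in Hn. rewrite Cmod2_alt in Hn. exact Hn. }
replace (- a / f z ^ 2 * h + - b / f z ^ 2 * Cconj h)%C with
  (- (a * h + b * Cconj h) * (/ f z) ^ 2)%C by (field; exact Hn).
rewrite Ef. split.
- apply (is_derive_ext (fun t => fr t / (fr t ^ 2 + fi t ^ 2))). { reflexivity. }
  auto_derive. repeat split; try (eexists; eassumption). lra.
  rewrite (is_derive_unique fr 0 _ F1 : Derive (fun x : R => fr x) 0 = _).
  rewrite (is_derive_unique fi 0 _ F2 : Derive (fun x : R => fi x) 0 = _).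
  set (k := (a * h + b * Cconj h)%C). destruct k as [k1 k2].
  unfold Re, Im, Cinv; simpl. field. lra.
- apply (is_derive_ext (fun t => - fi t / (fr t ^ 2 + fi t ^ 2))). { reflexivity. }
  auto_derive. repeat split; try (eexists; eassumption). lra.
  rewrite (is_derive_unique fr 0 _ F1 : Derive (fun x : R => fr x) 0 = _).
  rewrite (is_derive_unique fi 0 _ F2 : Derive (fun x : R => fi x) 0 = _).
  set (k := (a * h + b * Cconj h)%C). destruct k as [k1 k2].
  unfold Re, Im, Cinv; simpl. field. lra.
Qed.

(** * The chart w0 = 1 and the formulas of the positive lift *)

Section AffineLift.

Variables (w1 w2 w3 : C -> C) (z d1 d2 d3 : C).
Hypothesis D1 : wirtinger w1 z d1 0.
Hypothesis D2 : wirtinger w2 z d2 0.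
Hypothesis D3 : wirtinger w3 z d3 0.

(** These are [xi] and [eta] of [tau (1, w1, w2, w3)]: since [1 + t] is [2 (1 + |w3|^2)] divided by
    the squared norm, the latter cancels. *)
Definition affine_xi (u : C) : C :=
  ((w1 u + Cconj (w2 u) * w3 u) * / (1 + w3 u * Cconj (w3 u)))%C.
Definition affine_eta (u : C) : C :=
  ((w2 u + - (1) * (Cconj (w1 u) * w3 u)) * / (1 + w3 u * Cconj (w3 u)))%C.

Lemma affine_norm_nz (w : C) : (1 + w * Cconj w)%C <> RtoC 0.
Proof.
rewrite <- Cmod2_conj, <- RtoC_plus. apply RtoC_nz. pose proof (pow2_ge_0 (Cmod w)). lra.
Qed.

Let N : C := (1 + w3 z * Cconj (w3 z))%C.

(** For a holomorphic curve [xi_zb] is [w3] times the conjugate of the [z] derivative of [eta], and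
    [eta_zb] is [- w3] times the conjugate of the [z] derivative of [xi]. This is the mechanism of
    the positive lift: the ratio of the derivatives reveals [w3]. *)
Lemma affine_wirtinger :
  wirtinger affine_xi z
    ((d1 * N + Cconj (w2 z) * d3 - w1 z * Cconj (w3 z) * d3) / N ^ 2)
    (w3 z * (Cconj d2 * N - w1 z * Cconj d3 - Cconj (w2 z) * w3 z * Cconj d3) / N ^ 2) /\
  wirtinger affine_eta z
    ((d2 * N - Cconj (w1 z) * d3 - w2 z * Cconj (w3 z) * d3) / N ^ 2)
    (- w3 z * (Cconj d1 * N + w2 z * Cconj d3 - Cconj (w1 z) * w3 z * Cconj d3) / N ^ 2).
Proof.
pose proof (affine_norm_nz (w3 z)) as Hn. fold N in Hn.
assert (DN : wirtinger (fun u => / (1 + w3 u * Cconj (w3 u)))%C z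
  (- (d3 * Cconj (w3 z)) / N ^ 2) (- (w3 z * Cconj d3) / N ^ 2)).
{ eapply wirtinger_value.
  - apply (wirtinger_inv (fun u => 1 + w3 u * Cconj (w3 u))%C). exact Hn.
    apply (wirtinger_plus (fun _ => 1%C)). apply wirtinger_const.
    apply wirtinger_mult. exact D3. apply wirtinger_conj. exact D3.
  - fold N. rewrite Cconj_RtoC. field. exact Hn.
  - fold N. field. exact Hn. }
split.
- eapply wirtinger_value.
  + apply (wirtinger_mult (fun u => w1 u + Cconj (w2 u) * w3 u)%C). 2: exact DN.
    apply wirtinger_plus. exact D1.
    apply wirtinger_mult. apply wirtinger_conj. exact D2. exact D3.
  + fold N. rewrite Cconj_RtoC. unfold N in *. field. exact Hn.
  + fold N. unfold N in *. field. exact Hn.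
- eapply wirtinger_value.
  + apply (wirtinger_mult (fun u => w2 u + - (1) * (Cconj (w1 u) * w3 u))%C). 2: exact DN.
    apply wirtinger_plus. exact D2.
    apply (wirtinger_mult (fun _ => - (1))%C). apply wirtinger_const.
    apply wirtinger_mult. apply wirtinger_conj. exact D1. exact D3.
  + fold N. rewrite Cconj_RtoC. unfold N in *. field. exact Hn.
  + fold N. unfold N in *. field. exact Hn.
Qed.

(* The affine chart of [tau] inverts: the point of the fibre is recovered from
   [xi], [eta] and the last coordinate. *)
Lemma affine_inverse :
  (affine_xi z - w3 z * Cconj (affine_eta z) = w1 z)%C /\
  (affine_eta z + w3 z * Cconj (affine_xi z) = w2 z)%C.
Proof.
pose proof (affine_norm_nz (w3 z)) as Hn.
assert (EN : Cconj (/ (1 + w3 z * Cconj (w3 z))) = (/ (1 + w3 z * Cconj (w3 z)))%C).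
{ rewrite Cinv_conj by exact Hn. f_equal.
  rewrite Cplus_conj, Cmult_conj, Cconj_conj, Cconj_RtoC. ring. }
unfold affine_xi, affine_eta.
rewrite !Cmult_conj, EN, !Cplus_conj, !Cmult_conj, !Cconj_conj, Copp_conj, Cconj_RtoC.
split; field; exact Hn.
Qed.

End AffineLift.

Lemma tau_affine (w1 w2 w3 : C) :
  let '(t, zeta1, zeta2) := tau (RtoC 1, w1, w2, w3) in
  (zeta1 / (1 + t))%C = ((w1 + Cconj w2 * w3) * / (1 + w3 * Cconj w3))%C /\
  (zeta2 / (1 + t))%C = ((w2 + - (1) * (Cconj w1 * w3)) * / (1 + w3 * Cconj w3))%C.
Proof.
unfold tau. rewrite Cmod_1, Cconj_RtoC.
assert (PN : 0 < 1 ^ 2 + Cmod w1 ^ 2 + Cmod w2 ^ 2 + Cmod w3 ^ 2).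
{ pose proof (pow2_ge_0 (Cmod w1)). pose proof (pow2_ge_0 (Cmod w2)).
  pose proof (pow2_ge_0 (Cmod w3)). lra. }
set (N := _ + Cmod w3 ^ 2) in *.
assert (E : (1 + RtoC ((1 ^ 2 + Cmod w3 ^ 2 - Cmod w1 ^ 2 - Cmod w2 ^ 2) / N))%C
  = (2 * (1 + w3 * Cconj w3) / RtoC N)%C).
{ rewrite <- Cmod2_conj, <- !RtoC_plus, <- RtoC_mult, <- RtoC_div by lra. f_equal.
  unfold N in *. field. lra. }
rewrite E.
pose proof (affine_norm_nz w3).
assert (RtoC N <> RtoC 0) by (apply RtoC_nz; lra).
split; field; auto.
Qed.

Section PositiveLift.

Variables (psi : R3 -> E5) (mu1 mu2 : C).
Hypothesis mu1_nz : mu1 <> RtoC 0.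
Hypothesis mu2_nz : mu2 <> RtoC 0.
Hypothesis Hpsi : forall z0 z1 : C, ((z0, z1) : C2) <> zero ->
  psi (sigma2_inv (z0, z1)) = tau (twistor_lift mu1 mu2 (z0, z1)).

Let w1 (u : C) : C := (mu1 * u)%C.
Let w2 (u : C) : C := (mu2 * u ^ 2)%C.
Let w3 (u : C) : C := (- (mu1 * mu2 / 3) * u ^ 3)%C.

Lemma twistor_lift_chart0 (u : C) : twistor_lift mu1 mu2 (chart0 u) = (RtoC 1, w1 u, w2 u, w3 u).
Proof. unfold twistor_lift, chart0, w1, w2, w3. apply C4_eq; ring. Qed.

Lemma xi_of_affine (u : C) : xi_of psi u = affine_xi w1 w2 w3 u.
Proof.
unfold xi_of. assert (Hn : chart0 u <> zero) by (apply C2_nonzero_l, C1_nz).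
unfold chart0 in *. rewrite (Hpsi _ _ Hn). fold (chart0 u). rewrite twistor_lift_chart0.
pose proof (tau_affine (w1 u) (w2 u) (w3 u)) as T.
destruct (tau _) as [[t a] b]. exact (proj1 T).
Qed.

Lemma eta_of_affine (u : C) : eta_of psi u = affine_eta w1 w2 w3 u.
Proof.
unfold eta_of. assert (Hn : chart0 u <> zero) by (apply C2_nonzero_l, C1_nz).
unfold chart0 in *. rewrite (Hpsi _ _ Hn). fold (chart0 u). rewrite twistor_lift_chart0.
pose proof (tau_affine (w1 u) (w2 u) (w3 u)) as T.
destruct (tau _) as [[t a] b]. exact (proj2 T).
Qed.

Let Dw1 (z : C) : wirtinger w1 z mu1 0.
Proof.
eapply wirtinger_value.
apply (wirtinger_mult (fun _ => mu1) (fun u => u)). apply wirtinger_const. apply wirtinger_id.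
all: ring.
Qed.

Let Dw2 (z : C) : wirtinger w2 z (2 * mu2 * z) 0.
Proof.
apply (wirtinger_ext (fun u => mu2 * (u * u))%C). { intros u. unfold w2. ring. }
eapply wirtinger_value.
apply (wirtinger_mult (fun _ => mu2) (fun u => u * u)%C). apply wirtinger_const.
apply (wirtinger_mult (fun u => u) (fun u => u)); apply wirtinger_id.
all: ring.
Qed.

Let Dw3 (z : C) : wirtinger w3 z (- (mu1 * mu2) * z ^ 2) 0.
Proof.
apply (wirtinger_ext (fun u => - (mu1 * mu2 / 3) * (u * (u * u)))%C). { intros u. unfold w3. ring. }
eapply wirtinger_value.
apply (wirtinger_mult (fun _ => - (mu1 * mu2 / 3))%C (fun u => u * (u * u))%C).
apply wirtinger_const.
apply (wirtinger_mult (fun u => u) (fun u => u * u)%C). apply wirtinger_id.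
apply (wirtinger_mult (fun u => u) (fun u => u)); apply wirtinger_id.
all: field; apply C3_nz.
Qed.

(** [p] and [e] are the scalar factors carried by the two expressions of the positive lift; the last
    clause says that at every [z] other than 0 at least one expression is usable. *)
Lemma lift_dzbar (z : C) : exists p e : C,
  dzbar (fun u => Cconj (xi_of psi u)) z = p /\
  dzbar (eta_of psi) z = (- w3 z * p)%C /\
  dzbar (fun u => Cconj (eta_of psi u)) z = e /\
  dzbar (xi_of psi) z = (w3 z * e)%C /\
  (xi_of psi z - w3 z * Cconj (eta_of psi z) = w1 z)%C /\
  (eta_of psi z + w3 z * Cconj (xi_of psi z) = w2 z)%C /\
  (z <> RtoC 0 -> p <> RtoC 0 \/ e <> RtoC 0).
Proof.
destruct (affine_wirtinger w1 w2 w3 z _ _ _ (Dw1 z) (Dw2 z) (Dw3 z)) as [X E].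
apply (wirtinger_ext _ (xi_of psi)) in X; [|intros; now rewrite xi_of_affine].
apply (wirtinger_ext _ (eta_of psi)) in E; [|intros; now rewrite eta_of_affine].
pose proof (affine_norm_nz (w3 z)) as Hn. set (N := (1 + w3 z * Cconj (w3 z))%C) in *.
assert (CN : Cconj N = N).
{ unfold N. rewrite Cplus_conj, Cmult_conj, Cconj_conj, Cconj_RtoC. ring. }
assert (Hn2 : (N ^ 2)%C <> RtoC 0) by now apply Cpow_nz.
destruct (affine_inverse w1 w2 w3 z) as [I1 I2].
exists ((Cconj mu1 * N + w2 z * Cconj (- (mu1 * mu2) * z ^ 2)
    - Cconj (w1 z) * w3 z * Cconj (- (mu1 * mu2) * z ^ 2)) / N ^ 2)%C.
exists ((Cconj (2 * mu2 * z) * N - w1 z * Cconj (- (mu1 * mu2) * z ^ 2)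
    - Cconj (w2 z) * w3 z * Cconj (- (mu1 * mu2) * z ^ 2)) / N ^ 2)%C.
rewrite xi_of_affine, eta_of_affine.
refine (conj _ (conj _ (conj _ (conj _ (conj I1 (conj I2 _)))))).
- rewrite (wirtinger_dzbar _ _ _ _ (wirtinger_conj _ _ _ _ X)).
  rewrite Cdiv_conj, Cpow_conj, CN by exact Hn2. f_equal.
  rewrite Cminus_conj, Cplus_conj, !Cmult_conj, !Cconj_conj, CN. reflexivity.
- rewrite (wirtinger_dzbar _ _ _ _ E). field. exact Hn.
- rewrite (wirtinger_dzbar _ _ _ _ (wirtinger_conj _ _ _ _ E)).
  rewrite Cdiv_conj, Cpow_conj, CN by exact Hn2. f_equal.
  rewrite !Cminus_conj, !Cmult_conj, !Cconj_conj, CN. reflexivity.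
- rewrite (wirtinger_dzbar _ _ _ _ X). field. exact Hn.
- intros Hz. apply NNPP. intros Q.
  set (M1 := Cmod mu1 ^ 2). set (M2 := Cmod mu2 ^ 2). set (s := Cmod z ^ 2).
  assert (C1 : Cconj mu1 <> RtoC 0).
  { apply Cmod_gt_0. rewrite Cmod_conj. now apply Cmod_gt_0. }
  assert (C2 : Cconj (mu2 * z) <> RtoC 0).
  { apply Cmod_gt_0. rewrite Cmod_conj. apply Cmod_gt_0. now apply Cmult_neq_0. }
  (* [p] is [Cconj mu1] times this real number, divided by [N ^ 2]. *)
  assert (P0 : 1 - M2 * s ^ 2 - 2 * (M1 * M2 * s ^ 3 / 9) = 0).
  { apply RtoC_inj. apply NNPP. intros Q1. apply Q. left.
    unfold Cdiv. apply Cmult_neq_0.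
    2: { intros Z. apply C1_nz. rewrite <- (Cinv_r _ Hn2), Z. ring. }
    replace (_ - _)%C with (Cconj mu1 * RtoC (1 - M2 * s ^ 2 - 2 * (M1 * M2 * s ^ 3 / 9)))%C.
    now apply Cmult_neq_0.
    unfold Rdiv. rewrite !RtoC_minus, !RtoC_mult, RtoC_inv, !RtoC_pow by lra.
    unfold M1, M2, s. rewrite !Cmod2_conj. unfold N, w1, w2, w3.
    rewrite !Cmult_conj, !Copp_conj, Cconj_div3, !Cmult_conj, !Cpow_conj.
    field; repeat split; first [apply C3_nz | apply RtoC_nz; lra]. }
  (* Likewise [e] is [Cconj (mu2 * z)] times this real number, divided by [N ^ 2]. *)
  assert (P1 : 2 + M1 * s - M1 * M2 * s ^ 3 / 9 = 0).
  { apply RtoC_inj. apply NNPP. intros Q1. apply Q. right.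
    unfold Cdiv. apply Cmult_neq_0.
    2: { intros Z. apply C1_nz. rewrite <- (Cinv_r _ Hn2), Z. ring. }
    replace (_ - _)%C with (Cconj (mu2 * z) * RtoC (2 + M1 * s - M1 * M2 * s ^ 3 / 9))%C.
    now apply Cmult_neq_0.
    unfold Rdiv. rewrite !RtoC_minus, !RtoC_plus, !RtoC_mult, RtoC_inv, !RtoC_pow by lra.
    unfold M1, M2, s. rewrite !Cmod2_conj. unfold N, w1, w2, w3.
    rewrite !Cmult_conj, !Copp_conj, Cconj_div3, !Cmult_conj, !Cpow_conj, Cconj_RtoC.
    field; repeat split; first [apply C3_nz | apply RtoC_nz; lra]. }
  (* Subtracting twice [P1] from [P0] eliminates the cubic term and leaves
     [- 3 - M2 s^2 - 2 M1 s = 0], which is impossible. *)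
  assert (H1 : 0 <= M1 * s) by (apply Rmult_le_pos; apply pow2_ge_0).
  assert (H2 : 0 <= M2 * s ^ 2) by (apply Rmult_le_pos; apply pow2_ge_0).
  lra.
Qed.

(** Both expressions are multiples, by [p] and by [e], of [(1, w1, w2, w3)]. The equivalence serves
    in both directions: [twistor_lift] is a positive lift, and every positive lift agrees with it
    away from 0 and infinity. *)
Lemma positive_lift_formulas (V : C4) (z : C) : z <> RtoC 0 ->
  let xi := xi_of psi z in
  let eta := eta_of psi z in
  let xi_zb := dzbar (xi_of psi) z in
  let eta_zb := dzbar (eta_of psi) z in
  let xibar_zb := dzbar (fun u => Cconj (xi_of psi u)) z in
  let etabar_zb := dzbar (fun u => Cconj (eta_of psi u)) z in
  (((xibar_zb, eta_zb) : C2) <> zero ->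
     proj_eq V ((xibar_zb, xibar_zb * xi + eta_zb * Cconj eta,
        xibar_zb * eta - eta_zb * Cconj xi, - eta_zb)%C : C4)) /\
  (((xi_zb, etabar_zb) : C2) <> zero ->
     proj_eq V ((etabar_zb, etabar_zb * xi - xi_zb * Cconj eta,
        etabar_zb * eta + xi_zb * Cconj xi, xi_zb)%C : C4)) <->
  proj_eq V (twistor_lift mu1 mu2 (chart0 z)).
Proof.
intros Hz. rewrite twistor_lift_chart0.
destruct (lift_dzbar z) as [p [e [-> [-> [-> [-> [I1 [I2 HN]]]]]]]]. cbv zeta.
specialize (HN Hz).
set (xi := xi_of psi z) in *. set (eta := eta_of psi z) in *. rewrite <- I1, <- I2.
assert (S : forall k : C, k <> RtoC 0 -> proj_eq
  ((k, k * xi - w3 z * k * Cconj eta, k * eta + w3 z * k * Cconj xi, w3 z * k)%C : C4)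
  ((RtoC 1, xi - w3 z * Cconj eta, eta + w3 z * Cconj xi, w3 z)%C : C4)).
{ intros k Hk. apply (proj_eq_intro _ _ k Hk). repeat split; ring. }
assert (F1 : ((p, p * xi + - w3 z * p * Cconj eta, p * eta - - w3 z * p * Cconj xi, - (- w3 z * p))%C : C4)
  = (p, p * xi - w3 z * p * Cconj eta, p * eta + w3 z * p * Cconj xi, w3 z * p)%C).
{ apply C4_eq; ring. }
rewrite F1. split.
- intros [H1 H2]. destruct HN as [Hp|He].
  + eapply proj_eq_trans. apply H1. now apply C2_nonzero_l. now apply S.
  + eapply proj_eq_trans. apply H2. now apply C2_nonzero_r. now apply S.
- intros HV. split; intros H0.
  + assert (Hp : p <> RtoC 0).
    { intros ->. apply H0. rewrite Cmult_0_r. reflexivity. }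
    eapply proj_eq_trans. exact HV. apply proj_eq_sym. now apply S.
  + assert (He : e <> RtoC 0).
    { intros ->. apply H0. rewrite Cmult_0_r. reflexivity. }
    eapply proj_eq_trans. exact HV. apply proj_eq_sym. now apply S.
Qed.

End PositiveLift.

(** * Holomorphic maps and horizontality *)

(** The codomain carries two normed module structures with the same norm: the product rule lives in
    one, the coordinates of C^4 in the other. *)
Lemma is_derive_C_AbsRing (f : C -> C) (z l : C) :
  is_derive (K := C_AbsRing) (V := C_NormedModule) f z l <->
  is_derive (K := C_AbsRing) (V := AbsRing_NormedModule C_AbsRing) f z l.
Proof.
split; intros [[H1 H2 H3] H]; (split; [constructor|]); assumption.
Qed.

Lemma is_derive_fst {K : AbsRing} {U V : NormedModule K} (F : K -> U * V) (z : K) (d : U * V) :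
  is_derive (V := prod_NormedModule K U V) F z d -> is_derive (fun u => fst (F u)) z (fst d).
Proof.
intros H. eapply filterdiff_ext_lin.
- apply (filterdiff_comp' F (fun x : prod_NormedModule K U V => fst x) z _ (fun x => fst x) H).
  apply filterdiff_linear, is_linear_fst.
- reflexivity.
Qed.

Lemma is_derive_snd {K : AbsRing} {U V : NormedModule K} (F : K -> U * V) (z : K) (d : U * V) :
  is_derive (V := prod_NormedModule K U V) F z d -> is_derive (fun u => snd (F u)) z (snd d).
Proof.
intros H. eapply filterdiff_ext_lin.
- apply (filterdiff_comp' F (fun x : prod_NormedModule K U V => snd x) z _ (fun x => snd x) H).
  apply filterdiff_linear, is_linear_snd.
- reflexivity.
Qed.

Lemma is_derive_pair {K : AbsRing} {U V : NormedModule K} (f : K -> U) (g : K -> V)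
    (z : K) (a : U) (b : V) :
  is_derive f z a -> is_derive g z b ->
  is_derive (V := prod_NormedModule K U V) (fun u => (f u, g u)) z (a, b).
Proof.
intros Hf Hg. eapply filterdiff_ext_lin.
- apply (filterdiff_comp'_2 f g (fun x y => (x, y)) z _ _ (fun x y => (x, y)) Hf Hg).
  apply filterdiff_linear. apply is_linear_prod. apply is_linear_fst. apply is_linear_snd.
- reflexivity.
Qed.

(** * Equality in CP^3 through minors *)

Definition coord (i : nat) (w : C4) : C :=
  match i with
  | 0 => fst (fst (fst w)) | 1 => snd (fst (fst w)) | 2 => snd (fst w) | _ => snd w
  end.

Lemma coord_nonzero (w : C4) : w <> zero -> exists i, coord i w <> RtoC 0.
Proof.
intros H. apply NNPP. intros N.
assert (Z : forall i, coord i w = RtoC 0).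
{ intros i. apply NNPP. intros Q. apply N. now exists i. }
apply H. destruct w as [[[a b] c] d].
apply C4_eq; [apply (Z 0%nat)|apply (Z 1%nat)|apply (Z 2%nat)|apply (Z 3%nat)].
Qed.

Lemma coord_scal (i : nat) (a : C) (w : C4) : coord i (scal a w) = (a * coord i w)%C.
Proof. destruct w as [[[w0 w1] w2] w3]. destruct i as [|[|[|i]]]; reflexivity. Qed.

Lemma C4_coord_eq (v w : C4) : (forall i, coord i v = coord i w) -> v = w.
Proof.
intros H. destruct v as [[[a b] c] d], w as [[[a' b'] c'] d'].
apply C4_eq; [apply (H 0%nat)|apply (H 1%nat)|apply (H 2%nat)|apply (H 3%nat)].
Qed.

(** Pluecker coordinates of the pair: projective equality becomes a set of polynomial equations,
    which pass to limits and can be differentiated without knowing the factor between the two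
    vectors. *)
Definition minor (i j : nat) (v w : C4) : C := (coord i v * coord j w - coord j v * coord i w)%C.

Lemma proj_eq_minor (i j : nat) (v w : C4) : proj_eq v w -> minor i j v w = RtoC 0.
Proof. intros [a [_ ->]]. unfold minor. rewrite !coord_scal. ring. Qed.

Lemma minor_proj_eq (v w : C4) : v <> zero -> w <> zero ->
  (forall i j, minor i j v w = RtoC 0) -> proj_eq v w.
Proof.
intros Hv Hw H. destruct (coord_nonzero w Hw) as [j Hj].
assert (E : forall i, coord i v = (coord j v / coord j w * coord i w)%C).
{ intros i. specialize (H i j). unfold minor in H.
  replace (coord i v) with ((coord i v * coord j w - coord j v * coord i w + coord j v * coord i w)
    / coord j w)%C by (field; exact Hj).
  rewrite H. field. exact Hj. }
exists (coord j v / coord j w)%C. split.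
- intros Z. destruct (coord_nonzero v Hv) as [i Hi]. apply Hi. rewrite E, Z. ring.
- apply C4_coord_eq. intros i. rewrite coord_scal. apply E.
Qed.

Lemma is_derive_coord (i : nat) (F : C -> C4) (z : C) (d : C4) :
  is_derive (K := C_AbsRing) F z d ->
  is_derive (K := C_AbsRing) (V := AbsRing_NormedModule C_AbsRing)
    (fun u => coord i (F u)) z (coord i d).
Proof.
intros H. apply is_derive_C_AbsRing.
assert (H3 := is_derive_snd _ _ _ H).
apply is_derive_fst in H. assert (H2 := is_derive_snd _ _ _ H).
apply is_derive_fst in H. assert (H1 := is_derive_snd _ _ _ H).
apply is_derive_fst in H.
destruct i as [|[|[|i]]]; assumption.
Qed.

Lemma is_derive_minor (i j : nat) (F G : C -> C4) (z : C) (dF dG : C4) :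
  is_derive (K := C_AbsRing) F z dF -> is_derive (K := C_AbsRing) G z dG ->
  is_derive (K := C_AbsRing) (V := AbsRing_NormedModule C_AbsRing)
    (fun u => minor i j (F u) (G u)) z (minor i j dF (G z) + minor i j (F z) dG)%C.
Proof.
intros HF HG.
assert (M : forall i j, is_derive (K := C_AbsRing) (V := AbsRing_NormedModule C_AbsRing)
    (fun u => coord i (F u) * coord j (G u))%C z
    (coord i dF * coord j (G z) + coord i (F z) * coord j dG)%C).
{ intros k l. apply (is_derive_mult (K := C_AbsRing) (fun u => coord k (F u)) (fun u => coord l (G u))).
  - now apply is_derive_coord.
  - now apply is_derive_coord.
  - exact Cmult_comm. }
replace (minor i j dF (G z) + minor i j (F z) dG)%C with
  ((coord i dF * coord j (G z) + coord i (F z) * coord j dG)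
   - (coord j dF * coord i (G z) + coord j (F z) * coord i dG))%C by (unfold minor; ring).
exact (is_derive_minus _ _ _ _ _ (M i j) (M j i)).
Qed.

Lemma C_accumulation (z : C) (P : C -> Prop) : locally z P -> exists u, u <> z /\ P u.
Proof.
intros [e He]. exists (z + RtoC (e / 2))%C.
pose proof (cond_pos e). split.
- intros E. apply (f_equal fst) in E. simpl in E. lra.
- apply He. split; unfold ball; simpl; unfold AbsRing_ball, abs, minus, plus, opp; simpl;
    apply Rabs_def1; lra.
Qed.

Lemma punctured_zero (g : C -> C) (z l : C) :
  is_derive (K := C_AbsRing) (V := AbsRing_NormedModule C_AbsRing) g z l ->
  locally z (fun u => u <> z -> g u = RtoC 0) -> g z = RtoC 0.
Proof.
intros H HL. apply NNPP. intros N.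
assert (Hc : @continuous (AbsRing_UniformSpace C_AbsRing) C_UniformSpace g z).
{ apply is_derive_C_AbsRing in H.
  exact (ex_derive_continuous (V := C_NormedModule) g z (ex_intro _ l H)). }
assert (HN : locally z (fun u => g u <> RtoC 0)).
{ apply locally_C. apply (Hc (fun v => v <> RtoC 0)).
  assert (Hd : exists e : posreal, forall v : C, ball (g z) e v -> v <> RtoC 0).
  (* Half the modulus, because a box of radius [r] lies in the disk of radius [sqrt 2 * r]. *)
  { assert (Pm : 0 < Cmod (g z) / 2) by (apply Cmod_gt_0 in N; lra).
    assert (E : forall v, Cmod (v - g z)%C < Cmod (g z) -> v <> RtoC 0).
    { intros v Hv ->. replace (RtoC 0 - g z)%C with (- g z)%C in Hv by ring.
      rewrite Cmod_opp in Hv. lra. }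
    exists (mkposreal _ Pm). intros v Hv. apply E.
    apply C_NormedModule_mixin_compat2 in Hv. simpl in Hv.
    eapply Rlt_le_trans. exact Hv.
    assert (sqrt 2 <= 2). { rewrite <- (sqrt_pow2 2) at 2 by lra. apply sqrt_le_1_alt. lra. }
    nra. }
  destruct Hd as [e He]. now exists e. }
destruct (C_accumulation z _ (filter_and _ _ HL HN)) as [u [Hu [H1 H2]]].
now apply H2, H1.
Qed.

Lemma locally_zero_derive (g : C -> C) (z l : C) :
  is_derive (K := C_AbsRing) (V := AbsRing_NormedModule C_AbsRing) g z l ->
  locally z (fun u => g u = RtoC 0) -> l = RtoC 0.
Proof.
intros H HL.
assert (H0 : is_derive (K := C_AbsRing) (V := C_NormedModule) g z (RtoC 0)).
{ apply (is_derive_ext_loc (fun _ => RtoC 0)).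
  - apply locally_C in HL. revert HL. apply filter_imp. now intros.
  - apply @is_derive_const. }
apply is_derive_C_AbsRing in H. apply is_C_derive_unique in H, H0. now rewrite <- H.
Qed.

Lemma Cmult_div_cancel (a b : C) : a <> RtoC 0 -> (a * (b / a))%C = b.
Proof. intros H. field. exact H. Qed.

Section TwistorLift.

Variables mu1 mu2 : C.
Hypothesis mu1_nz : mu1 <> RtoC 0.
Hypothesis mu2_nz : mu2 <> RtoC 0.

Let W : C2 -> C4 := twistor_lift mu1 mu2.

Lemma twistor_lift_CP_map : CP_map W.
Proof.
split.
- intros z. now apply twistor_lift_nonzero.
- intros z [z0 z1] _ _ [c [Hc ->]].
  change (proj_eq (W (c * z0, c * z1)%C) (W (z0, z1))).
  unfold W. rewrite twistor_lift_scal. exists (c ^ 3)%C. split; [now apply Cpow_nz|]. reflexivity.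
Qed.

Lemma is_derive_monomial (k : C) (n : nat) (z : C) :
  is_derive (K := C_AbsRing) (V := C_NormedModule) (fun u => k * u ^ n)%C z
    (k * (RtoC (INR n) * z ^ pred n))%C.
Proof.
apply is_derive_C_AbsRing.
assert (M : forall f g a b, is_derive (K := C_AbsRing) (V := AbsRing_NormedModule C_AbsRing) f z a ->
  is_derive (K := C_AbsRing) (V := AbsRing_NormedModule C_AbsRing) g z b ->
  is_derive (K := C_AbsRing) (V := AbsRing_NormedModule C_AbsRing) (fun u => f u * g u)%C z
    (a * g z + f z * b)%C).
{ intros f g a b Hf Hg. apply (is_derive_mult (K := C_AbsRing) f g); trivial. exact Cmult_comm. }
assert (P : is_derive (K := C_AbsRing) (V := AbsRing_NormedModule C_AbsRing) (fun u => u ^ n)%C z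
  (RtoC (INR n) * z ^ pred n)%C).
{ induction n as [|n IH].
  - simpl. rewrite Cmult_0_l. apply @is_derive_const.
  - replace (RtoC (INR (S n)) * z ^ pred (S n))%C
      with (1 * z ^ n + z * (RtoC (INR n) * z ^ pred n))%C.
    + apply (M (fun u => u) (fun u => u ^ n)%C). apply @is_derive_id. exact IH.
    + rewrite S_INR, RtoC_plus. destruct n as [|n].
      * simpl. ring.
      * simpl pred. rewrite Cpow_S. ring. }
replace (k * (RtoC (INR n) * z ^ pred n))%C with
  (0 * z ^ n + k * (RtoC (INR n) * z ^ pred n))%C by ring.
apply (M (fun _ => k) (fun u => u ^ n)%C). apply @is_derive_const. exact P.
Qed.

(** It equals [herm w (quat_j v)], so it measures the component of [w] along the fiber of [tau]
    through [v]. *)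
Let contact (v w : C4) : C := (minor 0 3 v w + minor 1 2 v w)%C.

Lemma twistor_lift_chart_derive (phi : C -> C2) (z : C) : phi = chart0 \/ phi = chart1 ->
  exists dW, is_derive (K := C_AbsRing) (fun u => W (phi u)) z dW /\
    contact (W (phi z)) dW = RtoC 0.
Proof.
intros Hphi. 
assert (X : forall k0 k1 k2 k3 n0 n1 n2 n3,
  (forall u, W (phi u) = (k0 * u ^ n0, k1 * u ^ n1, k2 * u ^ n2, k3 * u ^ n3)%C) ->
  is_derive (K := C_AbsRing) (fun u => W (phi u)) z
   ((k0 * (RtoC (INR n0) * z ^ pred n0), k1 * (RtoC (INR n1) * z ^ pred n1),
     k2 * (RtoC (INR n2) * z ^ pred n2), k3 * (RtoC (INR n3) * z ^ pred n3))%C : C4)).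
{ intros k0 k1 k2 k3 n0 n1 n2 n3 E.
  apply (is_derive_ext (K := C_AbsRing)
    (fun u => (k0 * u ^ n0, k1 * u ^ n1, k2 * u ^ n2, k3 * u ^ n3)%C : C4)).
  { intros u. now rewrite E. }
  repeat apply is_derive_pair; apply is_derive_monomial. }
destruct Hphi as [-> | ->].
- eexists. split.
  + apply (X (RtoC 1) mu1 mu2 (- (mu1 * mu2 / 3))%C 0%nat 1%nat 2%nat 3%nat).
    intros u. unfold W, twistor_lift, chart0. apply C4_eq; ring.
  + unfold contact, minor, W, twistor_lift, chart0, coord. simpl fst. simpl snd.
    simpl. replace (1 + 1 + 1) with 3 by ring. replace (1 + 1) with 2 by ring.
    field; apply C3_nz.
- eexists. split.
  + apply (X (RtoC 1) mu1 mu2 (- (mu1 * mu2 / 3))%C 3%nat 2%nat 1%nat 0%nat).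
    intros u. unfold W, twistor_lift, chart1. apply C4_eq; ring.
  + unfold contact, minor, W, twistor_lift, chart1, coord. simpl fst. simpl snd.
    simpl. replace (1 + 1 + 1) with 3 by ring. replace (1 + 1) with 2 by ring.
    field; apply C3_nz.
Qed.

Lemma chart_nonzero (phi : C -> C2) (u : C) : phi = chart0 \/ phi = chart1 -> phi u <> zero.
Proof.
intros [-> | ->]. apply C2_nonzero_l, C1_nz. apply C2_nonzero_r, C1_nz.
Qed.

Lemma twistor_lift_holomorphic : holomorphic W.
Proof.
split. apply twistor_lift_CP_map.
intros phi Hphi z. exists (fun u => W (phi u)). unfold local_lift.
apply filter_forall. intros u. split; [|split].
- now apply twistor_lift_nonzero, chart_nonzero.
- apply proj_eq_refl.
- destruct (twistor_lift_chart_derive phi u Hphi) as [d [Hd _]]. now exists d.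
Qed.

Lemma twistor_lift_unique (W' : C2 -> C4) : holomorphic W' ->
  (forall z, z <> RtoC 0 -> proj_eq (W' (chart0 z)) (W (chart0 z))) ->
  forall z, z <> zero -> proj_eq (W' z) (W z).
Proof.
intros [[_ Hp] HW'] H0.
assert (L : forall phi, phi = chart0 \/ phi = chart1 ->
  (forall u, u <> RtoC 0 -> proj_eq (W' (phi u)) (W (phi u))) ->
  proj_eq (W' (phi (RtoC 0))) (W (phi (RtoC 0)))).
{ intros phi Hphi Hu. destruct (HW' phi Hphi (RtoC 0)) as [F HF].
  destruct (locally_singleton _ _ HF) as [Fn [FW [dF DF]]].
  destruct (twistor_lift_chart_derive phi (RtoC 0) Hphi) as [dG [DG _]].
  eapply proj_eq_trans. exact FW.
  apply minor_proj_eq; [exact Fn|now apply twistor_lift_nonzero, chart_nonzero|].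
  intros i j.
  apply (punctured_zero (fun u => minor i j (F u) (W (phi u))) _ _
    (is_derive_minor i j F _ _ _ _ DF DG)).
  revert HF. unfold local_lift. apply filter_imp. intros u [_ [E _]] Hn. apply proj_eq_minor.
  eapply proj_eq_trans. apply proj_eq_sym. exact E. now apply Hu. }
assert (R : forall z z', z <> zero -> z' <> zero -> proj_eq z z' ->
  proj_eq (W' z') (W z') -> proj_eq (W' z) (W z)).
{ intros z z' Hz Hz' E H. eapply proj_eq_trans. now apply (Hp z z').
  eapply proj_eq_trans. exact H. apply proj_eq_sym. now apply twistor_lift_CP_map. }
intros [z0 z1] Hz. destruct (classic (z0 = RtoC 0)) as [E0|E0].
- destruct (C2_nonzero _ _ Hz) as [E1|E1]; [easy|].
  apply (R _ (chart1 (RtoC 0))); trivial.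
  + apply chart_nonzero. auto.
  + exists z1. split; [exact E1|]. change ((z0, z1) = (z1 * RtoC 0, z1 * RtoC 1)%C).
    now rewrite E0, Cmult_0_r, Cmult_1_r.
  + apply L; [auto|]. intros u Hu. apply (R _ (chart0 (/ u)%C)).
    * apply chart_nonzero. auto.
    * apply chart_nonzero. auto.
    * exists u. split; [exact Hu|]. change ((u, RtoC 1) = (u * RtoC 1, u * / u)%C).
      now rewrite Cmult_1_r, Cinv_r.
    * apply H0. intros Z. apply C1_nz. rewrite <- (Cinv_r u Hu), Z. ring.
- apply (R _ (chart0 (z1 / z0)%C)); trivial.
  + apply chart_nonzero. auto.
  + exists z0. split; [exact E0|]. change ((z0, z1) = (z0 * RtoC 1, z0 * (z1 / z0))%C).
    now rewrite Cmult_1_r, Cmult_div_cancel.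
  + destruct (classic ((z1 / z0)%C = RtoC 0)) as [-> | E]; [|now apply H0].
    apply L; auto.
Qed.

(** [F] is pointwise a multiple of [W], by a factor not known to be differentiable. Differentiating
    the vanishing minors of [F] and [W] bypasses it: the minors of [F] and [dF] at [z] are [a ^ 2]
    times those of [W] and its derivative. *)
Lemma lift_contact (phi : C -> C2) (z : C) (F : C -> C4) (dF : C4) :
  phi = chart0 \/ phi = chart1 -> local_lift W phi z F ->
  is_derive (K := C_AbsRing) F z dF -> contact (F z) dF = RtoC 0.
Proof.
intros Hphi HF DF.
destruct (twistor_lift_chart_derive phi z Hphi) as [dG [DG HG]].
destruct (locally_singleton _ _ HF) as [_ [FW _]]. apply proj_eq_sym in FW.
destruct FW as [a [Ha EF]].
assert (M : forall i j, (minor i j dF (W (phi z)) + minor i j (F z) dG)%C = RtoC 0).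
{ intros i j.
  apply (locally_zero_derive _ _ _ (is_derive_minor i j F _ _ _ _ DF DG)).
  revert HF. unfold local_lift. apply filter_imp. intros u [_ [E _]]. apply proj_eq_minor, proj_eq_sym, E. }
assert (K : forall i j, minor i j (F z) dF = (a * a * minor i j (W (phi z)) dG)%C).
{ intros i j. specialize (M i j). rewrite EF in *. unfold minor in *. rewrite !coord_scal in *.
  set (x := coord i dF) in *. set (y := coord j dF) in *.
  set (p := coord i (W (phi z))) in *. set (q := coord j (W (phi z))) in *.
  set (r := coord i dG) in *. set (s := coord j dG) in *.
  transitivity (a * a * (p * s - q * r) - a * (x * q - y * p + (a * p * s - a * q * r)))%C; [ring|].
  rewrite M. ring. }
unfold contact in *. rewrite !K, <- Cmult_plus_distr_l, HG. ring.
Qed.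

End TwistorLift.

(* The fibre of [tau] through [w] is the projective line spanned by [w] and
   [quat_j w]. *)
Definition quat_j (w : C4) : C4 :=
  let '(w0, w1, w2, w3) := w in (- Cconj w3, - Cconj w2, Cconj w1, Cconj w0)%C.

Lemma herm_self (w0 w1 w2 w3 : C) : herm (w0, w1, w2, w3) (w0, w1, w2, w3) =
  RtoC (Cmod w0 ^ 2 + Cmod w1 ^ 2 + Cmod w2 ^ 2 + Cmod w3 ^ 2).
Proof. unfold herm. now rewrite !RtoC_plus, !Cmod2_conj. Qed.

Lemma Cdiv_eq_cross (a b m n : C) : m <> RtoC 0 -> n <> RtoC 0 ->
  (2 * a / m = 2 * b / n)%C -> (a * n = b * m)%C.
Proof.
intros Hm Hn E.
replace (a * n)%C with ((2 * a / m) * m * n / 2)%C by (field; auto).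
rewrite E. field; auto.
Qed.

(** Multiplied by [2 |g|^2], the identity in each coordinate is a combination, with coefficients
    linear in [g], of the cross-multiplied equations [tau g = tau w] and their conjugates. *)
Lemma tau_fiber (g w : C4) : g <> zero -> w <> zero -> tau g = tau w ->
  scal (herm w w) g = plus (scal (herm g w) w) (scal (herm g (quat_j w)) (quat_j w)).
Proof.
destruct g as [[[g0 g1] g2] g3], w as [[[w0 w1] w2] w3]. intros Hg Hw E.
apply C4_norm_pos in Hg, Hw.
unfold tau in E. cbv zeta in E.
set (Ng := Cmod g0 ^ 2 + Cmod g1 ^ 2 + Cmod g2 ^ 2 + Cmod g3 ^ 2) in *.
set (Nw := Cmod w0 ^ 2 + Cmod w1 ^ 2 + Cmod w2 ^ 2 + Cmod w3 ^ 2) in *.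
assert (Hg' : RtoC Ng <> RtoC 0) by (apply RtoC_nz; lra).
assert (Hw' : RtoC Nw <> RtoC 0) by (apply RtoC_nz; lra).
assert (ENg : RtoC Ng = (g0 * Cconj g0 + g1 * Cconj g1 + g2 * Cconj g2 + g3 * Cconj g3)%C).
{ unfold Ng. now rewrite !RtoC_plus, !Cmod2_conj. }
assert (ENw : RtoC Nw = (w0 * Cconj w0 + w1 * Cconj w1 + w2 * Cconj w2 + w3 * Cconj w3)%C).
{ unfold Nw. now rewrite !RtoC_plus, !Cmod2_conj. }
assert (E0 := f_equal (fun y : E5 => fst (fst y)) E).
assert (E1 := f_equal (fun y : E5 => snd (fst y)) E).
assert (E2 := f_equal (fun y : E5 => snd y) E). simpl in E0, E1, E2. clear E.
apply Cdiv_eq_cross in E1; [|exact Hg'|exact Hw'].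
apply Cdiv_eq_cross in E2; [|exact Hg'|exact Hw'].
assert (E0' : ((g0 * Cconj g0 + g3 * Cconj g3 - g1 * Cconj g1 - g2 * Cconj g2) * RtoC Nw
  = (w0 * Cconj w0 + w3 * Cconj w3 - w1 * Cconj w1 - w2 * Cconj w2) * RtoC Ng)%C).
{ rewrite <- !Cmod2_conj, <- !RtoC_plus, <- !RtoC_minus, <- !RtoC_mult. f_equal.
  apply (Rmult_eq_reg_r (/ Ng * / Nw)).
  2: { apply Rmult_integral_contrapositive_currified; apply Rinv_neq_0_compat; lra. }
  transitivity ((Cmod g0 ^ 2 + Cmod g3 ^ 2 - Cmod g1 ^ 2 - Cmod g2 ^ 2) / Ng); [field; lra|].
  transitivity ((Cmod w0 ^ 2 + Cmod w3 ^ 2 - Cmod w1 ^ 2 - Cmod w2 ^ 2) / Nw); [exact E0|field; lra]. }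
assert (C1 := f_equal Cconj E1). assert (C2 := f_equal Cconj E2).
rewrite !Cmult_conj, !Cplus_conj, !Cmult_conj, !Cconj_conj, !Cconj_RtoC in C1.
rewrite !Cmult_conj, !Cminus_conj, !Cmult_conj, !Cconj_conj, !Cconj_RtoC in C2.
clear E0. rewrite ENg, ENw in E0', E1, E2, C1, C2.
assert (Z : forall a b : C, (RtoC 2 * RtoC Ng * (a - b) = 0)%C -> a = b).
{ intros a b H. apply Ceq_minus. apply NNPP. intros Q.
  revert H. apply Cmult_neq_0; [|exact Q]. apply Cmult_neq_0; [|exact Hg'].
  apply RtoC_nz. lra. }
unfold herm, quat_j.
rewrite !Copp_conj, !Cconj_conj.
rewrite ENg in Z.
set (g0' := Cconj g0) in *. set (g1' := Cconj g1) in *.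
set (g2' := Cconj g2) in *. set (g3' := Cconj g3) in *.
set (w0' := Cconj w0) in *. set (w1' := Cconj w1) in *.
set (w2' := Cconj w2) in *. set (w3' := Cconj w3) in *.
(* From here on the conjugates are independent variables and the claim is purely polynomial. *)
clearbody g0' g1' g2' g3' w0' w1' w2' w3'. clear - Z E0' E1 E2 C1 C2.
set (ng := (g0 * g0' + g1 * g1' + g2 * g2' + g3 * g3')%C) in *.
set (nw := (w0 * w0' + w1 * w1' + w2 * w2' + w3 * w3')%C) in *.
apply Ceq_minus in E0', E1, E2, C1, C2.
set (e0 := (_ - _)%C) in E0'. set (e1 := (_ - _)%C) in E1. set (e2 := (_ - _)%C) in E2.
set (c1 := (_ - _)%C) in C1. set (c2 := (_ - _)%C) in C2.
set (a := (g0 * w0' + g1 * w1' + g2 * w2' + g3 * w3')%C).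
set (b := (g0 * - w3 + g1 * - w2 + g2 * w1 + g3 * w0)%C).
change ((nw * g0, nw * g1, nw * g2, nw * g3)%C =
  (a * w0 + b * - w3', a * w1 + b * - w2', a * w2 + b * w1', a * w3 + b * w0')%C).
apply C4_eq; apply Z; unfold a, b.
- transitivity (e0 * g0 + 2 * c1 * g1 + 2 * c2 * g2)%C.
  + unfold e0, c1, c2, ng, nw. ring.
  + rewrite E0', C1, C2. ring.
- transitivity (- e0 * g1 + 2 * e1 * g0 - 2 * c2 * g3)%C.
  + unfold e0, e1, c2, ng, nw. ring.
  + rewrite E0', E1, C2. ring.
- transitivity (- e0 * g2 + 2 * e2 * g0 + 2 * c1 * g3)%C.
  + unfold e0, e2, c1, ng, nw. ring.
  + rewrite E0', E2, C1. ring.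
- transitivity (e0 * g3 - 2 * e2 * g1 + 2 * e1 * g2)%C.
  + unfold e0, e1, e2, ng, nw. ring.
  + rewrite E0', E1, E2. ring.
Qed.

(** * Tangents to the fibers of tau and horizontality *)

Definition is_derive_RC (g : R -> C) (t : R) (d : C) : Prop :=
  is_derive (fun u => Re (g u)) t (Re d) /\ is_derive (fun u => Im (g u)) t (Im d).

Lemma is_derive_RC_scal (k : C) (g : R -> C) (t : R) (d : C) :
  is_derive_RC g t d -> is_derive_RC (fun u => k * g u)%C t (k * d)%C.
Proof.
intros [H1 H2].
set (gr := fun u : R => Re (g u)) in *. set (gi := fun u : R => Im (g u)) in *.
split.
- apply (is_derive_ext (fun u => Re k * gr u - Im k * gi u)). { reflexivity. }
  auto_derive. repeat split; eexists; eassumption.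
  rewrite (is_derive_unique gr t _ H1 : Derive (fun x : R => gr x) t = _).
  rewrite (is_derive_unique gi t _ H2 : Derive (fun x : R => gi x) t = _).
  unfold Re, Im; simpl. ring.
- apply (is_derive_ext (fun u => Re k * gi u + Im k * gr u)). { reflexivity. }
  auto_derive. repeat split; eexists; eassumption.
  rewrite (is_derive_unique gr t _ H1 : Derive (fun x : R => gr x) t = _).
  rewrite (is_derive_unique gi t _ H2 : Derive (fun x : R => gi x) t = _).
  unfold Re, Im; simpl. ring.
Qed.

Lemma is_derive_RC_plus (g h : R -> C) (t : R) (c d : C) :
  is_derive_RC g t c -> is_derive_RC h t d -> is_derive_RC (fun u => g u + h u)%C t (c + d)%C.
Proof.
intros [G1 G2] [H1 H2]. split.
- exact (is_derive_plus (K := R_AbsRing) (V := R_NormedModule) _ _ _ _ _ G1 H1).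
- exact (is_derive_plus (K := R_AbsRing) (V := R_NormedModule) _ _ _ _ _ G2 H2).
Qed.

Lemma is_derive_RC_coord (i : nat) (gamma : R -> C4) (t : R) (d : C4) :
  is_derive (K := R_AbsRing) gamma t d -> is_derive_RC (fun u => coord i (gamma u)) t (coord i d).
Proof.
intros H.
assert (H3 := is_derive_snd _ _ _ H).
apply is_derive_fst in H. assert (H2 := is_derive_snd _ _ _ H).
apply is_derive_fst in H. assert (H1 := is_derive_snd _ _ _ H).
apply is_derive_fst in H.
destruct i as [|[|[|i]]].
- exact (conj (is_derive_fst _ _ _ H) (is_derive_snd _ _ _ H)).
- exact (conj (is_derive_fst _ _ _ H1) (is_derive_snd _ _ _ H1)).
- exact (conj (is_derive_fst _ _ _ H2) (is_derive_snd _ _ _ H2)).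
- exact (conj (is_derive_fst _ _ _ H3) (is_derive_snd _ _ _ H3)).
Qed.

Lemma is_derive_RC_locally_zero (g : R -> C) (t : R) (d : C) :
  is_derive_RC g t d -> locally t (fun u => g u = RtoC 0) -> d = RtoC 0.
Proof.
intros [H1 H2] HL.
assert (Z : forall p : C -> R, p (RtoC 0) = 0 -> forall l, is_derive (fun u => p (g u)) t l -> l = 0).
{ intros p Hp l Hl. rewrite <- (is_derive_unique _ _ _ Hl). apply is_derive_unique.
  apply (is_derive_ext_loc (fun _ => 0)).
  - revert HL. apply filter_imp. intros u ->. now rewrite Hp.
  - apply @is_derive_const. }
apply (Z Re) in H1; [|reflexivity]. apply (Z Im) in H2; [|reflexivity].
destruct d as [d1 d2]. simpl in H1, H2. now rewrite H1, H2.
Qed.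

(** For fixed [w] the equation of [tau_fiber] is linear in [g], so it passes to the derivative of a
    curve in the fiber. *)
Lemma fiber_tangent (w : C4) (gamma : R -> C4) (v : C4) : w <> zero ->
  locally 0 (fun t : R => gamma t <> zero /\ tau (gamma t) = tau w) ->
  is_derive (K := R_AbsRing) gamma 0 v ->
  scal (herm w w) v = plus (scal (herm v w) w) (scal (herm v (quat_j w)) (quat_j w)).
Proof.
intros Hw HL Hd.
assert (L : forall k0 k1 k2 k3 : C,
  locally 0 (fun t : R => (k0 * coord 0 (gamma t) + k1 * coord 1 (gamma t)
    + k2 * coord 2 (gamma t) + k3 * coord 3 (gamma t))%C = RtoC 0) ->
  (k0 * coord 0 v + k1 * coord 1 v + k2 * coord 2 v + k3 * coord 3 v)%C = RtoC 0).
{ intros k0 k1 k2 k3. apply is_derive_RC_locally_zero.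
  repeat apply is_derive_RC_plus; apply is_derive_RC_scal; now apply is_derive_RC_coord. }
(* [K] is the matrix of the linear map whose kernel is the span of [w] and [quat_j w]. *)
set (K := fun i j : nat => (coord i (scal (herm w w) ((RtoC (if Nat.eqb j 0 then 1 else 0), RtoC (if Nat.eqb j 1 then 1 else 0),
      RtoC (if Nat.eqb j 2 then 1 else 0), RtoC (if Nat.eqb j 3 then 1 else 0)) : C4))
  - Cconj (coord j w) * coord i w - Cconj (coord j (quat_j w)) * coord i (quat_j w))%C).
assert (KE : forall (g : C4) (i : nat),
  (K i 0%nat * coord 0 g + K i 1%nat * coord 1 g + K i 2%nat * coord 2 g + K i 3%nat * coord 3 g)%C
  = (coord i (scal (herm w w) g)
     - coord i (plus (scal (herm g w) w) (scal (herm g (quat_j w)) (quat_j w))))%C).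
{ intros g i. unfold K. rewrite !coord_scal.
  destruct w as [[[w0 w1] w2] w3], g as [[[g0 g1] g2] g3].
  set (n := herm (w0, w1, w2, w3) (w0, w1, w2, w3)). clearbody n.
  unfold herm, quat_j.
  destruct i as [|[|[|i]]]; cbn; unfold Cminus; ring. }
apply C4_coord_eq. intros i. apply Ceq_minus. rewrite <- KE. apply L.
revert HL. apply filter_imp. intros t [Hn Ht]. rewrite KE, (tau_fiber _ _ Hn Hw Ht). ring.
Qed.

(** The metric removes the component of [v] along [w]; the one along [quat_j w] contributes the
    conjugate of [herm v (quat_j w)] times the contact form of [w] and [u]. *)
Lemma fubini_study_zero (w u v : C4) (a : C) :
  (minor 0 3 w u + minor 1 2 w u)%C = RtoC 0 ->
  scal (herm w w) v = plus (scal (herm v w) w) (scal (herm v (quat_j w)) (quat_j w)) ->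
  FubiniStudy w (scal a u) v = 0.
Proof.
intros Hc Hv. unfold FubiniStudy.
assert (CN : Cconj (herm w w) = herm w w).
{ destruct w as [[[w0 w1] w2] w3]. rewrite herm_self. apply Cconj_RtoC. }
enough (E : (herm w w * herm (scal a u) v - herm (scal a u) w * herm w v)%C = RtoC 0).
{ rewrite E. unfold Cdiv. rewrite Cmult_0_l. reflexivity. }
assert (Hi : forall i, Cconj (coord i (scal (herm w w) v)) =
  Cconj (coord i (plus (scal (herm v w) w) (scal (herm v (quat_j w)) (quat_j w))))).
{ intros i. now rewrite Hv. }
assert (H0 := Hi 0%nat). assert (H1 := Hi 1%nat). assert (H2 := Hi 2%nat). assert (H3 := Hi 3%nat).
clear Hi Hv. revert CN H0 H1 H2 H3. generalize (herm w w). intros N CN H0 H1 H2 H3.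
destruct w as [[[w0 w1] w2] w3], u as [[[u0 u1] u2] u3], v as [[[v0 v1] v2] v3].
set (p := herm (v0, v1, v2, v3) (quat_j (w0, w1, w2, w3))) in *.
change (Cconj (N * v0) = Cconj (herm (v0, v1, v2, v3) (w0, w1, w2, w3) * w0 + p * - Cconj w3))%C in H0.
change (Cconj (N * v1) = Cconj (herm (v0, v1, v2, v3) (w0, w1, w2, w3) * w1 + p * - Cconj w2))%C in H1.
change (Cconj (N * v2) = Cconj (herm (v0, v1, v2, v3) (w0, w1, w2, w3) * w2 + p * Cconj w1))%C in H2.
change (Cconj (N * v3) = Cconj (herm (v0, v1, v2, v3) (w0, w1, w2, w3) * w3 + p * Cconj w0))%C in H3.
clearbody p.
unfold herm in H0, H1, H2, H3.
rewrite Cmult_conj, CN, ?Cplus_conj, ?Cmult_conj, ?Copp_conj, ?Cplus_conj, ?Cmult_conj, ?Cconj_conj in H0.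
rewrite Cmult_conj, CN, ?Cplus_conj, ?Cmult_conj, ?Copp_conj, ?Cplus_conj, ?Cmult_conj, ?Cconj_conj in H1.
rewrite Cmult_conj, CN, ?Cplus_conj, ?Cmult_conj, ?Copp_conj, ?Cplus_conj, ?Cmult_conj, ?Cconj_conj in H2.
rewrite Cmult_conj, CN, ?Cplus_conj, ?Cmult_conj, ?Copp_conj, ?Cplus_conj, ?Cmult_conj, ?Cconj_conj in H3.
change (herm (scal a (u0, u1, u2, u3)) ?x) with (herm ((a * u0, a * u1, a * u2, a * u3)%C : C4) x).
unfold herm. unfold minor, coord in Hc. simpl in Hc.
transitivity (a * (u0 * (N * Cconj v0) + u1 * (N * Cconj v1) + u2 * (N * Cconj v2)
  + u3 * (N * Cconj v3))
  - a * (u0 * Cconj w0 + u1 * Cconj w1 + u2 * Cconj w2 + u3 * Cconj w3)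
    * (w0 * Cconj v0 + w1 * Cconj v1 + w2 * Cconj v2 + w3 * Cconj v3))%C; [ring|].
rewrite H0, H1, H2, H3.
transitivity (a * Cconj p * (w0 * u3 - w3 * u0 + (w1 * u2 - w2 * u1)))%C; [ring|].
rewrite Hc. ring.
Qed.

Lemma twistor_lift_horizontal (mu1 mu2 : C) : horizontal (twistor_lift mu1 mu2).
Proof.
intros phi Hphi z F dF HF DF gamma dgamma _ HL Hd a.
destruct (locally_singleton _ _ HF) as [Fn _].
apply fubini_study_zero.
- exact (lift_contact mu1 mu2 phi z F dF Hphi HF DF).
- now apply fiber_tangent with gamma.
Qed.

(** * Inversion of the stereographic projection, and the theorem *)

Lemma sigma2_nonzero (x : R3) : sigma2 x <> zero.
Proof.
destruct x as [[x1 x2] x3]. unfold sigma2. destruct (Req_EM_T x3 (-1)).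
- apply C2_nonzero_r, C1_nz.
- apply C2_nonzero_l, C1_nz.
Qed.

Lemma sigma2_inv_sigma2 (x : R3) : S2 x -> sigma2_inv (sigma2 x) = x.
Proof.
destruct x as [[x1 x2] x3]. unfold S2, sigma2. intros Hx.
destruct (Req_EM_T x3 (-1)) as [-> | Hn].
- assert (x1 = 0) by nra. assert (x2 = 0) by nra. subst.
  unfold sigma2_inv. rewrite Cmod_0, Cmod_1, Cconj_RtoC.
  unfold Re, Im; simpl. apply R3_ext; field.
- assert (P : 0 < 1 + x3) by nra.
  assert (E : ((RtoC x1 + Ci * RtoC x2) / (RtoC 1 + RtoC x3))%C = (x1 / (1 + x3), x2 / (1 + x3))).
  { rewrite <- RtoC_plus. unfold Cdiv. rewrite <- RtoC_inv by lra.
    unfold Cmult, Cplus, Ci, RtoC; simpl. apply f_equal2; field; lra. }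
  rewrite E. unfold sigma2_inv. rewrite Cmod_1, Cconj_RtoC, Cmult_1_l, Cmod2_alt.
  unfold Re, Im; simpl fst; simpl snd.
  assert (EN : 1 ^ 2 + ((x1 / (1 + x3)) ^ 2 + (x2 / (1 + x3)) ^ 2) = 2 / (1 + x3)).
  { transitivity (((1 + x3) ^ 2 + (x1 ^ 2 + x2 ^ 2)) / (1 + x3) ^ 2); [field; lra|].
    replace (x1 ^ 2 + x2 ^ 2) with ((1 - x3) * (1 + x3)) by lra. field. lra. }
  rewrite EN. apply R3_ext; [field; lra|field; lra|].
  replace ((x1 / (1 + x3)) ^ 2 + (x2 / (1 + x3)) ^ 2) with (2 / (1 + x3) - 1) by lra.
  field. lra.
Qed.

Lemma opp_S2pole : opp S2pole = (0, 0, 1).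
Proof. change (((- 0, - 0, - -1) : R3) = (0, 0, 1)). apply R3_ext; ring. Qed.

Lemma scal_equivariant (omega : R3 -> E5) (k : R) :
  equivariant omega -> equivariant (fun x => scal k (omega x)).
Proof.
intros H al x Hx. rewrite H by exact Hx.
destruct (omega x) as [[t [a b]] [c d]].
change (((k * t, (k * (cos al * a - sin al * b), k * (cos al * b + sin al * a)),
    (k * (cos (2 * al) * c - sin (2 * al) * d), k * (cos (2 * al) * d + sin (2 * al) * c))) : E5)
  = (k * t, (cos al * (k * a) - sin al * (k * b), cos al * (k * b) + sin al * (k * a)),
    (cos (2 * al) * (k * c) - sin (2 * al) * (k * d),
     cos (2 * al) * (k * d) + sin (2 * al) * (k * c)))).
apply triple_eq; [ring| |]; apply f_equal2; ring.
Qed.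

Theorem theorem3p19 (omega : R3 -> E5)
    (Hharm : harmonic_sphere omega)
    (Hequi : equivariant omega)
    (Hfull : linearly_full omega) :
  exists eps : R,
    (eps = 1 /\ omega (opp S2pole) = opp S4pole \/
     eps = -1 /\ omega (opp S2pole) = S4pole) /\
    let psi : R3 -> E5 := fun x => scal eps (omega x) in
    exists W : C2 -> C4,
      positive_lift psi W /\
      (forall W' : C2 -> C4, positive_lift psi W' ->
         forall z, z <> zero -> proj_eq (W' z) (W z)) /\
      CP_equivariant W /\ holomorphic W /\ horizontal W /\
      (forall x, S2 x -> psi x = tau (W (sigma2 x))) /\
      exists mu1 mu2 : C,
        mu1 <> RtoC 0 /\ mu2 <> RtoC 0 /\
        (forall z0 z1 : C, (z0, z1) <> zero ->
           proj_eq (W (z0, z1))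
             (z0 ^ 3, mu1 * z0 ^ 2 * z1, mu2 * z0 * z1 ^ 2,
              - (mu1 * mu2 / 3) * z1 ^ 3)%C) /\
        (forall z0 z1 : C, (z0, z1) <> zero ->
           let a0 := Cmod z0 in let a1 := Cmod z1 in
           let m1 := Cmod mu1 in let m2 := Cmod mu2 in
           let D := a0 ^ 6 + m1 ^ 2 * a0 ^ 4 * a1 ^ 2
                    + m2 ^ 2 * a0 ^ 2 * a1 ^ 4
                    + m1 ^ 2 * m2 ^ 2 / 9 * a1 ^ 6 in
           psi (sigma2_inv (z0, z1)) =
             ((a0 ^ 6 - m1 ^ 2 * a0 ^ 4 * a1 ^ 2 - m2 ^ 2 * a0 ^ 2 * a1 ^ 4
                 + m1 ^ 2 * m2 ^ 2 / 9 * a1 ^ 6) / D,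
              (2 * mu1 * Cconj z0 * z1
                 * RtoC (a0 ^ 4 - m2 ^ 2 / 3 * a1 ^ 4) / RtoC D)%C,
              (2 * mu2 * Cconj z0 ^ 2 * z1 ^ 2
                 * RtoC (a0 ^ 2 + m1 ^ 2 / 3 * a1 ^ 2) / RtoC D)%C)).
Proof.
destruct (meridian_profile omega Hharm Hequi Hfull)
  as [eps [m1 [m2 [p1 [r1 [p2 [r2 [Heps [M1 [M2 [U1 [U2 [HP HM]]]]]]]]]]]]].
set (mu1 := (m1 * p1, m1 * r1) : C). set (mu2 := (m2 * p2, m2 * r2) : C).
assert (N : forall m p r, m <> 0 -> p ^ 2 + r ^ 2 = 1 -> ((m * p, m * r) : C) <> RtoC 0).
{ intros m p r Hm U E.
  assert (E1 := f_equal fst E). assert (E2 := f_equal snd E). simpl in E1, E2.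
  destruct (Rmult_integral _ _ E1) as [|Hp]; [easy|].
  destruct (Rmult_integral _ _ E2) as [|Hr]; [easy|]. rewrite Hp, Hr in U. lra. }
assert (N1 : mu1 <> RtoC 0) by now apply N.
assert (N2 : mu2 <> RtoC 0) by now apply N.
exists eps. split.
- rewrite opp_S2pole. specialize (HP 1 (or_introl eq_refl)).
  destruct (omega (0, 0, 1)) as [[t [a b]] [c d]].
  assert (E0 := f_equal (fun y : E5 => fst (fst y)) HP).
  assert (E1 := f_equal (fun y : E5 => fst (snd (fst y))) HP).
  assert (E2 := f_equal (fun y : E5 => snd (snd (fst y))) HP).
  assert (E3 := f_equal (fun y : E5 => fst (snd y)) HP).
  assert (E4 := f_equal (fun y : E5 => snd (snd y)) HP).
  change (eps * t = 1) in E0. change (eps * a = 0) in E1. change (eps * b = 0) in E2.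
  change (eps * c = 0) in E3. change (eps * d = 0) in E4.
  destruct Heps as [-> | ->]; [left|right]; (split; [reflexivity|]);
    [change (opp S4pole) with ((- -1, (- 0, - 0), (- 0, - 0)) : E5)|];
    apply triple_eq; try apply f_equal2; simpl; lra.
- intros psi.
  assert (Hpsi : forall z0 z1 : C, ((z0, z1) : C2) <> zero ->
    psi (sigma2_inv (z0, z1)) = tau (twistor_lift mu1 mu2 (z0, z1))).
  { apply psi_sigma2_inv; trivial. now apply scal_equivariant. }
  exists (twistor_lift mu1 mu2).
  refine (conj _ (conj _ (conj _ (conj _ (conj _ (conj _ _)))))).
  + split. now apply twistor_lift_holomorphic.
    intros z Hz. apply (positive_lift_formulas psi mu1 mu2 N1 N2 Hpsi _ z Hz). apply proj_eq_refl.
  + intros W' [HW' HF]. apply twistor_lift_unique; trivial.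
    intros z Hz. apply (positive_lift_formulas psi mu1 mu2 N1 N2 Hpsi _ z Hz). now apply HF.
  + intros al z _. rewrite twistor_lift_rot. apply proj_eq_refl.
  + now apply twistor_lift_holomorphic.
  + apply twistor_lift_horizontal.
  + intros x Hx. rewrite <- (sigma2_inv_sigma2 x Hx) at 1.
    pose proof (sigma2_nonzero x) as Hs. destruct (sigma2 x) as [z0 z1]. now apply Hpsi.
  + exists mu1, mu2. repeat (split; [assumption|]). split.
    * intros z0 z1 _. apply proj_eq_refl.
    * intros z0 z1 Hz. cbv zeta. rewrite Hpsi by exact Hz. apply tau_twistor_lift.
Qed.
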